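(* Let $r\ge1$ and let $(\pi:\mathcal X\to M,\ J,\ L)$ be a scale-invariant special K\''ahler (SK) geometry of rank $r$ over a connected complex manifold $M$ of dimension $r$ (the regular locus of a Coulomb branch). Suppose it is completely split: for all $u$ in a dense open subset of $M$, the fiber $X_u$ is isomorphic, as a complex torus (with no condition on polarizations), to a product $X^1_u\times\cdots\times X^r_u$ of $r$ one-dimensional complex tori. Then the SK geometry is isotrivial.
   Context: A polarized abelian variety (p.a.v.) of rank $r$ is a pair $(X,J)$ where $X=V/\Lambda$ is an $r$-dimensional complex torus and $J$ is a polarization, i.e. a non-degenerate integral skew-symmetric form on $\Lambda=H_1(X,\mathbb Z)$ that is the imaginary part of a positive-definite hermitian form on $V$. There is a basis $\{\alpha_i,\beta^i\}$ of $\Lambda$ in which $J=\begin{pmatrix}0&\Delta\\-\Delta&0\end{pmatrix}$, $\Delta=\mathrm{diag}(d_1,\dots,d_r)$ with positive integers $d_i\mid d_{i+1}$ (a symplectic basis), and a basis $\{\theta^i\}$ of holomorphic $1$-forms with $\int_{\alpha_i}\theta^j=\Delta^j_i$; then $\tau^{ij}=\int_{\beta^i}\theta^j$ is symmetric with positive-definite imaginary part and is called the modulus. An SK geometry of rank $r$ over $M$ consists of a holomorphic family $\pi:\mathcal X\to M$ of $r$-dimensional complex tori $X_u=\pi^{-1}(u)$, a polarization $J$ on the fibers that is locally constant on the lattices $H_1(X_u,\mathbb Z)$, making each $(X_u,J)$ a p.a.v., and a closed non-degenerate holomorphic $(2,0)$-form $L$ on $\mathcal X$ whose restriction to each fiber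 vanishes. It is scale-invariant if there is a holomorphic local action $(\lambda,u)\mapsto\lambda\circ u$ of $\mathbb C^\times$ near the identity: every point of $M$ has a neighborhood $U$ and an $\epsilon>0$ such that $\lambda\circ u\in M$ is defined and holomorphic for $u\in U$, $\lambda\in B_\epsilon=\{|\lambda-1|<\epsilon\}$, with $1\circ u=u$, $\lambda\circ(\mu\circ u)=(\lambda\mu)\circ u$ whenever defined, and $\lambda\circ u\ne u$ for $\lambda\neq1$; and this action lifts to a holomorphic local action on $\mathcal X$ covering it that maps fibers $X_u\to X_{\lambda\circ u}$ by isomorphisms of p.a.v.s and satisfies $\lambda^*L=\lambda L$. The SK geometry is isotrivial if, on every contractible open subset $\mathcal C\subset M$, with respect to a locally constant symplectic basis of the fiber homology, the modulus $\tau^{ij}(u)$ is constant on $\mathcal C$ (equivalently, $\tau$ is locally constant on $M$). *)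

(* Defs.v *)
From HB Require Import structures.
From mathcomp Require Import all_boot all_order all_algebra.
From mathcomp Require Import all_classical all_reals all_analysis.
From mathcomp Require Import complex.

Set Implicit Arguments.
Unset Strict Implicit.
Unset Printing Implicit Defensive.

Import Order.TTheory GRing.Theory Num.Theory.
Import numFieldNormedType.Exports.

Local Open Scope classical_set_scope.
Local Open Scope ring_scope.

(* R[i] is presented as a numClosedFieldType because the norm topology of the
   library is attached to that structure, and not directly to the type R[i]. *)
Definition Cx (R : realType) : numClosedFieldType := R[i].

Definition ofReal (R : realType) (t : R) : Cx R := (t%:C)%C.

(* Vectors are row vectors: a linear map sends v to v *m A, and the matrix of
   the differential of f is jacobian f, with 'd f x v = v *m jacobian f x. *)

(* A chart of T with values in E. The functions are total, but chart_map is
   meaningful on chart_dom only, and chart_inv on its image. *)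
Record chart (T E : Type) := Chart {
  chart_dom : set T;
  chart_map : T -> E;
  chart_inv : E -> T
}.

Section Charts.
Variable R : realType.

Definition is_chart (T : topologicalType) (E : normedModType (Cx R))
    (c : chart T E) : Prop :=
  [/\ open (chart_dom c), open (chart_map c @` chart_dom c),
      forall x, chart_dom c x -> chart_inv c (chart_map c x) = x,
      forall x, chart_dom c x -> {for x, continuous (chart_map c)}
    & forall y, (chart_map c @` chart_dom c) y ->
        {for y, continuous (chart_inv c)}].

Definition vector_atlas (E : Type) : set (chart E E) :=
  [set Chart setT id id].

Definition prod_chart (T T' E E' : Type) (c : chart T E) (c' : chart T' E') :
    chart (T * T')%type (E * E')%type :=
  Chart (chart_dom c `*` chart_dom c')
        (fun z => (chart_map c z.1, chart_map c' z.2))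
        (fun z => (chart_inv c z.1, chart_inv c' z.2)).

Definition prod_atlas (T T' E E' : Type)
    (A : set (chart T E)) (A' : set (chart T' E')) :
    set (chart (T * T')%type (E * E')%type) :=
  [set c | exists c1 c2, [/\ A c1, A' c2 & c = prod_chart c1 c2]].

(* Holomorphy of f at the points of an OPEN set W: f is continuous and its
   coordinate expressions are complex (Frechet) differentiable. *)
Definition holomorphic_on (T T' : topologicalType) (E E' : normedModType (Cx R))
    (A : set (chart T E)) (A' : set (chart T' E')) (W : set T) (f : T -> T') :
    Prop :=
  forall x, W x -> {for x, continuous f} /\
    forall c c', A c -> A' c' -> chart_dom c x -> chart_dom c' (f x) ->
      differentiable (fun y => chart_map c' (f (chart_inv c y)))
                     (chart_map c x).

Record complexManifold (n : nat) := ComplexManifold {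
  space :> topologicalType;
  atlas : set (chart space 'rV[Cx R]_n);
  space_hausdorff : hausdorff_space space;
  space_second_countable : @second_countable space;
  atlas_is_chart : forall c, atlas c -> is_chart c;
  atlas_cover : forall x, exists2 c, atlas c & chart_dom c x;
  atlas_compatible : forall c c', atlas c -> atlas c' ->
      forall x, chart_dom c x -> chart_dom c' x ->
        differentiable (chart_map c' \o chart_inv c) (chart_map c x)
}.

Definition contractible (T : topologicalType) (C : set T) : Prop :=
  exists (x0 : T) (H : R * T -> T),
    [/\ C x0,
        {within `[0, 1]%classic `*` C, continuous H},
        forall t x, 0 <= t <= 1 -> C x -> C (H (t, x))
      & forall x, C x -> H (0, x) = x /\ H (1, x) = x0].

End Charts.

Arguments vector_atlas : clear implicits.
Arguments atlas {R n} c : rename.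

Section Tori.
Variables (R : realType) (r : nat).
Variables (M : complexManifold R r) (X : complexManifold R (r + r)).
Variable proj : X -> M.

Local Notation K := (Cx R).
Local Notation fiber u := [set x : X | proj x = u].

Definition intmx (m n : nat) (N : 'M[int]_(m, n)) : 'M[K]_(m, n) :=
  map_mx intr N.

(* The 2n rows of P are linearly independent over the reals, i.e. they generate
   a lattice Z^2n P in C^n. *)
Definition is_lattice_basis (n : nat) (P : 'M[K]_(n + n, n)) : Prop :=
  forall c : 'rV[K]_(n + n),
    (forall a, c 0 a \is Num.real) -> c *m P = 0 -> c = 0.

(* p induces an isomorphism of the complex torus C^r / Z^2r P onto X_u. *)
Definition uniformizes (u : M) (p : 'rV[K]_r -> X) (P : 'M[K]_(r + r, r)) :
    Prop :=
  [/\ is_lattice_basis P,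
      holomorphic_on (vector_atlas _) (atlas X) setT p,
      range p = fiber u,
      forall v w, p v = p w <-> exists n : 'rV[int]_(r + r), v - w = intmx n *m P
    & forall v d, atlas X d -> chart_dom d (p v) ->
        row_free (jacobian (chart_map d \o p) v)].

(* X is identified over U with the quotient of U x C^r by the lattices
   Z^2r (P u), which depend holomorphically on u. *)
Definition torus_chart (U : set M) (Phi : M * 'rV[K]_r -> X)
    (P : M -> 'M[K]_(r + r, r)) : Prop :=
  [/\ open U,
      holomorphic_on (atlas M) (vector_atlas _) U P,
      holomorphic_on (prod_atlas (atlas M) (vector_atlas _))
        (atlas X) (U `*` setT) Phi
    & forall u, U u -> uniformizes u (fun v => Phi (u, v)) (P u)].

(* A holomorphic family of complex tori V_u / Lambda_u; no section of proj is
   singled out. *)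
Definition torus_family : Prop :=
  holomorphic_on (atlas X) (atlas M) setT proj /\
  forall u0, exists U Phi P, U u0 /\ torus_chart U Phi P.

(* A loop is a function on R, of which only the restriction to [0, 1]
   matters. *)
Definition fiber_loop (u : M) (g : R -> X) : Prop :=
  [/\ {within `[0, 1]%classic, continuous g},
      forall t, 0 <= t <= 1 -> proj (g t) = u & g 0 = g 1].

(* The class of the loop g in H_1(X_u, Z) = Z^2r P, X_u = C^r / Z^2r P, has
   coordinates n in the basis of the rows of P: n P is the difference of the end
   points of a lift of g to C^r. *)
Definition loop_class (p : 'rV[K]_r -> X) (P : 'M[K]_(r + r, r))
    (g : R -> X) (n : 'rV[int]_(r + r)) : Prop :=
  exists h : R -> 'rV[K]_r,
    [/\ {within `[0, 1]%classic, continuous h},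
        forall t, 0 <= t <= 1 -> g t = p (h t)
      & h 1 - h 0 = intmx n *m P].

Definition period_loop (p : 'rV[K]_r -> X) (P : 'M[K]_(r + r, r))
    (a : 'I_(r + r)) : R -> X :=
  fun t => p (ofReal t *: row a P).

(* A pairing on H_1(X_u, Z) is given by its values on pairs of loops in X_u (its
   values on other functions are irrelevant). *)
Variable pol : M -> (R -> X) -> (R -> X) -> int.

(* The last clause says that E is the restriction to the lattice of Im H, for a
   positive-definite hermitian form H. With H antilinear in its FIRST argument,
   J(alpha, beta) = Delta is the convention for which Im tau is positive. *)
Definition polarization_at (u : M) : Prop :=
  forall p P, uniformizes u p P ->
  exists E : 'M[int]_(r + r),
    [/\ forall g h n m, loop_class p P g n -> loop_class p P h m ->
          pol u g h = (n *m E *m m^T) 0 0,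
        E^T = - E,
        \det E != 0
      & exists H : 'M[K]_r,
        [/\ map_mx Num.conj H^T = H,
            forall v : 'rV[K]_r, v != 0 ->
              0 < (map_mx Num.conj v *m H *m v^T) 0 0
          & forall a b, (E a b)%:~R =
              'Im ((map_mx Num.conj (row a P) *m H *m (row b P)^T) 0 0)]].

(* The loops Phi(u, t P_a(u)) form the locally constant basis of H_1(X_u, Z)
   defined by a torus chart. *)
Definition polarized_family : Prop :=
  (forall u, polarization_at u) /\
  forall U Phi P, torus_chart U Phi P ->
  let loop u a := period_loop (fun v => Phi (u, v)) (P u) a in
  forall u0, U u0 -> forall a b, \forall u \near u0,
    pol u (loop u a) (loop u b) = pol u0 (loop u0 a) (loop u0 b).

Definition pav_isomorphism (u w : M) (f : X -> X) : Prop :=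
  (exists g : X -> X,
    [/\ forall x, proj x = u -> proj (f x) = w /\ g (f x) = x,
        forall y, proj y = w -> proj (g y) = u /\ f (g y) = y,
        forall p P, uniformizes u p P ->
          holomorphic_on (vector_atlas _) (atlas X) setT (f \o p)
      & forall p P, uniformizes w p P ->
          holomorphic_on (vector_atlas _) (atlas X) setT (g \o p)]) /\
  forall g h, fiber_loop u g -> fiber_loop u h ->
    pol w (f \o g) (f \o h) = pol u g h.

Definition polarization_type (D : 'I_r -> nat) : Prop :=
  (forall i, 0 < D i)%N /\
  forall i j : 'I_r, i.+1 = j :> nat -> (D i %| D j)%N.

(* The loops s (lshift r i) are alpha_i, the loops s (rshift r i) are beta^i. *)
Definition symplectic_basis (u : M) (D : 'I_r -> nat)
    (s : 'I_(r + r) -> R -> X) : Prop :=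
  let J : 'M[int]_(r + r) :=
    block_mx 0 (diag_mx (\row_i (D i)%:Z)) (- diag_mx (\row_i (D i)%:Z)) 0 in
  (forall a, fiber_loop u (s a)) /\
  (exists p P (N : 'M[int]_(r + r)),
    [/\ uniformizes u p P, forall a, loop_class p P (s a) (row a N)
      & N \in unitmx]) /\
  forall a b, pol u (s a) (s b) = J a b.

(* Over C, the class of s u in H_1(X_u, Z) is locally constant. *)
Definition locally_constant_class (C : set M) (s : M -> R -> X) : Prop :=
  forall U Phi P, torus_chart U Phi P -> forall u0, C u0 -> U u0 ->
  exists n, \forall u \near u0, C u ->
    loop_class (fun v => Phi (u, v)) (P u) (s u) n.

(* The holomorphic 1-forms on C^r / Z^2r P are the constant ones; the columns of
   T are a basis theta^1 .. theta^r of them, and the integral of theta^j along a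
   loop of class n is the j-th entry of n P T. So the two equations say that the
   integral of theta^j along alpha_i is Delta^j_i, and along beta^i is
   tau^{ij}. *)
Definition modulus (u : M) (D : 'I_r -> nat) (s : 'I_(r + r) -> R -> X)
    (tau : 'M[K]_r) : Prop :=
  exists p P (N : 'M[int]_(r + r)) (T : 'M[K]_r),
    [/\ uniformizes u p P,
        forall a, loop_class p P (s a) (row a N),
        T \in unitmx,
        usubmx (intmx N *m P) *m T = diag_mx (\row_i (D i)%:R)
      & dsubmx (intmx N *m P) *m T = tau].

Definition isotrivial_family : Prop :=
  forall C : set M, open C -> contractible R C ->
  forall (D : 'I_r -> nat) (s : M -> 'I_(r + r) -> R -> X),
    polarization_type D ->
    (forall u, C u -> symplectic_basis u D (s u)) ->
    (forall a, locally_constant_class C (fun u => s u a)) ->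
  exists tau, forall u, C u -> modulus u D (s u) tau.

(* The period matrix of the product of the tori C / (Z Q_i00 + Z Q_i10). *)
Definition product_lattice (Q : 'I_r -> 'M[K]_(1 + 1, 1)) : 'M[K]_(r + r, r) :=
  col_mx (diag_mx (\row_i usubmx (Q i) 0 0)) (diag_mx (\row_i dsubmx (Q i) 0 0)).

Definition split_fiber (u : M) : Prop :=
  exists Q : 'I_r -> 'M[K]_(1 + 1, 1),
    (forall i, is_lattice_basis (Q i)) /\
    exists p, uniformizes u p (product_lattice Q).

Definition split_family : Prop :=
  exists S : set M, [/\ open S, dense S & forall u, S u -> split_fiber u].

(* A (2,0)-form is given by its coefficient matrix L d x in the chart d at x:
   the form maps tangent vectors v, w (in the chart d) to v (L d x) w^T. *)
Variable L : chart X 'rV[K]_(r + r) -> X -> 'M[K]_(r + r).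

Definition holomorphic_2form : Prop :=
  (forall d, atlas X d ->
    holomorphic_on (atlas X) (vector_atlas _) (chart_dom d) (L d) /\
    forall x, chart_dom d x -> (L d x)^T = - L d x) /\
  forall d d', atlas X d -> atlas X d' ->
  forall x, chart_dom d x -> chart_dom d' x ->
    let A := jacobian (chart_map d' \o chart_inv d) (chart_map d x) in
    A *m L d' x *m A^T = L d x.

Definition closed_2form : Prop :=
  forall d, atlas X d -> forall x, chart_dom d x ->
  let partial i : 'M[K]_(r + r) :=
    'd (L d \o chart_inv d) (chart_map d x) (delta_mx 0 i) in
  forall i j k, partial i j k + partial j k i + partial k i j = 0.

Definition nondegenerate_2form : Prop :=
  forall d x, atlas X d -> chart_dom d x -> L d x \in unitmx.

(* The tangent space of the fiber through x is the kernel of the differential of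
   proj at x. *)
Definition vanishes_on_fibers : Prop :=
  forall d c, atlas X d -> atlas M c ->
  forall x, chart_dom d x -> chart_dom c (proj x) ->
  let A := jacobian (chart_map c \o proj \o chart_inv d) (chart_map d x) in
  forall v w : 'rV[K]_(r + r), v *m A = 0 -> w *m A = 0 ->
    v *m L d x *m w^T = 0.

(* f^* L = lambda L at x. *)
Definition scales_2form_at (lambda : K) (f : X -> X) (x : X) : Prop :=
  forall d d', atlas X d -> atlas X d' -> chart_dom d x -> chart_dom d' (f x) ->
    let A := jacobian (chart_map d' \o f \o chart_inv d) (chart_map d x) in
    A *m L d' (f x) *m A^T = lambda *: L d x.

End Tori.

(* A holomorphic local action of C^* near 1; act (lambda, u) is defined for
   (lambda, u) in the open set D. *)
Definition local_action (R : realType) (n : nat) (Y : complexManifold R n)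
    (D : set (Cx R * Y)) (act : Cx R * Y -> Y) : Prop :=
  [/\ open D /\ (forall l u, D (l, u) -> l != 0),
      forall u0, exists (U : set Y) (e : R),
        [/\ open U, U u0, 0 < e
          & forall l u, U u -> `|l - 1| < ofReal e -> D (l, u)],
      holomorphic_on (prod_atlas (vector_atlas ((Cx R)^o : normedModType (Cx R)))
                        (atlas Y)) (atlas Y) D act,
      forall u, act (1, u) = u
    & forall l m u, D (m, u) -> D (l, act (m, u)) -> D (l * m, u) ->
        act (l, act (m, u)) = act (l * m, u)].

Record SKGeometry (R : realType) (r : nat) := MkSKGeometry {
  base : complexManifold R r;
  total : complexManifold R (r + r);
  proj : total -> base;
  pol : base -> (R -> total) -> (R -> total) -> int;
  form : chart total 'rV[Cx R]_(r + r) -> total -> 'M[Cx R]_(r + r);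
  sk_torus_family : torus_family proj;
  sk_polarized : polarized_family proj pol;
  sk_form_holomorphic : holomorphic_2form form;
  sk_form_closed : closed_2form form;
  sk_form_nondegenerate : nondegenerate_2form form;
  sk_form_fibers : vanishes_on_fibers proj form
}.

Arguments proj {R r} G : rename.
Arguments pol {R r} G : rename.
Arguments form {R r} G : rename.

Section SKProperties.
Variables (R : realType) (r : nat) (G : SKGeometry R r).

Definition scale_invariant : Prop :=
  exists (D : set (Cx R * base G)) (act : Cx R * base G -> base G)
         (lift : Cx R * total G -> total G),
    [/\ local_action D act,
        forall l u, D (l, u) -> l != 1 -> act (l, u) <> u,
        local_action [set z | D (z.1, proj G z.2)] lift,
        forall l u, D (l, u) ->
          pav_isomorphism (proj G) (pol G) u (act (l, u))
            (fun x => lift (l, x))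
      & forall l x, D (l, proj G x) ->
          scales_2form_at (form G) l (fun y => lift (l, y)) x].

Definition completely_split : Prop := split_family (proj G).

Definition isotrivial : Prop :=
  isotrivial_family (proj G) (pol G).

End SKProperties.

(* Main.v *)
Require Import Defs.
From HB Require Import structures.
From mathcomp Require Import all_boot all_order all_algebra.
From mathcomp Require Import all_classical all_reals all_analysis.
From mathcomp Require Import complex.
From mathcomp Require Import ring lra.

Set Implicit Arguments.
Unset Strict Implicit.
Unset Printing Implicit Defensive.

Import Order.TTheory GRing.Theory Num.Theory.
Import numFieldNormedType.Exports.

Local Open Scope classical_set_scope.
Local Open Scope ring_scope.

(** On a torus chart Phi : U x C^r -> X with period matrix P, pull L back along
    (lambda, z, v) |-> lambda o Phi (z, v). At lambda = 1 the blocks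
    xi = L(d_lambda, d_v) and B = L(d_z, d_v) are entire and Z^2r P-periodic in
    v, hence independent of v by Liouville's theorem, and B is invertible
    because the fibers are Lagrangian. Closedness of the pullback, together
    with lambda^* L = lambda L, gives d alpha_a = B P_a for the special
    coordinates alpha_a = xi . P_a.

    If the fibers over an open set are split, then by Baire's theorem a fixed
    integer change of basis achieves P_(r+i) = tau_i P_i over a smaller open
    set. Then alpha_(r+i) = tau_i alpha_i, whereas
    d alpha_(r+i) = B P_(r+i) = tau_i d alpha_i, so that alpha_i d tau_i = 0;
    since d alpha_i = B P_i has no zero, tau_i is constant. So P (u) = Q T(u)
    there, with Q constant and T(u) invertible.

    By Baire's theorem and the identity theorem, the set of the points near
    which P has this form is closed, hence it is the whole of M. The modulus is
    a quotient of two blocks of N P for a locally constant integer matrix N, so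
    T(u) cancels. *)

(** * The norm of R[i] as a real number *)

Section RealNorm.
Variable R : realType.
Local Notation K := (Cx R).

Definition rn (V : normedZmodType K) (x : V) : R := complex.Re (`|x| : R[i]).

Lemma rnE (V : normedZmodType K) (x : V) : `|x| = ofReal (rn x) :> K.
Proof. by rewrite /ofReal /rn RRe_real // normr_real. Qed.

Lemma ofRealD (x y : R) : ofReal (x + y) = ofReal x + ofReal y.
Proof. exact: rmorphD. Qed.
Lemma ofRealM (x y : R) : ofReal (x * y) = ofReal x * ofReal y.
Proof. exact: rmorphM. Qed.
Lemma ofRealN (x : R) : ofReal (- x) = - ofReal x.
Proof. exact: rmorphN. Qed.
Lemma ofRealB (x y : R) : ofReal (x - y) = ofReal x - ofReal y.
Proof. exact: rmorphB. Qed.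
Lemma ofReal0 : ofReal (0 : R) = 0. Proof. by []. Qed.
Lemma ofReal1 : ofReal (1 : R) = 1. Proof. by []. Qed.
Lemma ofReal_nat n : ofReal (n%:R : R) = n%:R.
Proof. exact: rmorph_nat. Qed.
Lemma ofReal_int n : ofReal (n%:~R : R) = n%:~R.
Proof. exact: rmorph_int. Qed.
Lemma ofRealV (x : R) : ofReal (x^-1) = (ofReal x)^-1.
Proof. exact: fmorphV. Qed.
Lemma ofReal_inj : injective (@ofReal R).
Proof. exact: complexI. Qed.
Lemma ofReal_eq0 (x : R) : (ofReal x == 0) = (x == 0).
Proof. by rewrite -ofReal0 (inj_eq ofReal_inj). Qed.
Lemma ler_ofReal (x y : R) : (ofReal x <= ofReal y) = (x <= y).
Proof. exact: lecR. Qed.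
Lemma ltr_ofReal (x y : R) : (ofReal x < ofReal y) = (x < y).
Proof. exact: ltcR. Qed.
Lemma norm_ofReal (x : R) : `|ofReal x| = ofReal `|x|.
Proof.
case: (ger0P x) => h.
- by rewrite ger0_norm // -ofReal0 ler_ofReal.
- by rewrite ltr0_norm ?ofRealN // -ofReal0 ltr_ofReal.
Qed.

Lemma gt0_ofReal (e : K) : 0 < e -> exists2 d : R, 0 < d & e = ofReal d.
Proof.
move=> e0; exists (complex.Re (e : R[i])).
  by move: e0; case: e => a b; rewrite ltcE /= => /andP[].
by rewrite /ofReal RRe_real // gtr0_real.
Qed.

Section Basic.
Variable V : normedZmodType K.
Implicit Types x y : V.

Lemma rn_ge0 x : 0 <= rn x.
Proof. by rewrite -ler_ofReal -rnE ofReal0. Qed.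
Lemma rn0 : rn (0 : V) = 0.
Proof. by apply: ofReal_inj; rewrite -rnE normr0. Qed.
Lemma rn_eq0 x : (rn x == 0) = (x == 0).
Proof. by rewrite -ofReal_eq0 -rnE normr_eq0. Qed.
Lemma rnN x : rn (- x) = rn x.
Proof. by apply: ofReal_inj; rewrite -!rnE normrN. Qed.
Lemma rnD x y : rn (x + y) <= rn x + rn y.
Proof. by rewrite -ler_ofReal ofRealD -!rnE ler_normD. Qed.
Lemma rnB x y : rn (x - y) <= rn x + rn y.
Proof. by rewrite -(rnN y) rnD. Qed.
Lemma rn_distC x y : rn (x - y) = rn (y - x).
Proof. by rewrite -rnN opprB. Qed.
Lemma rn_tri x y z : rn (x - z) <= rn (x - y) + rn (y - z).
Proof. by rewrite -[x - z](_ : (x - y) + (y - z) = _) ?rnD // addrA subrK. Qed.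
Lemma rn_rev x y : rn x - rn y <= rn (x - y).
Proof. by rewrite lerBlDr -{1}(subrK y x) rnD. Qed.
Lemma rn_sum I (s : seq I) (P : pred I) (F : I -> V) :
  rn (\sum_(i <- s | P i) F i) <= \sum_(i <- s | P i) rn (F i).
Proof.
elim/big_rec2: _ => [|i a b _ h]; first by rewrite rn0.
by apply: le_trans (rnD _ _) _; rewrite lerD2l.
Qed.
Lemma rn_gt0 x : (0 < rn x) = (x != 0).
Proof. by rewrite lt_neqAle rn_ge0 andbT eq_sym rn_eq0. Qed.
End Basic.

Lemma rnM (x y : K) : rn (x * y) = rn x * rn y.
Proof. by apply: ofReal_inj; rewrite ofRealM -!rnE normrM. Qed.
Lemma rn1 : rn (1 : K) = 1.
Proof. by apply: ofReal_inj; rewrite -rnE normr1. Qed.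
Lemma rnV (x : K) : rn (x^-1) = (rn x)^-1.
Proof. by apply: ofReal_inj; rewrite ofRealV -!rnE normfV. Qed.
Lemma rnX (x : K) n : rn (x ^+ n) = rn x ^+ n.
Proof. by elim: n => [|n IH]; rewrite ?expr0 ?rn1 // !exprS rnM IH. Qed.
Lemma rn_ofReal (x : R) : rn (ofReal x) = `|x|.
Proof. by apply: ofReal_inj; rewrite -rnE norm_ofReal. Qed.
Lemma rnZ (V : normedModType K) (k : K) (x : V) : rn (k *: x) = rn k * rn x.
Proof. by apply: ofReal_inj; rewrite ofRealM -!rnE normrZ. Qed.

Lemma rn_Re (z : K) : `|complex.Re z| <= rn z.
Proof. by rewrite -ler_ofReal -rnE; exact: normc_ge_Re. Qed.

Lemma rn_i : rn ('i : K) = 1.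
Proof. by apply: ofReal_inj; rewrite -rnE normCi. Qed.

Lemma rn_Im (z : K) : `|complex.Im z| <= rn z.
Proof.
have := rn_Re (- (z * 'i)); rewrite rnN rnM rn_i mulr1; apply: le_trans.
by rewrite -complexiE raddfN /= normrN ReiNIm normrN.
Qed.

Lemma KE (z : K) : z = ofReal (complex.Re z) + 'i * ofReal (complex.Im z).
Proof. by rewrite {1}[z]complexE -complexiE. Qed.

Definition cpx (x y : R) : K := ofReal x + 'i * ofReal y.

Lemma cpxE (x y : R) : cpx x y = Complex x y.
Proof. by rewrite /cpx -complexiE [RHS]complexE. Qed.

Lemma cpx_Re x y : complex.Re (cpx x y : R[i]) = x.
Proof. by rewrite cpxE. Qed.
Lemma cpx_Im x y : complex.Im (cpx x y : R[i]) = y.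
Proof. by rewrite cpxE. Qed.

Lemma rn_cpx (x y : R) : rn (cpx x y) <= `|x| + `|y|.
Proof.
by apply: le_trans (rnD _ _) _; rewrite rnM rn_i mul1r !rn_ofReal.
Qed.

Lemma nbhs_rnP (V : normedModType K) (x : V) (A : set V) :
  nbhs x A <-> exists2 e : R, 0 < e & forall y, rn (y - x) < e -> A y.
Proof.
split=> [/nbhs_normP[e /= e0 h]|[e e0 h]].
  have [d d0 ee] := gt0_ofReal e0; exists d => // y hy; apply: h => /=.
  by rewrite ee rnE ltr_ofReal rn_distC.
apply/nbhs_normP; exists (ofReal e) => /=; first by rewrite -ofReal0 ltr_ofReal.
by move=> y /=; rewrite rnE ltr_ofReal rn_distC; exact: h.
Qed.

Lemma continuous_rnP (V W : normedModType K) (f : V -> W) (x : V) :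
  {for x, continuous f} <->
  forall e : R, 0 < e -> exists2 d : R, 0 < d &
    forall y, rn (y - x) < d -> rn (f y - f x) < e.
Proof.
split=> [h e e0|h A].
  have /h : nbhs (f x) [set y | rn (y - f x) < e].
    by apply/nbhs_rnP; exists e.
  by rewrite nbhs_simpl /= => /nbhs_rnP[d d0 hd]; exists d.
rewrite nbhs_simpl => /nbhs_rnP[e e0 he]; have [d d0 hd] := h e e0.
apply/(@nbhs_rnP _ x (f @^-1` A)); exists d => // y hy; apply: he; exact: hd.
Qed.

End RealNorm.

(* The field tactics are much faster over an abstract field than over R[i]. *)
Ltac absK R :=
  repeat match goal with
  | h : ?P |- _ => match type of P with Prop => clear h end
  end;
  repeat match goal with
  | |- context [@ofReal R ?x] => generalize (@ofReal R x); intro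
  | |- context [@cpx R ?x ?y] => generalize (@cpx R x y); intro
  end;
  repeat match goal with
  | x : Num.ClosedField.sort (Cx R) |- _ => revert x
  end;
  generalize (Cx R).

(** * Integrals of complex functions *)

Section PathIntegral.
Variable R : realType.
Local Notation K := (Cx R).
Local Notation mu := (@lebesgue_measure R).

Definition ccont (phi : R -> K) (a b : R) : Prop :=
  {within `[a, b], continuous (fun x => complex.Re (phi x) : R)} /\
  {within `[a, b], continuous (fun x => complex.Im (phi x) : R)}.

Definition cint (phi : R -> K) (a b : R) : K :=
  cpx (\int[mu]_(x in `[a, b]) complex.Re (phi x))
      (\int[mu]_(x in `[a, b]) complex.Im (phi x)).

Lemma cReM (z w : K) : complex.Re (z * w) =
  complex.Re z * complex.Re w - complex.Im z * complex.Im w.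
Proof. by case: z; case: w. Qed.
Lemma cImM (z w : K) : complex.Im (z * w) =
  complex.Re z * complex.Im w + complex.Im z * complex.Re w.
Proof. by case: z; case: w. Qed.

Lemma ccontP (phi : R -> K) a b :
  (forall x, a <= x <= b -> forall e : R, 0 < e -> exists2 d : R, 0 < d &
     forall y, `|y - x| < d -> rn (phi y - phi x) < e) ->
  ccont phi a b.
Proof.
move=> h; split; apply: continuous_in_subspaceT => x /[!inE] /=;
  rewrite in_itv /= => xab A /nbhs_normP[e /= e0 he];
  have [d d0 hd] := h x xab e e0; apply/nbhs_normP; exists d => //= y hy;
  apply: he => /=; rewrite distrC -raddfB.
  apply: le_lt_trans (rn_Re _) _; apply: hd; by rewrite distrC.
by apply: le_lt_trans (rn_Im _) _; apply: hd; rewrite distrC.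
Qed.

Lemma ccont_int phi a b : ccont phi a b ->
  mu.-integrable `[a, b] (EFin \o (fun x => complex.Re (phi x) : R)) /\
  mu.-integrable `[a, b] (EFin \o (fun x => complex.Im (phi x) : R)).
Proof.
move=> [h1 h2]; split;
by apply: continuous_compact_integrable => //; exact: segment_compact.
Qed.

Lemma Rint_split (f : R -> R) a b c : a <= b -> b <= c ->
  mu.-integrable `[a, c] (EFin \o f) ->
  \int[mu]_(x in `[a, c]) f x =
  \int[mu]_(x in `[a, b]) f x + \int[mu]_(x in `[b, c]) f x.
Proof.
move=> ab bc fi.
have := @Rintegral_itvB _ f (BLeft a) (BRight c) b fi.
rewrite !bnd_simp => /(_ ab bc) h; rewrite -[LHS](subrK (\int[mu]_(x in `[a, b]) f x)) h.
rewrite addrC Rintegral_itv_obnd_cbnd //.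
apply: integrableS fi => // x /=; rewrite !in_itv /= => /andP[bx ->].
by rewrite (le_trans ab (ltW bx)).
Qed.

Lemma cint_split phi a b c : a <= b -> b <= c -> ccont phi a c ->
  cint phi a c = cint phi a b + cint phi b c.
Proof.
move=> ab bc /ccont_int[i1 i2].
by rewrite /cint (Rint_split ab bc i1) (Rint_split ab bc i2) /cpx !ofRealD mulrDr addrACA.
Qed.

Lemma cintD phi psi a b : ccont phi a b -> ccont psi a b ->
  cint (fun x => phi x + psi x) a b = cint phi a b + cint psi a b.
Proof.
move=> /ccont_int[i1 i2] /ccont_int[j1 j2]; rewrite /cint.
under eq_Rintegral do rewrite raddfD /=.
rewrite RintegralD //.
under [X in cpx _ X]eq_Rintegral do rewrite raddfD /=.
rewrite RintegralD //.
by rewrite /cpx !ofRealD mulrDr addrACA.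
Qed.

Lemma cintZ (k : K) phi a b : ccont phi a b ->
  cint (fun x => k * phi x) a b = k * cint phi a b.
Proof.
move=> /ccont_int[i1 i2]; rewrite /cint.
set p := complex.Re (k : R[i]); set q := complex.Im (k : R[i]).
have mI : measurable `[a, b]%classic by exact: measurable_itv.
have -> : \int[mu]_(x in `[a, b]) complex.Re (k * phi x : K) =
  p * \int[mu]_(x in `[a, b]) complex.Re (phi x) -
  q * \int[mu]_(x in `[a, b]) complex.Im (phi x).
  rewrite -!RintegralZl // -RintegralB //; last 2 first.
  - exact: integrableZl i1.
  - exact: integrableZl i2.
  by apply: eq_Rintegral => x _; rewrite cReM.
have -> : \int[mu]_(x in `[a, b]) complex.Im (k * phi x : K) =
  p * \int[mu]_(x in `[a, b]) complex.Im (phi x) +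
  q * \int[mu]_(x in `[a, b]) complex.Re (phi x).
  rewrite -!RintegralZl // -RintegralD //; last 2 first.
  - exact: integrableZl i2.
  - exact: integrableZl i1.
  by apply: eq_Rintegral => x _; rewrite cImM.
move: (\int[mu]_(x in _) _) (\int[mu]_(x in _) _) => u v.
by rewrite !cpxE [k in RHS](KE k) -/p -/q -/(cpx p q) cpxE.
Qed.

Lemma ccontZ (k : K) phi a b : ccont phi a b ->
  ccont (fun x => k * phi x) a b.
Proof.
move=> [h1 h2]; case: k => p q; split.
  rewrite (_ : (fun x => _) = (fun x => p * complex.Re (phi x) - q * complex.Im (phi x)));
    last by apply/funext => x; rewrite cReM.
  by move=> x; apply: cvgB; apply: cvgM;
    [exact: cvg_cst|exact: h1|exact: cvg_cst|exact: h2].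
rewrite (_ : (fun x => _) = (fun x => p * complex.Im (phi x) + q * complex.Re (phi x)));
    last by apply/funext => x; rewrite cImM.
by move=> x; apply: cvgD; apply: cvgM;
    [exact: cvg_cst|exact: h2|exact: cvg_cst|exact: h1].
Qed.

Lemma Rint_bound (f : R -> R) (a b M : R) : a <= b ->
  mu.-integrable `[a, b] (EFin \o f) ->
  (forall x, a <= x <= b -> `|f x| <= M) ->
  `|\int[mu]_(x in `[a, b]) f x| <= M * (b - a).
Proof.
move=> ab fi fM; apply: le_trans (le_normr_Rintegral _ fi) _ => //.
have mI : measurable `[a, b]%classic by exact: measurable_itv.
have -> : M * (b - a) = \int[mu]_(x in `[a, b]) M.
  rewrite Rintegral_cst //; congr (_ * _).
  have := @lebesgue_measure_itv R `[a, b]; rewrite /= lte_fin => ->.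
  by case: ltgtP ab => // -> _; rewrite subrr.
apply: le_Rintegral => //.
- by apply: integrable_norm fi.
- apply: continuous_compact_integrable; first exact: segment_compact.
  by move=> x; exact: cvg_cst.
Qed.

Lemma cint_bound phi (a b M : R) : a <= b -> ccont phi a b ->
  (forall x, a <= x <= b -> rn (phi x) <= M) ->
  rn (cint phi a b) <= 2 * M * (b - a).
Proof.
move=> ab /ccont_int[i1 i2] hM; apply: le_trans (rn_cpx _ _) _.
rewrite -mulrA mulr_natl mulr2n; apply: lerD; apply: Rint_bound => // x /hM.
  exact: le_trans (rn_Re _).
exact: le_trans (rn_Im _).
Qed.

Lemma eq_cint phi psi a b : (forall x, a <= x <= b -> phi x = psi x) ->
  cint phi a b = cint psi a b.
Proof.
by move=> h; congr cpx; apply: eq_Rintegral => x /[!inE] /=;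
  rewrite in_itv /= => /h ->.
Qed.

End PathIntegral.

Ltac gencint := repeat match goal with |- context[cint ?a ?b ?c] => generalize (cint a b c); intro end.

Section Contour.
Variable R : realType.
Local Notation K := (Cx R).
Local Notation mu := (@lebesgue_measure R).

Lemma Rint_FTC (F f : R -> R) (a b : R) : a <= b ->
  (forall x : R, is_derive x 1 F (f x)) -> continuous f ->
  \int[mu]_(x in `[a, b]) f x = F b - F a.
Proof.
rewrite le_eqVlt => /orP[/eqP <- _ _|ab dF cf].
  by rewrite set_itv1 Rintegral_set1 subrr.
have cF : continuous F.
  move=> x; have [dx _] := dF x.
  by apply: differentiable_continuous; apply/derivable1_diffP.
rewrite /Rintegral (@continuous_FTC2 _ f F) //.
- by apply: continuous_in_subspaceT => x _; exact: cf.
- split=> [x _|| ]; first by have [dx _] := dF x.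
  + by apply: cvg_at_right_filter; exact: cF.
  + by apply: cvg_at_left_filter; exact: cF.
- by move=> x _; rewrite derive1E; have [_ ->] := dF x.
Qed.

Lemma cint_cst (u : K) (a b : R) : a <= b -> cint (fun=> u) a b = ofReal (b - a) * u.
Proof.
move=> ab; have I (c : R) : \int[mu]_(x in `[a, b]) c = (b - a) * c.
  have D (x : R) : is_derive x 1 (fun x => x * c) c.
    by apply: is_derive_eq; rewrite /GRing.scale /=; ring.
  by rewrite (Rint_FTC ab D) ?mulrBl // => x; exact: cvg_cst.
rewrite /cint !I [u in RHS]KE /cpx !ofRealM mulrDr mulrCA //.
Qed.

Lemma cint_id (a b : R) : a <= b ->
  cint (fun x => ofReal x) a b = ofReal (2^-1 * (b ^+ 2 - a ^+ 2)).
Proof.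
move=> ab; have D (x : R) : is_derive x 1 (fun x => 2^-1 * x ^+ 2) x.
  by apply: is_derive_eq; rewrite /GRing.scale /=; field.
have D0 (x : R) : is_derive x (1 : R) (fun=> 0 : R) (0 : R) by exact: is_derive_cst.
rewrite /cint /= (Rint_FTC ab D); last by move=> x; exact: cvg_id.
rewrite (Rint_FTC ab D0); last by move=> x; exact: cvg_cst.
by rewrite /cpx subrr ofReal0 mulr0 addr0 mulrBr.
Qed.

Lemma ccont_cst (u : K) a b : ccont (fun=> u) a b.
Proof. by split=> x; exact: cvg_cst. Qed.

Lemma ccont_ofReal (a b : R) : ccont (@ofReal R) a b.
Proof.
by apply: ccontP => x _ e e0; exists e => // y h; rewrite -ofRealB rn_ofReal.
Qed.

Lemma ccontZr (k : K) phi a b : ccont phi a b ->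
  ccont (fun x => phi x * k) a b.
Proof.
by move=> h; under eq_fun do rewrite mulrC; exact: ccontZ.
Qed.

Lemma cint_affine (u v : K) (a b : R) : a <= b ->
  cint (fun x => u + ofReal x * v) a b =
  ofReal (b - a) * u + ofReal (2^-1 * (b ^+ 2 - a ^+ 2)) * v.
Proof.
move=> ab; rewrite cintD; last 2 first.
- exact: ccont_cst.
- exact/ccontZr/ccont_ofReal.
under [X in _ + X]eq_cint do rewrite mulrC.
rewrite cint_cst // (cintZ _ (ccont_ofReal a b)) cint_id //.
by rewrite [X in _ + X]mulrC.
Qed.

Definition cpt (V W : normedZmodType K) (f : V -> W) (z : V) : Prop :=
  forall e : R, 0 < e -> exists2 d : R, 0 < d &
    forall w, rn (w - z) < d -> rn (f w - f z) < e.

(* f'(z) = a. *)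
Definition hd (f : K -> K) (z a : K) : Prop :=
  forall e : R, 0 < e -> exists2 d : R, 0 < d &
    forall h, rn h < d -> rn (f (z + h) - f z - h * a) <= e * rn h.

Lemma hd_cpt f z a : hd f z a -> cpt f z.
Proof.
move=> h e e0; have [d d0 hd] := h 1 ltr01.
pose m := Num.min d (e / (2 + rn a)).
have ra := rn_ge0 a.
have A0 : 0 < 2 + rn a by lra.
exists m => [|w hw]; first by rewrite lt_min d0 divr_gt0.
have /hd : rn (w - z) < d by apply: lt_le_trans hw _; rewrite ge_min lexx.
rewrite subrKC mul1r => h1.
have h2 : rn (w - z) < e / (2 + rn a).
  by apply: lt_le_trans hw _; rewrite ge_min lexx orbT.
rewrite ltr_pdivlMr // in h2.
rewrite -[f w - f z](subrK ((w - z) * a)).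
apply: le_lt_trans (rnD _ _) _; rewrite rnM; have := rn_ge0 (w - z); nra.
Qed.

(* The integral along the boundary of the rectangle, counterclockwise. *)
Definition J (f : K -> K) (x0 x1 y0 y1 : R) : K :=
  cint (fun x => f (cpx x y0)) x0 x1 - cint (fun x => f (cpx x y1)) x0 x1 +
  'i * (cint (fun y => f (cpx x1 y)) y0 y1 - cint (fun y => f (cpx x0 y)) y0 y1).

Lemma cpxB x y x' y' : cpx x y - cpx x' y' = cpx (x - x') (y - y') :> K.
Proof. by rewrite /cpx !ofRealB; ring. Qed.
Lemma hcont (f : K -> K) y a b : (forall x : R, a <= x <= b -> cpt f (cpx x y)) ->
  ccont (fun x => f (cpx x y)) a b.
Proof.
move=> h; apply: ccontP => x /h hx e /hx[d d0 hd]; exists d => // w hw.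
apply: hd; rewrite cpxB subrr; apply: le_lt_trans (rn_cpx _ _) _.
by rewrite normr0 addr0.
Qed.

Lemma vcont (f : K -> K) x a b : (forall y : R, a <= y <= b -> cpt f (cpx x y)) ->
  ccont (fun y => f (cpx x y)) a b.
Proof.
move=> h; apply: ccontP => y /h hx e /hx[d d0 hd]; exists d => // w hw.
apply: hd; rewrite cpxB subrr; apply: le_lt_trans (rn_cpx _ _) _.
by rewrite normr0 add0r.
Qed.

Definition bd (x0 x1 y0 y1 x y : R) : Prop :=
  [/\ x0 <= x <= x1, y0 <= y <= y1 & [\/ x = x0, x = x1, y = y0 | y = y1]].

Definition bcont (f : K -> K) x0 x1 y0 y1 : Prop :=
  forall x y, bd x0 x1 y0 y1 x y -> cpt f (cpx x y).

Section Rect.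
Variables (x0 x1 y0 y1 : R).
Hypotheses (hx : x0 <= x1) (hy : y0 <= y1).

Lemma bdx0 y : y0 <= y <= y1 -> bd x0 x1 y0 y1 x0 y.
Proof. by move=> h; split=> //; [rewrite lexx|constructor 1]. Qed.
Lemma bdx1 y : y0 <= y <= y1 -> bd x0 x1 y0 y1 x1 y.
Proof. by move=> h; split=> //; [rewrite lexx andbT|constructor 2]. Qed.
Lemma bdy0 x : x0 <= x <= x1 -> bd x0 x1 y0 y1 x y0.
Proof. by move=> h; split=> //; [rewrite lexx|constructor 3]. Qed.
Lemma bdy1 x : x0 <= x <= x1 -> bd x0 x1 y0 y1 x y1.
Proof. by move=> h; split=> //; [rewrite lexx andbT|constructor 4]. Qed.

Lemma bcontE f : bcont f x0 x1 y0 y1 ->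
  [/\ ccont (fun x => f (cpx x y0)) x0 x1, ccont (fun x => f (cpx x y1)) x0 x1,
      ccont (fun y => f (cpx x1 y)) y0 y1 & ccont (fun y => f (cpx x0 y)) y0 y1].
Proof.
move=> h; split.
- by apply: hcont => x /bdy0 /h.
- by apply: hcont => x /bdy1 /h.
- by apply: vcont => y /bdx1 /h.
- by apply: vcont => y /bdx0 /h.
Qed.

Lemma eq_J f g : (forall x y, bd x0 x1 y0 y1 x y -> f (cpx x y) = g (cpx x y)) ->
  J f x0 x1 y0 y1 = J g x0 x1 y0 y1.
Proof.
move=> h; rewrite /J; congr (_ - _ + _ * (_ - _)); apply: eq_cint => t ht; apply: h.
- exact: bdy0.
- exact: bdy1.
- exact: bdx1.
- exact: bdx0.
Qed.

Lemma JD (f g : K -> K) : bcont f x0 x1 y0 y1 -> bcont g x0 x1 y0 y1 ->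
  J (fun z => f z + g z) x0 x1 y0 y1 = J f x0 x1 y0 y1 + J g x0 x1 y0 y1.
Proof.
move=> /bcontE[f1 f2 f3 f4] /bcontE[g1 g2 g3 g4]; rewrite /J !cintD //.
gencint; absK R => C *; ring.
Qed.

Lemma JZ (k : K) (f : K -> K) : bcont f x0 x1 y0 y1 ->
  J (fun z => k * f z) x0 x1 y0 y1 = k * J f x0 x1 y0 y1.
Proof.
move=> /bcontE[f1 f2 f3 f4]; rewrite /J !cintZ //.
gencint; absK R => C *; ring.
Qed.

Lemma J_bound f M : bcont f x0 x1 y0 y1 ->
  (forall x y, bd x0 x1 y0 y1 x y -> rn (f (cpx x y)) <= M) ->
  rn (J f x0 x1 y0 y1) <= 4 * M * ((x1 - x0) + (y1 - y0)).
Proof.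
move=> /bcontE[f1 f2 f3 f4] hM; rewrite /J.
have b1 := cint_bound hx f1 (fun x h => hM _ _ (bdy0 h)).
have b2 := cint_bound hx f2 (fun x h => hM _ _ (bdy1 h)).
have b3 := cint_bound hy f3 (fun x h => hM _ _ (bdx1 h)).
have b4 := cint_bound hy f4 (fun x h => hM _ _ (bdx0 h)).
apply: le_trans (rnD _ _) _; rewrite rnM rn_i mul1r.
apply: le_trans (lerD (rnB _ _) (rnB _ _)) _; move: b1 b2 b3 b4.
move: (rn _) (rn _) (rn _) (rn _) => a b c d; lra.
Qed.

Lemma J_affine (p q : K) : J (fun z => p + z * q) x0 x1 y0 y1 = 0.
Proof.
rewrite /J.
have H y : cint (fun x : R => p + cpx x y * q) x0 x1 =
    ofReal (x1 - x0) * (p + 'i * ofReal y * q) + ofReal (2^-1 * (x1 ^+ 2 - x0 ^+ 2)) * q.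
  rewrite -cint_affine //; apply: eq_cint => x _; rewrite /cpx; absK R => C *; ring.
have V x : cint (fun y : R => p + cpx x y * q) y0 y1 =
    ofReal (y1 - y0) * (p + ofReal x * q) + ofReal (2^-1 * (y1 ^+ 2 - y0 ^+ 2)) * ('i * q).
  rewrite -cint_affine //; apply: eq_cint => y _; rewrite /cpx; absK R => C *; ring.
rewrite !H !V !expr2 !(ofRealB, ofRealM).
absK R => C *; ring: (@sqrCi C).
Qed.
End Rect.
End Contour.

(** * Goursat's theorem and Cauchy's formula *)

Section Goursat.
Variable R : realType.
Local Notation K := (Cx R).

Definition rcont (f : K -> K) (x0 x1 y0 y1 : R) : Prop :=
  forall x y : R, x0 <= x <= x1 -> y0 <= y <= y1 -> cpt f (cpx x y).

Lemma rcont_sub f x0 x1 y0 y1 a0 a1 b0 b1 : rcont f x0 x1 y0 y1 ->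
  x0 <= a0 -> a1 <= x1 -> y0 <= b0 -> b1 <= y1 -> rcont f a0 a1 b0 b1.
Proof.
move=> h h1 h2 h3 h4 x y /andP[u v] /andP[u' v']; apply: h.
  by rewrite (le_trans h1 u) (le_trans v h2).
by rewrite (le_trans h3 u') (le_trans v' h4).
Qed.

Lemma rcont_bcont f x0 x1 y0 y1 : rcont f x0 x1 y0 y1 -> bcont f x0 x1 y0 y1.
Proof. by move=> h x y [hx hy _]; exact: h. Qed.

Lemma J_splitx f (x0 xm x1 y0 y1 : R) : x0 <= xm -> xm <= x1 -> y0 <= y1 ->
  (forall x : R, x0 <= x <= x1 -> cpt f (cpx x y0) /\ cpt f (cpx x y1)) ->
  J f x0 x1 y0 y1 = J f x0 xm y0 y1 + J f xm x1 y0 y1.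
Proof.
move=> h1 h2 hy c.
have c0 : ccont (fun x => f (cpx x y0)) x0 x1 by apply: hcont => x /c[].
have c1 : ccont (fun x => f (cpx x y1)) x0 x1 by apply: hcont => x /c[].
rewrite /J (cint_split h1 h2 c0) (cint_split h1 h2 c1).
gencint; absK R => C *; ring.
Qed.

Lemma J_splity f (x0 x1 y0 ym y1 : R) : y0 <= ym -> ym <= y1 -> x0 <= x1 ->
  (forall y : R, y0 <= y <= y1 -> cpt f (cpx x0 y) /\ cpt f (cpx x1 y)) ->
  J f x0 x1 y0 y1 = J f x0 x1 y0 ym + J f x0 x1 ym y1.
Proof.
move=> h1 h2 hy c.
have c0 : ccont (fun y => f (cpx x0 y)) y0 y1 by apply: vcont => y /c[].
have c1 : ccont (fun y => f (cpx x1 y)) y0 y1 by apply: vcont => y /c[].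
rewrite /J (cint_split h1 h2 c0) (cint_split h1 h2 c1).
gencint; absK R => C *; ring.
Qed.

Lemma J_split4 f (x0 xm x1 y0 ym y1 : R) : x0 <= xm -> xm <= x1 ->
  y0 <= ym -> ym <= y1 -> rcont f x0 x1 y0 y1 ->
  J f x0 x1 y0 y1 = J f x0 xm y0 ym + J f xm x1 y0 ym +
    (J f x0 xm ym y1 + J f xm x1 ym y1).
Proof.
move=> h1 h2 h3 h4 rc; have hx := le_trans h1 h2; have hy := le_trans h3 h4.
rewrite (J_splity h3 h4 hx); last first.
  by move=> t ht; split; apply: rc; rewrite ?lexx ?hx.
rewrite (J_splitx h1 h2 h3); last first.
  by move=> t ht; split; apply: rc; rewrite ?lexx ?h3 ?hy.
by rewrite (J_splitx h1 h2 h4) // => t ht; split; apply: rc; rewrite ?lexx ?h3 ?h4 ?hy.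
Qed.

Lemma cptD (V : normedZmodType K) (f g : V -> K) (z : V) : cpt f z -> cpt g z -> cpt (fun z => f z + g z) z.
Proof.
move=> hf hg e e0; have e2 : 0 < e / 2 by rewrite divr_gt0.
have [d1 d10 h1] := hf _ e2; have [d2 d20 h2] := hg _ e2.
exists (Num.min d1 d2) => [|w]; first by rewrite lt_min d10.
rewrite lt_min => /andP[/h1 l1 /h2 l2]; rewrite opprD addrACA.
by rewrite (splitr e) (le_lt_trans (rnD _ _)) // ltrD.
Qed.

Lemma cptZ (V : normedZmodType K) (k : K) (f : V -> K) (z : V) : cpt f z -> cpt (fun z => k * f z) z.
Proof.
move=> hf e e0; have p : 0 < 1 + rn k by have := rn_ge0 k; lra.
have [d d0 h] := hf (e / (1 + rn k)) (divr_gt0 e0 p).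
exists d => // w /h; rewrite -mulrBr rnM ltr_pdivlMr //.
have := rn_ge0 k; have := rn_ge0 (f w - f z); nra.
Qed.

Lemma cpt_cst (V : normedZmodType K) (k : K) (z : V) : cpt (fun=> k) z.
Proof. by move=> e e0; exists 1 => // w _; rewrite subrr rn0. Qed.

Lemma cpt_id (V : normedZmodType K) (z : V) : cpt id z.
Proof. by move=> e e0; exists e. Qed.

Lemma cpt_affine (p q z : K) : cpt (fun z => p + z * q) z.
Proof.
apply: cptD; first exact: cpt_cst.
by under eq_fun do rewrite mulrC; apply: cptZ; exact: cpt_id.
Qed.

Lemma nested_limit (x w : nat -> R) : (forall n, 0 <= w n) ->
  (forall n, x n <= x n.+1) -> (forall n, x n.+1 + w n.+1 <= x n + w n) ->
  exists X, forall n, x n <= X <= x n + w n.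
Proof.
move=> w0 h1 h2.
have mono n m : x n <= x (m + n)%N.
  by elim: m => // m IH; rewrite addSn; apply: le_trans IH (h1 _).
have anti n m : x (m + n)%N + w (m + n)%N <= x n + w n.
  by elim: m => // m IH; rewrite addSn; apply: le_trans (h2 _) IH.
have ub n m : x m <= x n + w n.
  have [nm|mn] := leqP n m.
    have := anti n (m - n)%N; rewrite subnK // => A; have := w0 m; lra.
  have := mono m (n - m)%N; rewrite subnK 1?ltnW // => A; have := w0 n; lra.
exists (sup (range x)) => n; apply/andP; split.
  by apply: ub_le_sup; [exists (x 0%N + w 0%N) => _ [m _ <-]; exact: ub|exists n].
by apply: ge_sup; [exists (x 0%N); exists 0%N|move=> _ [m _ <-]; exact: ub].
Qed.

Lemma exists_quarter (F : bool -> bool -> R) (r : R) :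
  r <= F false false + F true false + (F false true + F true true) ->
  exists i j, r <= 4 * F i j.
Proof.
move=> h; apply: contrapT => H.
have lt i j : 4 * F i j < r.
  by rewrite ltNge; apply/negP => hh; apply: H; exists i, j.
move: h (lt false false) (lt false true) (lt true false) (lt true true).
move: (F _ _) (F _ _) (F _ _) (F _ _); clear => r1 r2 r3 r4; lra.
Qed.

Lemma goursat_eps (d S : R) : 0 < d -> 4 * (d / (8 * (S ^+ 2 + 1))) * S ^+ 2 < d.
Proof.
move=> d0; have S1 : 0 < S ^+ 2 + 1 by rewrite ltr_wpDl // sqr_ge0.
rewrite mulrA mulrAC ltr_pdivrMr; last by rewrite mulr_gt0.
have := sqr_ge0 S; nra.
Qed.

Lemma dist_segment (a w x y : R) : a <= x <= a + w -> a <= y <= a + w ->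
  `|x - y| <= w.
Proof.
by move=> /andP[h1 h2] /andP[h3 h4]; rewrite ler_norml; apply/andP; split; lra.
Qed.

Theorem goursat f (x0 x1 y0 y1 : R) : x0 <= x1 -> y0 <= y1 ->
  (forall x y : R, x0 <= x <= x1 -> y0 <= y <= y1 -> exists a, hd f (cpx x y) a) ->
  J f x0 x1 y0 y1 = 0.
Proof.
move=> hx hy hf.
have rc : rcont f x0 x1 y0 y1.
  by move=> x y u v; have [a] := hf x y u v; exact: hd_cpt.
apply/eqP/contraT; rewrite -rn_gt0 => d0.
set delta := rn _ in d0.
pose a := x1 - x0; pose b := y1 - y0.
pose w (n : nat) : R := a / 2 ^+ n; pose v (n : nat) : R := b / 2 ^+ n.
have a0 : 0 <= a by rewrite subr_ge0.
have b0 : 0 <= b by rewrite subr_ge0.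
have p2 n : 0 < 2 ^+ n :> R by rewrite exprn_gt0.
have w0 n : 0 <= w n by rewrite divr_ge0 // ltW.
have v0 n : 0 <= v n by rewrite divr_ge0 // ltW.
have wS n : w n = w n.+1 + w n.+1.
  by rewrite /w exprS; have := gt_eqF (p2 n); move/negbT => h; field.
have vS n : v n = v n.+1 + v n.+1.
  by rewrite /v exprS; have := gt_eqF (p2 n); move/negbT => h; field.
pose inv n (p : R * R) := [/\ x0 <= p.1, p.1 + w n <= x1, y0 <= p.2 & p.2 + v n <= y1].
pose Q n (p : R * R) := J f p.1 (p.1 + w n) p.2 (p.2 + v n).
have step (np : nat * (R * R)) : exists p' : R * R, inv np.1 np.2 ->
  [/\ inv np.1.+1 p', np.2.1 <= p'.1 /\ p'.1 + w np.1.+1 <= np.2.1 + w np.1,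
   np.2.2 <= p'.2 /\ p'.2 + v np.1.+1 <= np.2.2 + v np.1 &
   rn (Q np.1 np.2) <= 4 * rn (Q np.1.+1 p')].
  case: np => n [x y] /=; have [[i1 i2 i3 i4]|] := pselect (inv n (x, y)); last by exists (0, 0).
  rewrite /= in i1 i2 i3 i4.
  have W := w0 n.+1; have V := v0 n.+1.
  have eW : x + w n = x + w n.+1 + w n.+1 by rewrite (wS n) addrA.
  have eV : y + v n = y + v n.+1 + v n.+1 by rewrite (vS n) addrA.
  have e : Q n (x, y) = Q n.+1 (x, y) + Q n.+1 (x + w n.+1, y) +
     (Q n.+1 (x, y + v n.+1) + Q n.+1 (x + w n.+1, y + v n.+1)).
    rewrite /Q /= eW eV; apply: J_split4; rewrite ?lerDl //.
    by apply: rcont_sub rc _ _ _ _; rewrite -?eW -?eV.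
  have le4 : rn (Q n (x, y)) <= rn (Q n.+1 (x, y)) + rn (Q n.+1 (x + w n.+1, y)) +
     (rn (Q n.+1 (x, y + v n.+1)) + rn (Q n.+1 (x + w n.+1, y + v n.+1))).
    rewrite e; apply: le_trans (rnD _ _) _; apply: lerD; exact: rnD.
  have : exists i j : bool, rn (Q n (x, y)) <= 4 * rn (Q n.+1 (x + w n.+1 *+ i, y + v n.+1 *+ j)).
    apply: (@exists_quarter (fun i j => rn (Q n.+1 (x + w n.+1 *+ i, y + v n.+1 *+ j)))).
    by rewrite !mulr0n !mulr1n !addr0.
  move=> [i [j hij]]; exists (x + w n.+1 *+ i, y + v n.+1 *+ j) => _ /=.
  have iW : 0 <= w n.+1 *+ i <= w n.+1 by case: (i); rewrite ?mulr0n ?mulr1n ?lexx ?W.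
  have jV : 0 <= v n.+1 *+ j <= v n.+1 by case: (j); rewrite ?mulr0n ?mulr1n ?lexx ?V.
  move: (w n.+1 *+ i) (v n.+1 *+ j) iW jV hij => wi vj /andP[iW1 iW2] /andP[jV1 jV2] hij.
  rewrite eW in i2 *; rewrite eV in i4 *.
  rewrite /inv /=; move: (w n.+1) (v n.+1) i1 i2 i3 i4 iW1 iW2 jV1 jV2 hij.
  move: (rn _ <= _); clear => P W V i1 i2 i3 i4 iW1 iW2 jV1 jV2 hij.
  by split=> //; [split=> /=|split|split]; lra.
have [g hg] := choice step.
pose p := fix p n := if n is m.+1 then g (m, p m) else (x0, y0).
have w0E : w 0%N = a by rewrite /w expr0 divr1.
have v0E : v 0%N = b by rewrite /v expr0 divr1.
have pinv n : inv n (p n).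
  elim: n => [|n IH]; last by have [] := hg (n, p n) IH.
  by rewrite /inv /= w0E v0E /a /b; split; lra.
have pstep n := hg (n, p n) (pinv n).
have pQ n : delta <= 4 ^+ n * rn (Q n (p n)).
  elim: n => [|n IH].
    by rewrite expr0 mul1r /Q /= w0E v0E /a /b !subrKC.
  apply: le_trans IH _; rewrite exprSr -mulrA ler_wpM2l ?exprn_ge0 //.
  by have [] := pstep n.
have [X hX] : exists X, forall n, (p n).1 <= X <= (p n).1 + w n.
  apply: nested_limit => // n; by have [_ []] := pstep n.
have [Y hY] : exists X, forall n, (p n).2 <= X <= (p n).2 + v n.
  apply: nested_limit => // n; by have [_ _ []] := pstep n.
have [c hc] : exists c, hd f (cpx X Y) c.
  have [i1 i2 i3 i4] := pinv 0%N; have := hX 0%N; have := hY 0%N.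
  by rewrite /= w0E v0E /a /b !subrKC => u u'; apply: hf.
pose S := a + b.
have S0 : 0 <= S by rewrite addr_ge0.
pose e := delta / (8 * (S ^+ 2 + 1)).
have e0 : 0 < e by rewrite divr_gt0 // mulr_gt0 // ltr_wpDl // sqr_ge0.
have [d dp hd] := hc e e0.
have [n hn] : exists n, w n + v n < d.
  pose n := Num.bound (S / d).
  have hn : S / d < n%:R by have := archi_boundP (divr_ge0 S0 (ltW dp)).
  exists n; rewrite /w /v -mulrDl -/S ltr_pdivrMr // mulrC -ltr_pdivrMr //.
  by apply: lt_le_trans hn _; rewrite -natrX ler_nat ltnW // ltn_expl.
have [i1 i2 i3 i4] := pinv n; have /andP[X1 X2] := hX n; have /andP[Y1 Y2] := hY n.
have px : (p n).1 <= (p n).1 + w n by rewrite lerDl.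
have py : (p n).2 <= (p n).2 + v n by rewrite lerDl.
pose z0 := cpx X Y; pose A := f z0 - z0 * c.
have bc : bcont f (p n).1 ((p n).1 + w n) (p n).2 ((p n).2 + v n).
  by apply: rcont_bcont; exact: rcont_sub rc _ _ _ _.
have bA : bcont (fun z => (-1) * (A + z * c)) (p n).1 ((p n).1 + w n) (p n).2 ((p n).2 + v n).
  by move=> x y _; apply: cptZ; exact: cpt_affine.
have QE : Q n (p n) = J (fun z => f z + (-1) * (A + z * c)) (p n).1 ((p n).1 + w n) (p n).2 ((p n).2 + v n).
  rewrite (JD px py bc bA) JZ // ?J_affine // ?mulr0 ?addr0 //.
  by move=> x y _; exact: cpt_affine.
have Qb : rn (Q n (p n)) <= 4 * (e * (w n + v n)) * (w n + v n).
  rewrite QE.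
  have -> : 4 * (e * (w n + v n)) * (w n + v n) = 4 * (e * (w n + v n)) *
     (((p n).1 + w n - (p n).1) + ((p n).2 + v n - (p n).2)).
    by rewrite (addrC (p n).1) addrK (addrC (p n).2) addrK.
  apply: J_bound => //.
    by move=> x y B; apply: cptD; [exact: bc|exact: bA].
  move=> x y [/andP[u1 u2] /andP[u3 u4] _].
  have hz : rn (cpx x y - z0) <= w n + v n.
    rewrite cpxB; apply: le_trans (rn_cpx _ _) _; by apply: lerD; [apply: (@dist_segment (p n).1)|apply: (@dist_segment (p n).2)]; apply/andP.
  have -> : f (cpx x y) + -1 * (A + cpx x y * c) =
    f (z0 + (cpx x y - z0)) - f z0 - (cpx x y - z0) * c.
    rewrite subrKC /A; move: (cpx x y) (z0) (c) (f (cpx x y)) (f z0).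
    by clear => *; absK R => C *; ring.
  apply: le_trans (hd _ (le_lt_trans hz hn)) _.
  by apply: ler_wpM2l => //; exact: ltW.
have := pQ n.
have wvE : w n + v n = S / 2 ^+ n by rewrite -mulrDl.
move: Qb; rewrite wvE => Qb.
have q4 : 0 <= 4 ^+ n :> R by rewrite exprn_ge0.
move=> /le_trans /(_ (ler_wpM2l q4 Qb)).
have -> : 4 ^+ n * (4 * (e * (S / 2 ^+ n)) * (S / 2 ^+ n)) = 4 * e * S ^+ 2.
  have -> : 4 ^+ n = 2 ^+ n * 2 ^+ n :> R by rewrite -exprMn -natrM.
  by have /negbT h := gt_eqF (p2 n); field.
by rewrite /e => F; have := goursat_eps S d0; rewrite ltNge F.
Qed.
End Goursat.

Section Cauchy.
Variable R : realType.
Local Notation K := (Cx R).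

Implicit Types (f g : K -> K) (z w a b c : K).

Lemma hd_derive (f : K -> K) (z a : K) :
  hd f z a <-> is_derive z (1 : K^o) (f : K^o -> K^o) a.
Proof.
have E (h : K) : h != 0 -> rn (h^-1 *: (f (h *: 1 + z) - f z : K^o) - a) =
    rn (f (z + h) - f z - h * a) / rn h.
  move=> h0; rewrite -rnV -rnM; congr rn.
  by rewrite /GRing.scale /= mulr1 (addrC z) mulrC [RHS]mulrBl [h * a]mulrC mulfK.
split=> [H|[dv dE] e e0].
  suff C : (fun h : K => h^-1 *: (f (h *: 1 + z) - f z : K^o)) @ 0^' --> (a : K^o).
    by split; [apply/cvg_ex; exists a|exact: cvg_lim C].
  apply/cvgrPdist_lt => e0 /gt0_ofReal[e ep ->].
  have [d d0 hd] := H (e / 2) (divr_gt0 ep (ltr0Sn _ 1)).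
  apply/nbhs_ballP; exists (ofReal d) => /=; first by rewrite -ofReal0 ltr_ofReal.
  move=> h; rewrite -ball_normE /= sub0r normrN rnE ltr_ofReal => hh h0.
  rewrite rnE ltr_ofReal rn_distC E // ltr_pdivrMr ?rn_gt0 //.
  apply: le_lt_trans (hd _ hh) _; rewrite ltr_pM2r ?rn_gt0 //.
  by rewrite ltr_pdivrMr // ltr_pMr // ltr1n.
have C : (fun h : K => h^-1 *: (f (h *: 1 + z) - f z : K^o)) @ 0^' --> (a : K^o).
  by rewrite -dE; exact: dv.
have /cvgrPdist_lt/(_ (ofReal e)) := C.
rewrite -ofReal0 ltr_ofReal => /(_ e0)/nbhs_ballP[d' /= /gt0_ofReal[d d0 ->] hd].
exists d => // h hh; have [->|h0] := eqVneq h 0.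
  by rewrite addr0 subrr mul0r subrr rn0 mulr0.
have := hd h; rewrite -ball_normE /= sub0r normrN rnE ltr_ofReal => /(_ hh h0).
rewrite rnE ltr_ofReal rn_distC E // ltr_pdivrMr ?rn_gt0 //.
exact: ltW.
Qed.

Lemma hdD f g z a b : hd f z a -> hd g z b -> hd (fun z => f z + g z) z (a + b).
Proof. by move=> /hd_derive hf /hd_derive hg; apply/hd_derive; exact: is_deriveD. Qed.

Lemma hdM f g z a b : hd f z a -> hd g z b ->
  hd (fun z => f z * g z) z (f z * b + g z * a).
Proof. by move=> /hd_derive hf /hd_derive hg; apply/hd_derive; exact: is_deriveM. Qed.

Lemma hd_cst c z : hd (fun=> c) z 0.
Proof. by apply/hd_derive; exact: is_derive_cst. Qed.

Lemma hd_inv (w z : K) : z != w -> exists a, hd (fun z => (z - w)^-1) z a.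
Proof.
rewrite -subr_eq0 => zw; eexists; apply/hd_derive; apply: DeriveDef.
  apply: derivableV => //; exact: derivableB.
reflexivity.
Qed.

Lemma J_shrink f (x0 x1 y0 y1 px py h : R) : 0 < h ->
  x0 <= px - h -> px + h <= x1 -> y0 <= py - h -> py + h <= y1 ->
  (forall x y : R, x0 <= x <= x1 -> y0 <= y <= y1 -> cpx x y != cpx px py ->
     exists a, hd f (cpx x y) a) ->
  J f x0 x1 y0 y1 = J f (px - h) (px + h) (py - h) (py + h).
Proof.
move=> h0 a1 a2 b1 b2 H.
have H' (x y : R) : x0 <= x <= x1 -> y0 <= y <= y1 -> x != px \/ y != py ->
     exists a, hd f (cpx x y) a.
  move=> hx hy xy; apply: H => //; apply/eqP; rewrite !cpxE => -[ex ey].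
  by move: xy; rewrite ex ey !eqxx; case.
have C (x y : R) : x0 <= x <= x1 -> y0 <= y <= y1 -> x != px \/ y != py -> cpt f (cpx x y).
  by move=> u v w; have [a] := H' _ _ u v w; exact: hd_cpt.
have hm : px - h <= px + h by lra.
have km : py - h <= py + h by lra.
rewrite (@J_splitx _ f x0 (px - h) x1 y0 y1); [|lra|lra|lra|]; last first.
  by move=> t ht; split; apply: C => //; [lra|right; lra|lra|right; lra].
rewrite goursat ?add0r //; [|lra|]; last first.
  by move=> x y hx hy; apply: H'; [lra|lra|left; lra].
rewrite (@J_splitx _ f (px - h) (px + h) x1 y0 y1); [|lra|lra|lra|]; last first.
  by move=> t ht; split; apply: C => //; [lra|lra|right; lra|lra|lra|right; lra].
rewrite [X in _ + X]goursat ?addr0 //; [|lra|]; last first.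
  by move=> x y hx hy; apply: H'; [lra|lra|left; lra].
rewrite (@J_splity _ f (px - h) (px + h) y0 (py - h) y1); [|lra|lra|lra|]; last first.
  by move=> t ht; split; apply: C => //; [lra|left; lra|lra|left; lra].
rewrite goursat ?add0r //; last first.
  by move=> x y hx hy; apply: H'; [lra|lra|right; lra].
rewrite (@J_splity _ f (px - h) (px + h) (py - h) (py + h) y1); [|lra|lra|lra|]; last first.
  by move=> t ht; split; apply: C => //; [lra|lra|left; lra|lra|lra|left; lra].
rewrite [X in _ + X]goursat ?addr0 //.
by move=> x y hx hy; apply: H'; [lra|lra|right; lra].
Qed.

Lemma sub_sing (s t : R) : cpx s t != 0 ->
  (cpx s t)^-1 = cpx (s / (s ^+ 2 + t ^+ 2)) (- t / (s ^+ 2 + t ^+ 2)).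
Proof. by move=> _; rewrite !cpxE mulNr. Qed.

Lemma Rint_cauchy_kernel (p h : R) : 0 < h ->
  \int[lebesgue_measure]_(x in `[(p - h), (p + h)]) (2 * (h / ((x - p) ^+ 2 + h ^+ 2))) = pi.
Proof.
move=> h0; have hle : p - h <= p + h by lra.
have hn : h != 0 by rewrite gt_eqF.
have den (x : R) : (x - p) ^+ 2 + h ^+ 2 != 0.
  by rewrite gt_eqF // ltr_wpDl ?sqr_ge0 // exprn_gt0.
have D (x : R) : is_derive x (1 : R) (fun x => 2 * atan ((x - p) / h) : R)
    (2 * (h / ((x - p) ^+ 2 + h ^+ 2))).
  have D1 : is_derive x (1 : R) (fun x => (x - p) / h : R) h^-1.
    by apply: is_derive_eq; rewrite /GRing.scale /=; ring.
  apply: is_derive_eq; rewrite /GRing.scale /=.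
  have d1 : 1 + ((x - p) / h) ^+ 2 != 0.
    by rewrite gt_eqF // ltr_wpDr ?sqr_ge0.
  have := den x; move: d1; move: (x - p) => y.
  move=> d1 d2; have -> : 1 + (y / h) ^+ 2 = (y ^+ 2 + h ^+ 2) / h ^+ 2.
    by rewrite mulrDl divff ?expf_neq0 // expr_div_n addrC.
  by field; rewrite hn d2.
rewrite (Rint_FTC hle D) => [|x].
  have -> : (p + h - p) / h = 1 by field.
  have -> : (p - h - p) / h = -1 by field.
  by rewrite atanN atan1; field.
apply: cvgM; first exact: cvg_cst.
apply: cvgM; first exact: cvg_cst.
apply: cvgV; first exact: den.
apply: cvgD; last exact: cvg_cst.
by apply: cvgM; (apply: cvgB; [exact: cvg_id|exact: cvg_cst]).
Qed.

Lemma cint_cauchy_kernel (p h : R) : 0 < h ->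
  cint (fun x => ofReal (2 * (h / ((x - p) ^+ 2 + h ^+ 2)))) (p - h) (p + h) = ofReal pi.
Proof.
move=> h0; rewrite /cint /= Rint_cauchy_kernel // -[in RHS](addr0 (ofReal pi)) /cpx.
by rewrite Rintegral_cst // mul0r ofReal0 mulr0.
Qed.

Lemma hd_inv_cpt w z : z != w -> cpt (fun z => (z - w)^-1) z.
Proof. by move=> /hd_inv[a]; exact: hd_cpt. Qed.

Lemma ccont_kernel (p h : R) : 0 < h ->
  ccont (fun x => ofReal (2 * (h / ((x - p) ^+ 2 + h ^+ 2)))) (p - h) (p + h).
Proof.
move=> h0; have den (x : R) : (x - p) ^+ 2 + h ^+ 2 != 0.
  by rewrite gt_eqF // ltr_wpDl ?sqr_ge0 // exprn_gt0.
split; apply: continuous_in_subspaceT => x _; last exact: cvg_cst.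
apply: cvgM; first exact: cvg_cst.
apply: cvgM; first exact: cvg_cst.
apply: cvgV; first exact: den.
apply: cvgD; last exact: cvg_cst.
by apply: cvgM; (apply: cvgB; [exact: cvg_id|exact: cvg_cst]).
Qed.


(* Opposite sides are paired: 1/(s - ih) - 1/(s + ih) = 2ih/(s^2 + h^2). *)
Lemma J_sing (px py h : R) : 0 < h ->
  J (fun z => (z - cpx px py)^-1) (px - h) (px + h) (py - h) (py + h) =
  2 * 'i * ofReal pi.
Proof.
move=> h0.
have hx : px - h <= px + h by lra.
have hy : py - h <= py + h by lra.
have i2 : 'i * 'i = -1 :> K by rewrite -expr2 sqrCi.
have kd (s t : R) : t != 0 -> s ^+ 2 + t ^+ 2 != 0.
  by move=> t0; rewrite gt_eqF // ltr_wpDl ?sqr_ge0 // exprn_even_gt0.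
have hn : h != 0 by rewrite gt_eqF.
have nz (s t : R) : s != 0 \/ t != 0 -> cpx s t != 0.
  move=> st; apply/eqP; rewrite cpxE => -[s0 t0].
  by move: st; rewrite s0 t0 eqxx; case.
have inv1 (s t : R) : s != 0 \/ t != 0 -> (cpx s t)^-1 =
    cpx (s / (s ^+ 2 + t ^+ 2)) (- t / (s ^+ 2 + t ^+ 2)).
  by move=> st; apply: sub_sing; exact: nz.
have c1 (y : R) : y != py -> ccont (fun x => (cpx x y - cpx px py)^-1) (px - h) (px + h).
  move=> yp; apply: (@hcont R (fun z => (z - cpx px py)^-1)) => x _.
  by apply: hd_inv_cpt; rewrite -subr_eq0 cpxB; apply: nz; right; rewrite subr_eq0.
have c2 (x : R) : x != px -> ccont (fun y => (cpx x y - cpx px py)^-1) (py - h) (py + h).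
  move=> yp; apply: (@vcont R (fun z => (z - cpx px py)^-1)) => y _.
  by apply: hd_inv_cpt; rewrite -subr_eq0 cpxB; apply: nz; left; rewrite subr_eq0.
have e1 : py - h != py by apply/eqP; lra.
have e2 : py + h != py by apply/eqP; lra.
have e3 : px - h != px by apply/eqP; lra.
have e4 : px + h != px by apply/eqP; lra.
have B (f g : R -> K) (a b : R) : ccont f a b -> ccont g a b ->
    cint f a b - cint g a b = cint (fun x => f x + (-1) * g x) a b.
  move=> hf hg; rewrite cintD //; last exact: ccontZ.
  by rewrite cintZ // mulN1r.
rewrite /J (B _ _ _ _ (c1 _ e1) (c1 _ e2)) (B _ _ _ _ (c2 _ e4) (c2 _ e3)).
rewrite (@eq_cint _ _ (fun x => 'i * ofReal (2 * (h / ((x - px) ^+ 2 + h ^+ 2))))); last first.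
  move=> x _; rewrite !cpxB !inv1; [|by right; lra|by right; lra].
  rewrite mulN1r cpxB /cpx.
  have -> : (py - h - py) = - h by ring.
  have -> : (py + h - py) = h by ring.
  rewrite sqrrN subrr ofReal0 add0r; congr (_ * ofReal _).
  by field; exact: kd.
rewrite [in X in _ + X](@eq_cint _ _ (fun x => ofReal (2 * (h / ((x - py) ^+ 2 + h ^+ 2))))); last first.
  move=> y _; rewrite !cpxB !inv1; [|by left; lra|by left; lra].
  rewrite mulN1r cpxB /cpx.
  have -> : (px - h - px) = - h by ring.
  have -> : (px + h - px) = h by ring.
  rewrite sqrrN subrr ofReal0 mulr0 addr0; congr (ofReal _).
  by field; have := kd (y - py) h hn; rewrite addrC.
rewrite cintZ; last exact: ccont_kernel.
rewrite !cint_cauchy_kernel //.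
by rewrite -mulrA mulr_natl mulr2n.
Qed.

Theorem cauchy f (r : R) w : 0 < r ->
  (forall x y : R, - r <= x <= r -> - r <= y <= r -> exists a, hd f (cpx x y) a) ->
  - r < complex.Re w < r -> - r < complex.Im w < r ->
  J (fun z => f z * (z - w)^-1) (- r) r (- r) r = 2 * 'i * ofReal pi * f w.
Proof.
move=> r0 hf /andP[x1 x2] /andP[y1 y2].
set px := complex.Re w in x1 x2; set py := complex.Im w in y1 y2.
have wE : w = cpx px py by rewrite {1}(KE w).
have hr : - r <= r by lra.
have nbd (x y : R) : bd (- r) r (- r) r x y -> cpx x y != w.
  move=> [_ _ b]; rewrite wE; apply/eqP; rewrite !cpxE => -[ex ey].
  by move: b; rewrite ex ey => -[]; lra.
pose F z := (f z + (-1) * f w) * (z - w)^-1.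
have hF (x y : R) : - r <= x <= r -> - r <= y <= r -> cpx x y != w -> exists a, hd F (cpx x y) a.
  move=> hx hy xy; have [a ha] := hf x y hx hy; have [b hb] := hd_inv xy.
  eexists; apply: hdM hb; apply: hdD ha _; exact: hd_cst.
have bF : bcont F (- r) r (- r) r.
  move=> x y b; have [hx hy _] := b.
  by have [a] := hF x y hx hy (nbd _ _ b); exact: hd_cpt.
have bS : bcont (fun z => (z - w)^-1) (- r) r (- r) r.
  by move=> x y b; apply: hd_inv_cpt; exact: nbd.
have [a ha] : exists a, hd f w a by rewrite wE; apply: hf; rewrite !ltW.
have [d d0 hd] := ha 1 ltr01.
have JS (h : R) : 0 < h -> - r <= px - h -> px + h <= r -> - r <= py - h -> py + h <= r ->
   J (fun z => (z - w)^-1) (- r) r (- r) r = 2 * 'i * ofReal pi.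
  move=> h0 a1 a2 b1 b2; rewrite (J_shrink h0 a1 a2 b1 b2) wE ?J_sing //.
  by move=> x y _ _ xy; exact: hd_inv.
have [h0 h00 fits] : exists2 h0 : R, 0 < h0 & forall h : R, h <= h0 ->
    [/\ - r <= px - h, px + h <= r, - r <= py - h & py + h <= r].
  exists (Num.min (Num.min (r - px) (px + r)) (Num.min (r - py) (py + r))).
    by rewrite !lt_min; apply/andP; split; apply/andP; split; lra.
  by move=> h; rewrite !le_min => /andP[/andP[? ?] /andP[? ?]]; split; lra.
have JF0 : J F (- r) r (- r) r = 0.
  apply/eqP; rewrite -rn_eq0 eq_le rn_ge0 andbT; apply/ler_addgt0Pr => /= e e0; rewrite add0r.
  have a0 := rn_ge0 a.
  pose h : R := Num.min h0 (Num.min (d / 4) (e / (16 * (1 + rn a)))).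
  have hh : 0 < h.
    rewrite !lt_min h00 /= divr_gt0 //= divr_gt0 // mulr_gt0 //; clear -a0; lra.
  have [a1 a2 b1 b2] : [/\ - r <= px - h, px + h <= r, - r <= py - h & py + h <= r].
    by apply: fits; rewrite ge_min lexx.
  have hd4 : h <= d / 4 by rewrite !ge_min lexx !orbT.
  have he : h <= e / (16 * (1 + rn a)) by rewrite !ge_min lexx !orbT.
  rewrite (J_shrink hh a1 a2 b1 b2); last by move=> x y u v; rewrite -wE; exact: hF.
  have q1 : px - h <= px + h by clear -hh; lra.
  have q2 : py - h <= py + h by clear -hh; lra.
  have nw (x y : R) : bd (px - h) (px + h) (py - h) (py + h) x y -> cpx x y != w.
    move=> [_ _ b]; rewrite wE; apply/eqP; rewrite !cpxE => -[ex ey].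
    by move: b; rewrite ex ey; clear -hh => -[]; lra.
  apply: (@le_trans _ _ (4 * (1 + rn a) * ((px + h - (px - h)) + (py + h - (py - h))))).
    apply: J_bound => // x y b; have [/andP[u1 u2] /andP[v1 v2] _] := b.
      have [||c] := hF x y _ _ (nw _ _ b); [clear -a1 a2 u1 u2; lra|clear -b1 b2 v1 v2; lra|].
      exact: hd_cpt.
    have zn : rn (cpx x y - w) < d.
      rewrite wE cpxB; apply: le_lt_trans (rn_cpx _ _) _.
      have n1 : `|x - px| <= h by rewrite ler_norml; clear -u1 u2; apply/andP; split; lra.
      have n2 : `|y - py| <= h by rewrite ler_norml; clear -v1 v2; apply/andP; split; lra.
      clear -n1 n2 hd4 d0; lra.
    rewrite /F rnM rnV ler_pdivrMr ?rn_gt0 ?subr_eq0 ?nw //.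
    have := hd _ zn; rewrite subrKC mulN1r.
    move=> hb; rewrite -(subrK ((cpx x y - w) * a) (f _ - f w)).
    apply: le_trans (rnD _ _) _; rewrite (mulrDl 1 (rn a)); apply: lerD => //.
    by rewrite rnM mulrC.
  have p1 : 0 < 16 * (1 + rn a) by rewrite mulr_gt0 //; clear -a0; lra.
  rewrite ler_pdivlMr // in he; clear -he; lra.
have := JS h0 h00; have [a1 a2 b1 b2] := fits h0 (lexx _).
move=> /(_ a1 a2 b1 b2) JSE.
rewrite (@eq_J _ _ _ _ _ hr hr _ (fun z => F z + f w * (z - w)^-1)); last first.
  by move=> x y _; rewrite /F -mulrDl mulN1r subrK.
rewrite JD // ?JF0 ?add0r; last by move=> x y /bS; exact: cptZ.
by rewrite JZ // JSE mulrC.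
Qed.
End Cauchy.

(** * Cauchy estimates in normed modules *)

Section OneVariable.
Variable R : realType.
Local Notation K := (Cx R).
Implicit Types (f g : K -> K) (z w a b c h : K) (r M : R).

Definition tpi : K := 2 * 'i * ofReal pi.

Lemma tpi_ge : 2 <= rn tpi.
Proof.
rewrite /tpi !rnM rn_i mulr1 rn_ofReal -ofReal_nat rn_ofReal !ger0_norm ?pi_ge0 //.
have := pi_ge2 R; lra.
Qed.

Lemma tpi_neq0 : tpi != 0.
Proof. by rewrite -rn_gt0; have := tpi_ge; lra. Qed.

Lemma bd_rn r x y : bd (- r) r (- r) r x y -> r <= rn (cpx x y : K) <= 2 * r.
Proof.
move=> [hx hy hb]; apply/andP; split; last first.
  apply: le_trans (rn_cpx _ _) _.
  have : `|x| <= r by rewrite ler_norml.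
  have : `|y| <= r by rewrite ler_norml.
  clear; lra.
have A : `|x| <= rn (cpx x y : K) by have := rn_Re (cpx x y); rewrite cpx_Re.
have B : `|y| <= rn (cpx x y : K) by have := rn_Im (cpx x y); rewrite cpx_Im.
case: hb => e; move: A B; rewrite e ?normrN.
- by have := ler_norm r; clear; lra.
- by have := ler_norm r; clear; lra.
- by have := ler_norm r; clear; lra.
- by have := ler_norm r; clear; lra.
Qed.

Lemma box_rn r (x y : R) : - r <= x <= r -> - r <= y <= r -> rn (cpx x y : K) <= 2 * r.
Proof.
move=> hx hy; apply: le_trans (rn_cpx _ _) _.
have : `|x| <= r by rewrite ler_norml.
have : `|y| <= r by rewrite ler_norml.
clear; lra.
Qed.

(* Cauchy's formula is used along squares instead of circles. *)
Definition CI r f : K := J f (- r) r (- r) r.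

Definition ring_cont r f := forall z, r <= rn z <= 2 * r -> cpt f z.

Lemma ring_cont_bcont r f : ring_cont r f -> bcont f (- r) r (- r) r.
Proof. by move=> h x y /bd_rn; exact: h. Qed.

Section CI.
Variable r : R.
Hypothesis r0 : 0 < r.

Let hr : - r <= r. Proof. by move: r0; lra. Qed.

Lemma CI_bound f M : ring_cont r f ->
  (forall z, r <= rn z <= 2 * r -> rn (f z) <= M) -> rn (CI r f) <= 16 * M * r.
Proof.
move=> cf hM; have -> : 16 * M * r = 4 * M * ((r - - r) + (r - - r)) by ring.
apply: (@J_bound _ _ _ _ _ hr hr); first exact: ring_cont_bcont.
by move=> x y /bd_rn; exact: hM.
Qed.

Lemma CID f g : ring_cont r f -> ring_cont r g ->
  CI r (fun z => f z + g z) = CI r f + CI r g.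
Proof. by move=> /ring_cont_bcont hf /ring_cont_bcont hg; exact: (JD hr hr). Qed.

Lemma CIZ c f : ring_cont r f -> CI r (fun z => c * f z) = c * CI r f.
Proof. by move=> /ring_cont_bcont hf; exact: (JZ hr hr). Qed.

Lemma eq_CI f g : (forall z, r <= rn z <= 2 * r -> f z = g z) -> CI r f = CI r g.
Proof. by move=> h; apply: (eq_J hr hr) => x y /bd_rn; exact: h. Qed.

Lemma CI_cauchy g w : (forall z, rn z <= 2 * r -> exists a, hd g z a) ->
  rn w < r -> CI r (fun z => g z * (z - w)^-1) = tpi * g w.
Proof.
move=> hg hw; apply: cauchy => //.
- by move=> x y hx hy; apply: hg; exact: box_rn.
- by rewrite -ltr_norml; apply: le_lt_trans (rn_Re _) hw.
- by rewrite -ltr_norml; apply: le_lt_trans (rn_Im _) hw.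
Qed.

End CI.

Lemma cptM (V : normedZmodType K) (f g : V -> K) (z : V) : cpt f z -> cpt g z -> cpt (fun z : V => f z * g z) z.
Proof.
move=> hf hg e e0.
pose A := 1 + rn (f z) + rn (g z).
have fz := rn_ge0 (f z); have gz := rn_ge0 (g z).
have A1 : 1 <= A by rewrite /A; lra.
pose e1 := Num.min 1 (e / (2 * A)).
have e10 : 0 < e1 by rewrite lt_min ltr01 divr_gt0 // mulr_gt0 //; lra.
have e11 : e1 <= 1 by rewrite ge_min lexx.
have e12 : e1 * (2 * A) <= e.
  by rewrite -ler_pdivlMr ?mulr_gt0 //; [rewrite ge_min lexx orbT|lra].
have [d1 d10 h1] := hf _ e10; have [d2 d20 h2] := hg _ e10.
exists (Num.min d1 d2) => [|w]; first by rewrite lt_min d10.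
rewrite lt_min => /andP[/h1 l1 /h2 l2].
have -> : f w * g w - f z * g z =
  (f w - f z) * (g w - g z) + (f w - f z) * g z + f z * (g w - g z).
  by move: (f w) (f z) (g w) (g z) => *; absK R => C *; ring.
apply: le_lt_trans (rnD _ _) _; apply: le_lt_trans (lerD (rnD _ _) (lexx _)) _.
rewrite !rnM; have u0 := rn_ge0 (f w - f z); have v0 := rn_ge0 (g w - g z).
move: e12 A1 l1 l2 u0 v0 fz gz; rewrite /A.
move: (rn (f w - f z)) (rn (g w - g z)) (rn (f z)) (rn (g z)) (e1) e10 e11.
clear => u v p q e1 *; nra.
Qed.

Lemma ring_contM r f g : ring_cont r f -> ring_cont r g -> ring_cont r (fun z => f z * g z).
Proof. by move=> hf hg z hz; apply: cptM; [exact: hf|exact: hg]. Qed.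

Lemma ring_inv r w : rn w < r -> ring_cont r (fun z => (z - w)^-1).
Proof.
move=> hw z /andP[hz _]; apply: hd_inv_cpt; apply/eqP => zw.
by move: hz; rewrite zw leNgt hw.
Qed.

Lemma ring_V r : 0 < r -> ring_cont r (fun z => z^-1).
Proof.
move=> r0; have := @ring_inv r 0; rewrite rn0 => /(_ r0).
by congr ring_cont; apply/funext => z; rewrite subr0.
Qed.

Lemma hd_uniq g z a b : hd g z a -> hd g z b -> a = b.
Proof.
by move=> /hd_derive[_ <-] /hd_derive[_ <-].
Qed.

Lemma ring_g g r : (forall z, rn z <= 2 * r -> exists a, hd g z a) -> ring_cont r g.
Proof. move=> hg; by move=> z /andP[_ /hg[a]]; exact: hd_cpt. Qed.

Lemma cauchy_max g r M w (r0 : 0 < r) (hg : forall z, rn z <= 2 * r -> exists a, hd g z a) : (forall z, r <= rn z <= 2 * r -> rn (g z) <= M) ->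
  rn w <= r / 2 -> rn (g w) <= 16 * M.
Proof.
move=> hM hw; have hwr : rn w < r by move: r0 hw; clear; lra.
have M0 : 0 <= M.
  apply: le_trans (rn_ge0 (g (ofReal r))) _; apply: hM; rewrite rn_ofReal gtr0_norm //.
  by move: r0; clear; lra.
have := @CI_bound r r0 (fun z => g z * (z - w)^-1) (M * (r / 2)^-1).
rewrite CI_cauchy // rnM => H.
have : rn tpi * rn (g w) <= 16 * (M / (r / 2)) * r.
  apply: H; first by apply: ring_contM; [exact: ring_g hg|exact: ring_inv].
  move=> z hz; rewrite rnM rnV; apply: ler_pM; rewrite ?rn_ge0 ?invr_ge0 ?rn_ge0 ?hM //.
  have h1 := rn_rev z w; case/andP: hz => hz _.
  by rewrite lef_pV2 ?posrE; move: r0 hw hz h1; clear; lra.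
have -> : 16 * (M / (r / 2)) * r = 32 * M by field; rewrite gt_eqF.
have := tpi_ge; have := rn_ge0 (g w); move: M0; clear; nra.
Qed.

Lemma taylor_CI g r M h (r0 : 0 < r) (hg : forall z, rn z <= 2 * r -> exists a, hd g z a) : (forall z, r <= rn z <= 2 * r -> rn (g z) <= M) ->
  rn h <= r / 2 ->
  rn (g h - g 0 - h * (tpi^-1 * CI r (fun z => g z * (z^-1 * z^-1)))) <=
  16 * M * rn h ^+ 2 / r ^+ 2.
Proof.
move=> hM hh; have hhr : rn h < r by move: r0 hh; clear; lra.
have rn00 : rn (0 : K) < r by rewrite rn0.
have cV := ring_V r0; have cg := ring_g hg.
pose k z := h ^+ 2 * (g z * (z^-1 * z^-1 * (z - h)^-1)).
have ck0 : ring_cont r (fun z => g z * (z^-1 * z^-1 * (z - h)^-1)).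
  by do !apply: ring_contM => //; exact: ring_inv.
have ck : ring_cont r k by move=> z hz; apply: cptZ; exact: ck0.
have c2 : ring_cont r (fun z => g z * (z^-1 * z^-1)) by do !apply: ring_contM.
have E : CI r (fun z => g z * (z - h)^-1) = CI r (fun z => g z * (z - 0)^-1) +
    h * CI r (fun z => g z * (z^-1 * z^-1)) + CI r k.
  rewrite -(CIZ r0) // -!(CID r0) //; last first.
  - by move=> z hz; apply: cptZ; exact: c2.
  - by apply: ring_contM => //; exact: ring_inv.
  - move=> z hz; apply: cptD; last by apply: cptZ; exact: c2.
    by apply: cptM; [exact: cg|apply: ring_inv hz].
  apply: (eq_CI r0) => z /andP[hz _]; rewrite /k subr0.
  have z0 : z != 0 by rewrite -rn_gt0; apply: lt_le_trans hz.
  have zh : z - h != 0.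
    by rewrite subr_eq0; apply/eqP => e; move: hz; rewrite e leNgt hhr.
  move: (g z) z0 zh => G; clear; move: z h G; generalize K => C z h G z0 zh.
  by field; rewrite z0 zh.
rewrite !(CI_cauchy r0) // in E.
have Ek : g h - g 0 - h * (tpi^-1 * CI r (fun z => g z * (z^-1 * z^-1))) = tpi^-1 * CI r k.
  have := tpi_neq0; have := E; move: (CI r k) (CI r _) (tpi) (g h) (g 0).
  clear; move: h; generalize K => C h k2 c t gh g0 e t0.
  have -> : gh = t^-1 * (t * gh) by field.
  by rewrite e; field.
rewrite Ek rnM rnV.
have bk : rn (CI r k) <= 16 * (rn h ^+ 2 * (M * (r^-1 * r^-1 * (r / 2)^-1))) * r.
  apply: (CI_bound r0) => // z hz; rewrite /k (rnM (h ^+ 2)) rnX; case/andP: (hz) => hz1 _.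
  rewrite ler_wpM2l ?exprn_ge0 ?rn_ge0 // !rnM !rnV.
  have h1 := rn_rev z h.
  have i1 : (rn z)^-1 <= r^-1 by rewrite lef_pV2 ?posrE //; apply: lt_le_trans hz1.
  have i2 : (rn (z - h))^-1 <= (r / 2)^-1.
    by rewrite lef_pV2 ?posrE; move: r0 hh hz1 h1; clear; lra.
  have p1 : 0 <= (rn z)^-1 by rewrite invr_ge0 rn_ge0.
  have p2 : 0 <= (rn (z - h))^-1 by rewrite invr_ge0 rn_ge0.
  apply: ler_pM => //; rewrite ?rn_ge0 ?mulr_ge0 ?hM //.
  by apply: ler_pM => //; rewrite ?mulr_ge0 //; apply: ler_pM.
have r1 : r != 0 by rewrite gt_eqF.
have -> : 16 * M * rn h ^+ 2 / r ^+ 2 =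
  2^-1 * (16 * (rn h ^+ 2 * (M * (r^-1 * r^-1 * (r / 2)^-1))) * r) by field.
apply: ler_pM => //; rewrite ?invr_ge0 ?rn_ge0 //.
rewrite lef_pV2 ?posrE ?tpi_ge //; have := tpi_ge; clear; lra.
Qed.

Lemma hd_CI g r M (r0 : 0 < r) (hg : forall z, rn z <= 2 * r -> exists a, hd g z a) :
  (forall z, r <= rn z <= 2 * r -> rn (g z) <= M) ->
  hd g 0 (tpi^-1 * CI r (fun z => g z * (z^-1 * z^-1))).
Proof.
move=> hM e e0; have M0 : 0 <= M.
  apply: le_trans (rn_ge0 (g (ofReal r))) _; apply: hM; rewrite rn_ofReal gtr0_norm //.
  by move: r0; clear; lra.
have p : 0 < 16 * M + 1 by move: M0; clear; lra.
exists (Num.min (r / 2) (e * r ^+ 2 / (16 * M + 1))).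
  by rewrite lt_min !divr_gt0 // mulr_gt0 // exprn_gt0.
move=> h; rewrite lt_min => /andP[h1 h2]; rewrite add0r.
apply: le_trans (taylor_CI r0 hg hM (ltW h1)) _.
rewrite ltr_pdivlMr // in h2; rewrite ler_pdivrMr ?exprn_gt0 //.
have := rn_ge0 h; have : 0 < r ^+ 2 by rewrite exprn_gt0.
move: h2; move: (r ^+ 2) (rn h) M0 e0; clear => s u M0 e0 h2 s0 u0; nra.
Qed.

Lemma deriv_CI g r M a (r0 : 0 < r) (hg : forall z, rn z <= 2 * r -> exists a, hd g z a) :
  (forall z, r <= rn z <= 2 * r -> rn (g z) <= M) -> hd g 0 a ->
  a = tpi^-1 * CI r (fun z => g z * (z^-1 * z^-1)).
Proof. by move=> hM ha; apply: hd_uniq ha _; exact: hd_CI hM. Qed.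

Lemma ring_VV r : 0 < r -> ring_cont r (fun z => z^-1 * z^-1).
Proof. by move=> r0; apply: ring_contM; exact: ring_V. Qed.

Lemma rn_VV r z : 0 < r -> r <= rn z -> rn (z^-1 * z^-1) <= (r ^+ 2)^-1.
Proof.
move=> r0 hz; have z0 : 0 < rn z by apply: lt_le_trans hz.
rewrite rnM rnV -invfM lef_pV2 ?posrE ?mulr_gt0 //.
by rewrite expr2 ler_pM // ltW.
Qed.

Lemma CI_VV_bound g r M (r0 : 0 < r) : ring_cont r g ->
  (forall z, r <= rn z <= 2 * r -> rn (g z) <= M) ->
  rn (tpi^-1 * CI r (fun z => g z * (z^-1 * z^-1))) <= 8 * M / r.
Proof.
move=> cg hM; rewrite rnM rnV.
have b : rn (CI r (fun z => g z * (z^-1 * z^-1))) <= 16 * (M * (r ^+ 2)^-1) * r.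
  apply: (CI_bound r0); first by apply: ring_contM => //; exact: ring_VV.
  move=> z hz; rewrite rnM; apply: ler_pM; rewrite ?rn_ge0 ?hM //.
  by apply: rn_VV => //; case/andP: hz.
have -> : 8 * M / r = 2^-1 * (16 * (M * (r ^+ 2)^-1) * r) by field; rewrite gt_eqF.
apply: ler_pM => //; rewrite ?invr_ge0 ?rn_ge0 //.
rewrite lef_pV2 ?posrE ?tpi_ge //; have := tpi_ge; clear; lra.
Qed.
End OneVariable.

Section SeveralVariables.
Variable R : realType.
Local Notation K := (Cx R).

Section Differentiable.
Variables (V W : normedModType K).
Implicit Types (f : V -> W).

Lemma diff_est f x : differentiable f x -> forall e : R, 0 < e ->
  exists2 d : R, 0 < d & forall h, rn h < d -> rn (f (x + h) - f x - 'd f x h) <= e * rn h.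
Proof.
move=> /diff_locallyP[_ /eqaddoP df] e e0.
have := df (ofReal e); rewrite -{1}(ofReal0 R) ltr_ofReal => /(_ e0) /nbhs_rnP[d d0 hd].
exists d => // h hh; have /hd : rn (h - 0) < d by rewrite subr0.
have -> : (f \o shift x - (cst (f x) + 'd f x)) h = f (x + h) - f x - 'd f x h.
  by rewrite [x + h]addrC -addrA -opprD.
by rewrite !rnE -ofRealM ler_ofReal.
Qed.

Lemma est_diff f x (L : {linear V -> W}) : continuous L ->
  (forall e : R, 0 < e -> exists2 d : R, 0 < d &
     forall h, rn h < d -> rn (f (x + h) - f x - L h) <= e * rn h) ->
  differentiable f x /\ 'd f x = L :> (V -> W).
Proof.
move=> cL H.
have E : f \o shift x = cst (f x) + L +o_ (0 : V) id.
  apply/eqaddoP => _/gt0_ofReal[e e0 ->]; have [d d0 hd] := H e e0.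
  apply/nbhs_rnP; exists d => // h; rewrite subr0 => /hd.
  have -> : (f \o shift x - (cst (f x) + L)) h = f (x + h) - f x - L h.
    by rewrite [x + h]addrC -addrA -opprD.
  by rewrite !rnE -ofRealM ler_ofReal.
have D := diff_unique cL E; split => //.
by apply/diff_locallyP; rewrite D.
Qed.
End Differentiable.

Section Scalar.
Variable V : normedModType K.
Implicit Types (f : V -> K) (x v h : V) (z : K) (r s M : R).

Lemma line_hd f x v z : differentiable f (x + z *: v) ->
  hd (fun z => f (x + z *: v)) z ('d f (x + z *: v) v).
Proof.
move=> /diff_est H e e0.
have v1 : 0 < 1 + rn v by have := rn_ge0 v; lra.
have [d d0 hd] := H (e / (1 + rn v)) (divr_gt0 e0 v1).
exists (d / (1 + rn v)) => [|h]; first exact: divr_gt0.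
rewrite ltr_pdivlMr // => hh.
have vh : rn (h *: v) <= rn h * (1 + rn v).
  by rewrite rnZ ler_wpM2l ?rn_ge0 // lerDr.
have := hd _ (le_lt_trans vh hh); rewrite linearZ scalerDl addrA => /le_trans; apply.
rewrite -mulrA ler_wpM2l ?(ltW e0) // mulrC ler_pdivrMr //.
Qed.

Section Local.
Variables (f : V -> K) (x : V) (s M : R).
Hypotheses (s0 : 0 < s) (df : forall y, rn (y - x) <= 2 * s -> differentiable f y)
  (hM : forall y, rn (y - x) <= 2 * s -> rn (f y) <= M).

Lemma local_line v r z : r * rn v <= s -> rn z <= 2 * r ->
  rn (x + z *: v - x) <= 2 * s.
Proof.
move=> rv zr; rewrite addrC addKr rnZ.
apply: le_trans (ler_wpM2r (rn_ge0 v) zr) _; lra.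
Qed.

Lemma diff_CI v r : 0 < r -> r * rn v <= s ->
  'd f x v = (tpi R)^-1 * CI r (fun z => f (x + z *: v) * (z^-1 * z^-1)).
Proof.
move=> r0 rv; apply: (@deriv_CI _ (fun z => f (x + z *: v)) r M) => //.
- by move=> z zr; exists ('d f (x + z *: v) v); apply: line_hd; apply: df; exact: local_line zr.
- by move=> z /andP[_ zr]; apply: hM; exact: local_line zr.
- have := @line_hd f x v 0; rewrite scale0r addr0; apply.
  by apply: df; rewrite subrr rn0 mulr_ge0 // ltW.
Qed.

Lemma diff_bound v : rn ('d f x v) <= 8 * M / s * rn v.
Proof.
have [->|v0] := eqVneq v 0; first by rewrite linear0 !rn0 mulr0.
have vp : 0 < rn v by rewrite rn_gt0.
have r0 : 0 < s / rn v by rewrite divr_gt0.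
have rv : s / rn v * rn v <= s by rewrite divfK // gt_eqF.
rewrite (diff_CI r0 rv); apply: le_trans (@CI_VV_bound _ _ _ M r0 _ _) _.
- apply: ring_g => z zr; exists ('d f (x + z *: v) v).
  by apply: line_hd; apply: df; exact: local_line zr.
- by move=> z /andP[_ zr]; apply: hM; exact: local_line zr.
- by rewrite invf_div mulrA mulrAC.
Qed.

Lemma taylor2 h : rn h <= s / 2 ->
  rn (f (x + h) - f x - 'd f x h) <= 16 * M / s ^+ 2 * rn h ^+ 2.
Proof.
move=> hh; have [->|h0] := eqVneq h 0.
  by rewrite addr0 subrr linear0 subrr !rn0 expr0n /= mulr0.
have hp : 0 < rn h by rewrite rn_gt0.
pose v := (ofReal (rn h))^-1 *: h.
have on : ofReal (rn h) != 0 by rewrite ofReal_eq0 gt_eqF.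
have hE : h = ofReal (rn h) *: v by rewrite /v scalerA divff // scale1r.
have v1 : rn v = 1 by rewrite /v rnZ rnV rn_ofReal ger0_norm ?rn_ge0 // mulVf ?gt_eqF.
have sv : s * rn v <= s by rewrite v1 mulr1.
have := @taylor_CI _ (fun z => f (x + z *: v)) s M (ofReal (rn h)) s0.
rewrite -hE scale0r addr0 -(diff_CI s0 sv).
have -> : 'd f x h = ofReal (rn h) * 'd f x v by rewrite {1}hE linearZ.
rewrite rn_ofReal (ger0_norm (ltW hp)) mulrAC; apply=> //.
- by move=> z zr; exists ('d f (x + z *: v) v); apply: line_hd; apply: df; exact: local_line zr.
- by move=> z /andP[_ zr]; apply: hM; exact: local_line zr.
Qed.

End Local.

Lemma liouville f M : (forall y, differentiable f y) -> (forall y, rn (f y) <= M) ->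
  forall x y, f x = f y.
Proof.
move=> df hM x y; apply/eqP; rewrite -subr_eq0 -rn_eq0 eq_le rn_ge0 andbT.
have M0 : 0 <= M by apply: le_trans (hM x); exact: rn_ge0.
pose h := x - y; have h0 := rn_ge0 h.
apply/ler_addgt0Pr => /= e e0; rewrite add0r.
pose s := 2 * rn h + 1 + (24 * M * (rn h + 1)) / e.
have s0 : 2 * rn h + 1 <= s by rewrite lerDl divr_ge0 ?(ltW e0) // !mulr_ge0 // addr_ge0.
have sp : 0 < s by lra.
have b1 := @diff_bound f y s M sp (fun y _ => df y) (fun y _ => hM y) h.
have b2 := @taylor2 f y s M sp (fun y _ => df y) (fun y _ => hM y) h.
have hs : rn h <= s / 2 by lra.
have -> : f x - f y = (f (y + h) - f y - 'd f y h) + 'd f y h by rewrite subrK subrKC.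
apply: le_trans (rnD _ _) _; apply: le_trans (lerD (b2 hs) b1) _.
have k : rn h ^+ 2 / s ^+ 2 <= rn h / s.
  rewrite -expr_div_n expr2 ler_piMl ?divr_ge0 ?(ltW sp) //.
  by rewrite ler_pdivrMr // mul1r; lra.
have -> : 16 * M / s ^+ 2 * rn h ^+ 2 + 8 * M / s * rn h =
   16 * M * (rn h ^+ 2 / s ^+ 2) + 8 * M * (rn h / s) by ring.
apply: (@le_trans _ _ (24 * M * (rn h / s))).
  have := ler_wpM2l (mulr_ge0 (ler0n R 16) M0) k; lra.
rewrite mulrA ler_pdivrMr //.
have : 24 * M * (rn h + 1) <= e * s.
  rewrite -ler_pdivrMl // mulrC /s lerDr; lra.
have : 24 * M * rn h <= 24 * M * (rn h + 1) by rewrite ler_wpM2l ?mulr_ge0 //; lra.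
lra.
Qed.
End Scalar.
End SeveralVariables.

Section SecondDerivative.
Variable R : realType.
Local Notation K := (Cx R).
Variable V : normedModType K.
Implicit Types (f : V -> K) (x v h : V) (z : K) (r s M : R).

Lemma diff_shift f x k : differentiable f (x + k) ->
  differentiable (fun y => f (y + k)) x /\
  forall v, 'd (fun y => f (y + k)) x v = 'd f (x + k) v.
Proof.
move=> D; have /diff_est H := D.
have [||dF dE] := @est_diff R V K (fun y => f (y + k)) x ('d f (x + k)).
- exact: diff_continuous.
- by move=> e /H[d d0 hd]; exists d => // h /hd; rewrite (addrAC x).
- by split=> // v; rewrite dE.
Qed.

Definition dball (f : V -> K) x s M : Prop :=
  forall y, rn (y - x) <= s -> differentiable f y /\ rn (f y) <= M.

Lemma dball_sub f x s M y s' : dball f x s M -> rn (y - x) + s' <= s -> dball f y s' M.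
Proof.
move=> H le w hw; apply: H; apply: le_trans (rn_tri w y x) _.
by apply: le_trans le; rewrite addrC lerD2l.
Qed.

Lemma dball_near f x : (\forall y \near x, differentiable f y) ->
  forall A : R, 0 < A -> exists s M, 0 < s /\ dball f x (A * s) M.
Proof.
move=> /nbhs_rnP[d d0 hd] A A0.
have /differentiable_continuous/continuous_rnP/(_ 1 ltr01)[d' d'0 hd'] : differentiable f x.
  by apply: hd; rewrite subrr rn0.
pose s := Num.min d d' / (2 * A); have m0 : 0 < Num.min d d' by rewrite lt_min d0.
exists s, (rn (f x) + 1); split; first by rewrite divr_gt0 // mulr_gt0.
have -> : A * s = Num.min d d' / 2 by rewrite /s; field; rewrite gt_eqF.
move=> y hy; have : rn (y - x) < Num.min d d' by apply: le_lt_trans hy _; lra.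
rewrite lt_min => /andP[/hd ? /hd' hf]; split => //.
by have := rn_rev (f y) (f x); lra.
Qed.

Section Data.
Variables (f : V -> K) (x0 : V) (s M : R).
Hypotheses (s0 : 0 < s) (H : dball f x0 (6 * s) M).

Let C1 := 8 * M / s.

Lemma dball_bound x v : rn (x - x0) <= 4 * s -> rn ('d f x v) <= C1 * rn v.
Proof.
move=> hx; have Hx : dball f x (2 * s) M by apply: dball_sub H _; lra.
by apply: diff_bound => // y /Hx[].
Qed.

Lemma dball_taylor x h : rn (x - x0) <= 4 * s -> rn h <= s / 2 ->
  rn (f (x + h) - f x - 'd f x h) <= 16 * M / s ^+ 2 * rn h ^+ 2.
Proof.
move=> hx hh; have Hx : dball f x (2 * s) M by apply: dball_sub H _; lra.
by apply: taylor2 => // y /Hx[].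
Qed.

Lemma dball_M0 : 0 <= M.
Proof.
have [|_ h] := H (y := x0); first by rewrite subrr rn0 mulr_ge0 // ltW.
by apply: le_trans h; exact: rn_ge0.
Qed.

Lemma dball_lip x h : rn (x - x0) <= 4 * s -> rn h <= s / 2 ->
  rn (f (x + h) - f x) <= 16 * M / s * rn h.
Proof.
move=> hx hh; have t := dball_taylor hx hh; have b := dball_bound h hx.
rewrite -(subrK ('d f x h) (f (x + h) - f x)).
apply: le_trans (rnD _ _) _; apply: le_trans (lerD t b) _.
have M0 := dball_M0; have h0 := rn_ge0 h.
have -> : 16 * M / s ^+ 2 * rn h ^+ 2 = 16 * M / s * rn h * (rn h / s).
  by field; rewrite gt_eqF.
have hs : rn h / s <= 2^-1 by rewrite ler_pdivrMr // mulrC.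
have p : 0 <= 16 * M / s * rn h by rewrite !mulr_ge0 // invr_ge0 ltW.
have := ler_wpM2l p hs.
pose u := M / s * rn h.
have -> : C1 * rn h = 8 * u by rewrite /u /C1; ring.
have -> : 16 * M / s * rn h = 16 * u by rewrite /u; ring.
by move: (u) (16 * u * (rn h / s)) => a b'; lra.
Qed.

Lemma dball_dcont x v : rn (x - x0) <= 2 * s -> cpt (fun x => 'd f x v) x.
Proof.
move=> hx e e0; have sp := s0; have M0 := dball_M0; have v0 := rn_ge0 v.
pose A := 8 * (16 * M / s) / s * rn v.
have A0 : 0 <= A by rewrite !mulr_ge0 // ?invr_ge0 ltW.
have A1 : 0 < A + 1 by lra.
exists (Num.min (s / 2) (e / (A + 1))) => [|w]; first by rewrite lt_min !divr_gt0.
rewrite lt_min => /andP[h1 h2]; pose k := w - x.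
pose phi y := f (y + k) - f y.
have dphi y : rn (y - x) <= 2 * s -> differentiable phi y /\ rn (phi y) <= 16 * M / s * rn k.
  move=> hy; have hyx : rn (y - x0) <= 4 * s.
    by apply: le_trans (rn_tri y x x0) _; lra.
  split; last by apply: dball_lip => //; rewrite ltW.
  have [|d1 _] := H (y := y + k).
    by rewrite addrAC; apply: le_trans (rnD _ _) _; rewrite /k; lra.
  have [|d2 _] := H (y := y); first by lra.
  by apply: differentiableB => //; exact: (diff_shift d1).1.
have B : rn ('d phi x v) <= 8 * (16 * M / s * rn k) / s * rn v.
  by apply: (@diff_bound R V phi x s _ s0) => y /dphi[].
have E : 'd phi x v = 'd f w v - 'd f x v.
  have [|d1 _] := H (y := x); first by lra.
  have [|d2 _] := H (y := x + k).
    by rewrite addrAC; apply: le_trans (rnD _ _) _; rewrite /k; lra.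
  have [d3 e3] := diff_shift d2.
  transitivity ('d f (x + k) v - 'd f x v); last by rewrite /k subrKC.
  rewrite -e3; have := diffB d3 d1; rewrite funeqE => /(_ v) /= <-.
  reflexivity.
rewrite E in B; apply: le_lt_trans B _.
apply: (@le_lt_trans _ _ (A * rn k)).
  by rewrite /A le_eqVlt; apply/orP; left; apply/eqP; ring.
rewrite ltr_pdivlMr // in h2; rewrite /k; have := rn_ge0 (w - x); nra.
Qed.



(* Differentiation of Cauchy's formula for ['d f x v] under the integral sign. *)
Lemma diff_diff_CI v r : 0 < r -> r * rn v <= s ->
  differentiable (fun x => 'd f x v) x0 /\
  forall h, 'd (fun x => 'd f x v) x0 h =
    (tpi R)^-1 * CI r (fun z => 'd f (x0 + z *: v) h * (z^-1 * z^-1)).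
Proof.
move=> r0 rv; have sp := s0; have M0 := dball_M0.
have inb z : r <= rn z <= 2 * r -> rn (x0 + z *: v - x0) <= 2 * s.
  move=> /andP[_ zr]; rewrite addrC addKr rnZ.
  by apply: le_trans (ler_wpM2r (rn_ge0 v) zr) _; lra.
have lc z : cpt (fun z => x0 + z *: v) z.
  move=> e e0; have v1 : 0 < 1 + rn v by have := rn_ge0 v; lra.
  exists (e / (1 + rn v)) => [|w]; first exact: divr_gt0.
  rewrite ltr_pdivlMr // => hw; rewrite opprD addrACA subrr add0r -scalerBl rnZ.
  by apply: le_lt_trans hw; rewrite ler_wpM2l ?rn_ge0 // lerDr.
have cd h : ring_cont r (fun z => 'd f (x0 + z *: v) h).
  move=> z /inb hz e e0; have [d d0 hd] := dball_dcont h hz e0.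
  by have [d' d'0 hd'] := lc z d d0; exists d' => // w /hd' /hd.
have cdV h : ring_cont r (fun z => 'd f (x0 + z *: v) h * (z^-1 * z^-1)).
  by apply: ring_contM => //; exact: ring_VV.
pose L h := (tpi R)^-1 * CI r (fun z => 'd f (x0 + z *: v) h * (z^-1 * z^-1)).
have Llin : linear (L : V -> K^o).
  move=> k a b; rewrite /L.
  rewrite (@eq_CI _ r r0 _ (fun z => k * ('d f (x0 + z *: v) a * (z^-1 * z^-1)) +
       'd f (x0 + z *: v) b * (z^-1 * z^-1))); last first.
    by move=> z _; rewrite linearP mulrDl -mulrA.
  rewrite (CID r0) //; last by move=> z hz; apply: cptZ; exact: cdV.
  by rewrite (CIZ r0) // mulrDr mulrCA.
have Lb h : rn (L h) <= 8 * (C1 * rn h) / r.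
  apply: CI_VV_bound => // z /inb hz; apply: dball_bound.
  by apply: le_trans hz _; lra.
pose Lm : {linear V -> (K : normedModType K)} :=
  HB.pack L (@GRing.isLinear.Build K V (K : normedModType K) _ L Llin).
have Lc : continuous Lm.
  move=> a; apply/continuous_rnP => e e0.
  have C0 : 0 <= 8 * C1 / r by rewrite /C1 !mulr_ge0 // invr_ge0 ltW.
  exists (e / (8 * C1 / r + 1)) => [|b]; first by rewrite divr_gt0 //; lra.
  rewrite ltr_pdivlMr; last by lra.
  move=> hb; rewrite -linearB; apply: le_lt_trans (Lb _) _.
  have -> : 8 * (C1 * rn (b - a)) / r = (8 * C1 / r) * rn (b - a) by ring.
  by have := rn_ge0 (b - a); move: (8 * C1 / r) C0 hb => c *; nra.
have gE x : rn (x - x0) <= s -> 'd f x v = (tpi R)^-1 * CI r (fun z => f (x + z *: v) * (z^-1 * z^-1)).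
  move=> hx; have Hx : dball f x (2 * s) M by apply: dball_sub H _; lra.
  apply: (@diff_CI R V f x s M s0 _ _ v r r0 rv); first by move=> y /Hx[].
  by move=> y /Hx[].
have cf x : rn (x - x0) <= s -> ring_cont r (fun z => f (x + z *: v)).
  move=> hx; apply: ring_g => z zr; exists ('d f (x + z *: v) v); apply: line_hd.
  have [|//] := H (y := x + z *: v); rewrite addrAC; apply: le_trans (rnD _ _) _.
  by rewrite rnZ; have := ler_wpM2r (rn_ge0 v) zr; lra.
have [|dF dE] := @est_diff R V K (fun x => 'd f x v) x0 Lm Lc; last by split=> // h; rewrite dE.
move=> e e0; pose C := 8 * (16 * M / s ^+ 2) / r.
have C0 : 0 <= C by rewrite /C !mulr_ge0 // invr_ge0 ltW // exprn_gt0.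
exists (Num.min (s / 2) (e / (C + 1))) => [|h]; first by rewrite lt_min !divr_gt0 //; lra.
rewrite lt_min => /andP[h1 h2].
have hs : rn (x0 + h - x0) <= s by rewrite addrC addKr; lra.
have hs0 : rn (x0 - x0) <= s by rewrite subrr rn0 ltW.
rewrite gE // gE // [Lm h]/(L h) /L -!mulrBr.
have E : CI r (fun z => f (x0 + h + z *: v) * (z^-1 * z^-1)) -
   CI r (fun z => f (x0 + z *: v) * (z^-1 * z^-1)) -
   CI r (fun z => 'd f (x0 + z *: v) h * (z^-1 * z^-1)) =
   CI r (fun z => (f (x0 + z *: v + h) + (-1) * f (x0 + z *: v) + (-1) * 'd f (x0 + z *: v) h) * (z^-1 * z^-1)).
  rewrite (@eq_CI _ r r0 (fun z => (_ + _ + _) * _) (fun z => (f (x0 + h + z *: v) * (z^-1 * z^-1) +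
     (-1) * (f (x0 + z *: v) * (z^-1 * z^-1))) + (-1) * ('d f (x0 + z *: v) h * (z^-1 * z^-1)))); last first.
    by move=> z _; rewrite (addrAC x0 h) !mulrDl !mulrA.
  have c1 : ring_cont r (fun z => f (x0 + h + z *: v) * (z^-1 * z^-1)).
    by apply: ring_contM; [exact: cf|exact: ring_VV].
  have c2 : ring_cont r (fun z => f (x0 + z *: v) * (z^-1 * z^-1)).
    by apply: ring_contM; [exact: cf|exact: ring_VV].
  rewrite !(CID r0) //; last 3 first.
  - by move=> z hz; apply: cptZ; exact: c2.
  - by move=> z hz; apply: cptD; [exact: c1|apply: cptZ; exact: c2].
  - by move=> z hz; apply: cptZ; exact: cdV.
  by rewrite !(CIZ r0) // !mulN1r.
rewrite E; apply: le_trans (@CI_VV_bound _ _ r (16 * M / s ^+ 2 * rn h ^+ 2) r0 _ _) _.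
- move=> z hz; apply: cptD; last by apply: cptZ; exact: cd.
  apply: cptD; last by apply: cptZ; exact: cf.
  by have := cf _ hs z hz; congr cpt; apply/funext => w; rewrite addrAC.
- move=> z /inb hz; rewrite !mulN1r; apply: dball_taylor => //; last by rewrite ltW.
  by apply: le_trans hz _; lra.
- have -> : 8 * (16 * M / s ^+ 2 * rn h ^+ 2) / r = C * rn h * rn h by rewrite /C; ring.
  rewrite ler_wpM2r ?rn_ge0 //; rewrite ltr_pdivlMr in h2; last by lra.
  by have := rn_ge0 h; move: (C) C0 h2 => c *; nra.
Qed.

End Data.

Theorem diff_diff f x0 : (\forall y \near x0, differentiable f y) -> forall v,
  differentiable (fun x => 'd f x v) x0 /\
  forall h, 'd (fun x => 'd f x v) x0 h = 'd (fun x => 'd f x h) x0 v.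
Proof.
move=> /dball_near/(_ 10)[//|s [M [s0 H]]] v.
have H0 : dball f x0 (6 * s) M by apply: dball_sub H _; rewrite subrr rn0; lra.
have v1 : 0 < 1 + rn v by have := rn_ge0 v; lra.
have r0 : 0 < s / (1 + rn v) by exact: divr_gt0.
have rv : s / (1 + rn v) * rn v <= s.
  by rewrite mulrAC ler_pdivrMr // ler_pM2l // lerDr.
have [dv dE] := diff_diff_CI s0 H0 r0 rv.
split; first exact: dv.
move=> h; etransitivity; first exact: (dE h).
pose M' := 8 * M / s * rn h.
have B y : rn (y - x0) <= 2 * s -> differentiable (fun x => 'd f x h) y /\ rn ('d f y h) <= M'.
  move=> hy; split; last by apply: dball_bound H0 _ _ _ => //; lra.
  have Hy : dball f y (6 * s) M by apply: dball_sub H _; lra.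
  have h1 : 0 < 1 + rn h by have := rn_ge0 h; lra.
  have q0 : 0 < s / (1 + rn h) by exact: divr_gt0.
  have qh : s / (1 + rn h) * rn h <= s by rewrite mulrAC ler_pdivrMr // ler_pM2l // lerDr.
  by have [] := diff_diff_CI s0 Hy q0 qh.
apply/esym; apply: (@diff_CI R V (fun x => 'd f x h) x0 s M' s0 _ _ v _ r0 rv).
  by move=> y /B[].
by move=> y /B[].
Qed.

End SecondDerivative.

Section Identity.
Variable R : realType.
Local Notation K := (Cx R).

Lemma ler_geometric (a M : R) : (forall n : nat, a <= M / 2 ^+ n) -> a <= 0.
Proof.
move=> h; apply/ler_addgt0Pr => /= e e0; rewrite add0r.
have M0 : 0 <= `|M| / e by rewrite divr_ge0 // ltW.
pose n := Num.bound (`|M| / e).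
have hn : `|M| / e < n%:R := archi_boundP M0.
apply: le_trans (h n) _; apply: le_trans (ler_wpM2r _ (ler_norm M)) _.
  by rewrite invr_ge0 exprn_ge0.
rewrite ler_pdivrMr ?exprn_gt0 // mulrC -ler_pdivrMr //.
by apply: le_trans (ltW hn) _; rewrite -natrX ler_nat ltnW // ltn_expl.
Qed.

(* The functions g(z)/z^n are bounded by M/r^n on the circle, hence
   |g(w)| <= 16 M (|w|/r)^n for all n. *)
Lemma identity_disc (g : K -> K) (r M d : R) (w : K) : 0 < r -> 0 < d ->
  (forall z, rn z <= 2 * r -> exists a, hd g z a) ->
  (forall z, r <= rn z <= 2 * r -> rn (g z) <= M) ->
  (forall z, rn z < d -> g z = 0) -> rn w <= r / 2 -> g w = 0.
Proof.
move=> r0 d0 hg hM g0 hw.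
have [->|w0] := eqVneq w 0; first by apply: g0; rewrite rn0.
pose G n z := g z * (z^-1) ^+ n.
have hG n z : rn z <= 2 * r -> exists a, hd (G n) z a.
  move=> hz; have [->|z0] := eqVneq z 0.
    exists 0 => e e0; exists d => // h hh; rewrite /G !g0 ?add0r ?rn0 //.
    by rewrite !mul0r mulr0 !subrr rn0 mulr_ge0 ?rn_ge0 // ltW.
  elim: n => [|n [a ha]].
    by have [a ha] := hg z hz; exists a; rewrite (_ : G 0%N = g) //; apply/funext => y; rewrite /G expr0 mulr1.
  have [b hb] := @hd_inv R 0 z z0; eexists.
  rewrite (_ : G n.+1 = fun z => G n z * (z - 0)^-1); first exact: hdM ha hb.
  by apply/funext => y; rewrite /G exprSr mulrA subr0.
apply/eqP; rewrite -rn_eq0 eq_le rn_ge0 andbT.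
have wp : 0 < rn w by rewrite rn_gt0.
apply: (@ler_geometric _ (16 * M)) => n.
have B : rn (G n w) <= 16 * (M / r ^+ n).
  apply: (cauchy_max r0 (hG n)) => // z hz; rewrite /G rnM rnX rnV -exprVn.
  apply: ler_pM; rewrite ?rn_ge0 ?hM // ?exprn_ge0 ?invr_ge0 ?rn_ge0 //.
  apply: lerXn2r; rewrite ?nnegrE ?invr_ge0 ?rn_ge0 ?(ltW r0) //.
  by case/andP: hz => hz _; rewrite lef_pV2 ?posrE //; apply: lt_le_trans hz.
have -> : rn (g w) = rn (G n w) * rn w ^+ n.
  by rewrite /G rnM rnX rnV exprVn mulfVK // expf_neq0 // gt_eqF.
have M0 : 0 <= M.
  apply: le_trans (rn_ge0 (g (ofReal r))) _; apply: hM; rewrite rn_ofReal gtr0_norm //.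
  by move: r0; clear; lra.
apply: le_trans (ler_wpM2r (exprn_ge0 _ (ltW wp)) B) _.
have -> : 16 * (M / r ^+ n) * rn w ^+ n = 16 * M * (rn w / r) ^+ n.
  by rewrite expr_div_n; ring.
rewrite ler_wpM2l ?mulr_ge0 // -exprVn.
apply: lerXn2r; rewrite ?nnegrE ?invr_ge0 ?divr_ge0 ?(ltW r0) ?(ltW wp) //.
by rewrite ler_pdivrMr // mulrC.
Qed.

Variable V : normedModType K.

Lemma identity_ball (f : V -> K) x (s M : R) : 0 < s -> dball f x (2 * s) M ->
  (\forall y \near x, f y = 0) -> forall y, rn (y - x) <= s / 2 -> f y = 0.
Proof.
move=> s0 H /nbhs_rnP[d d0 hd] y hy.
have [->|h0] := eqVneq y x; first by apply: hd; rewrite subrr rn0.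
pose h := y - x; have hp : 0 < rn h by rewrite rn_gt0 subr_eq0.
pose v := (ofReal (rn h))^-1 *: h.
have on : ofReal (rn h) != 0 by rewrite ofReal_eq0 gt_eqF.
have hE : h = ofReal (rn h) *: v by rewrite /v scalerA divff // scale1r.
have v1 : rn v = 1 by rewrite /v rnZ rnV rn_ofReal ger0_norm ?rn_ge0 // mulVf ?gt_eqF.
have xv z : rn (x + z *: v - x) = rn z by rewrite addrC addKr rnZ v1 mulr1.
have -> : f y = (fun z => f (x + z *: v)) (ofReal (rn h)) by rewrite /= -hE subrKC.
apply: (@identity_disc (fun z => f (x + z *: v)) s M d) => //.
- move=> z hz; exists ('d f (x + z *: v) v); apply: line_hd.
  by have [|] := H (x + z *: v); rewrite // xv.
- by move=> z /andP[_ hz]; have [|] := H (x + z *: v); rewrite // xv.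
- by move=> z hz; apply: hd; rewrite xv.
- by rewrite rn_ofReal ger0_norm ?rn_ge0.
Qed.

End Identity.

(** * Lattices in C^n *)

Section MatrixNorm.
Variable R : realType.
Local Notation K := (Cx R).

Lemma rn_mx_lt m n (A : 'M[K]_(m, n)) (e : R) : 0 < e ->
  rn A < e <-> forall i j, rn (A i j) < e.
Proof.
move=> e0; have E : ball (0 : 'M[K]_(m, n)) (ofReal e) A <-> rn A < e.
  by rewrite -ball_normE /= sub0r normrN rnE ltr_ofReal.
rewrite -E; split=> [[_ h] i j|h].
  by have := h i j; rewrite mxE -ball_normE /= sub0r normrN rnE ltr_ofReal.
split; first by rewrite -ofReal0 ltr_ofReal.
by move=> i j; rewrite mxE -ball_normE /= sub0r normrN rnE ltr_ofReal.
Qed.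

Lemma rn_mx_le m n (A : 'M[K]_(m, n)) i j : rn (A i j) <= rn A.
Proof.
apply/ler_addgt0Pr => /= e e0; apply: ltW.
have p : 0 < rn A + e by have := rn_ge0 A; lra.
by have /(rn_mx_lt A p) : rn A < rn A + e by rewrite ltrDl.
Qed.

End MatrixNorm.

Section Lattice.
Variable R : realType.
Local Notation K := (Cx R).
Variable n : nat.
Implicit Types (P : 'M[K]_(n + n, n)) (v : 'rV[K]_n) (c : 'rV[R]_(n + n)).

Definition realify m (A : 'M[K]_(m, n)) : 'M[R]_(m, n + n) :=
  row_mx (map_mx (fun z : K => complex.Re z : R) A) (map_mx (fun z : K => complex.Im z : R) A).

Definition cmx m p (A : 'M[R]_(m, p)) : 'M[K]_(m, p) := map_mx (@ofReal R) A.

Lemma Re_ofReal (x : R) : complex.Re (ofReal x : R[i]) = x. Proof. by []. Qed.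
Lemma Im_ofReal (x : R) : complex.Im (ofReal x : R[i]) = 0. Proof. by []. Qed.

Lemma realify_inj m : injective (@realify m).
Proof.
move=> A B /eq_row_mx[h1 h2]; apply/matrixP => i j.
have /matrixP/(_ i j) := h1; have /matrixP/(_ i j) := h2; rewrite !mxE => e1 e2.
by rewrite [LHS]KE [RHS]KE e1 e2.
Qed.

Lemma realifyM m p (c : 'M[R]_(m, p)) (A : 'M[K]_(p, n)) :
  realify (cmx c *m A) = c *m realify A.
Proof.
rewrite /realify mul_mx_row; congr row_mx; apply/matrixP => i j; rewrite !mxE raddf_sum;
  apply: eq_bigr => k _; rewrite !mxE.
  by etransitivity; [exact: cReM|rewrite Re_ofReal Im_ofReal mul0r subr0].
by etransitivity; [exact: cImM|rewrite Re_ofReal Im_ofReal mul0r addr0].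
Qed.

Lemma lattice_unit P : is_lattice_basis P -> realify P \in unitmx.
Proof.
move=> hP; rewrite -row_free_unit -kermx_eq0; apply/eqP/row_matrixP => i; rewrite row0.
set k := row i _; have k0 : k *m realify P = 0 by apply/sub_kermxP; exact: row_sub.
have := hP (cmx k); rewrite -realifyM in k0.
have -> : cmx k *m P = 0.
  apply: realify_inj; rewrite k0; apply/matrixP => a b; rewrite !mxE.
  by case: fintype.split => ?; rewrite !mxE.
move=> h; have /matrixP e : cmx k = 0.
  by apply: h => // a; rewrite mxE; apply/complex_realP; exists (k 0 a).
by apply/matrixP => a b; apply: (@ofReal_inj R); have := e a b; rewrite !mxE ofReal0.
Qed.

Definition lcoord P v : 'rV[R]_(n + n) := realify v *m invmx (realify P).

Lemma lcoordK P v : is_lattice_basis P -> cmx (lcoord P v) *m P = v.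
Proof.
move=> /lattice_unit u; apply: realify_inj; rewrite realifyM /lcoord mulmxKV //.
Qed.

Lemma lcoordE P c : is_lattice_basis P -> lcoord P (cmx c *m P) = c.
Proof. by move=> /lattice_unit u; rewrite /lcoord realifyM mulmxK. Qed.

Lemma lcoord_bound P : exists2 C : R, 0 < C & forall v a, `|lcoord P v 0 a| <= C * rn v.
Proof.
pose B := invmx (realify P).
exists (\sum_(a < n + n) \sum_(b < n + n) `|B b a| + 1).
  by rewrite ltr_wpDl // sumr_ge0 // => a _; apply: sumr_ge0.
move=> v a; rewrite /lcoord mxE.
apply: (@le_trans _ _ (\sum_b rn v * `|B b a|)).
  apply: le_trans (ler_norm_sum _ _ _) _; apply: ler_sum => b _; rewrite normrM.
  apply: ler_wpM2r => //; rewrite /realify mxE; case: fintype.split => j; rewrite mxE.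
    by apply: le_trans (rn_Re _) _; exact: rn_mx_le.
  by apply: le_trans (rn_Im _) _; exact: rn_mx_le.
rewrite -mulr_sumr mulrC ler_wpM2r ?rn_ge0 //.
rewrite [X in _ <= X + 1](bigD1 a) //= -addrA lerDl addr_ge0 //.
by apply: sumr_ge0 => b _; apply: sumr_ge0.
Qed.

Lemma intmx_cmx m (N : 'M[int]_(m, n + n)) :
  intmx R N = cmx (map_mx intr N : 'M[R]_(m, n + n)).
Proof. by apply/matrixP => i j; rewrite !mxE ofReal_int. Qed.

Lemma lattice_discrete P : is_lattice_basis P ->
  exists2 e : R, 0 < e & forall N : 'rV[int]_(n + n), rn (intmx R N *m P) < e -> N = 0.
Proof.
move=> hP; have [C C0 hC] := lcoord_bound P; exists C^-1 => [|N hN]; first by rewrite invr_gt0.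
apply/matrixP => i a; rewrite ord1 mxE.
have := hC (intmx R N *m P) a; rewrite intmx_cmx lcoordE // -intmx_cmx !mxE => h.
have : `|(N 0 a)%:~R : R| < 1.
  by apply: le_lt_trans h _; rewrite mulrC -ltr_pdivlMr // mul1r.
rewrite -intr_norm (ltr_int _ _ 1) => h1; apply/eqP; rewrite -normr_eq0.
by move: h1; case: (`|N 0 a|) (normr_ge0 (N 0 a)) => // -[].
Qed.

Definition fund_cell P : set 'rV[K]_n :=
  [set cmx c *m P | c in [set c : 'rV[R]_(n + n) | forall a, (`[0, 1]%classic : set R) (c ord0 a)]].

Lemma fund_cellP P v : is_lattice_basis P ->
  exists q (N : 'rV[int]_(n + n)), fund_cell P q /\ v = q + intmx R N *m P.
Proof.
move=> hP; have [c cE] : exists c, cmx c *m P = v by exists (lcoord P v); exact: lcoordK.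
pose N := \row_a Num.floor (c 0 a) : 'rV[int]_(n + n).
exists (cmx (c - map_mx intr N) *m P), N; split; last first.
  rewrite intmx_cmx -mulmxDl; have -> : cmx (c - map_mx intr N) + cmx (map_mx intr N) = cmx c.
    by apply/matrixP => i j; rewrite !mxE -ofRealD subrK.
  by rewrite cE.
exists (c - map_mx intr N) => // a /=; rewrite in_itv /= !mxE.
have /andP[h1 h2] := floor_itv (c 0 a).
rewrite intrD in h2; apply/andP; split; first by rewrite subr_ge0.
by rewrite lerBlDl; apply/ltW.
Qed.

Lemma cmx_continuous P : continuous (fun c : 'rV[R]_(n + n) => cmx c *m P).
Proof.
move=> c A /nbhs_rnP[e e0 he].
pose C := \sum_(j < n) \sum_(a < n + n) rn (P a j) + 1.
have C0 : 0 < C by rewrite ltr_wpDl // sumr_ge0 // => a _; apply: sumr_ge0 => b _; exact: rn_ge0.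
apply/nbhs_ballP; exists (e / C) => /=; first exact: divr_gt0.
move=> b [_ hb]; apply: he; apply/rn_mx_lt => // i j; rewrite -mulmxBl mxE.
apply: le_lt_trans (rn_sum _ _ _) _.
have p : 0 < e / C by exact: divr_gt0.
apply: (@le_lt_trans _ _ (e / C * \sum_(a < n + n) rn (P a j))).
  rewrite mulr_sumr; apply: ler_sum => a _; rewrite rnM ler_wpM2r ?rn_ge0 //.
  have := hb 0 a; rewrite !mxE !ord1 -ofRealB rn_ofReal /ball /= distrC.
  exact: ltW.
rewrite mulrAC ltr_pdivrMr // ltr_pM2l // /C (bigD1 j) //= -addrA ltrDl ltr_wpDl //.
by apply: sumr_ge0 => a _; apply: sumr_ge0 => b' _; exact: rn_ge0.
Qed.

Lemma fund_cell_compact P : compact (fund_cell P).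
Proof.
apply: continuous_compact; last first.
  by apply: (@rV_compact R _ (fun _ => `[0, 1]%classic)) => _; exact: segment_compact.
by apply: continuous_subspaceT; exact: cmx_continuous.
Qed.

Lemma periodic_bounded P (f : 'rV[K]_n -> K) : is_lattice_basis P -> continuous f ->
  (forall v (N : 'rV[int]_(n + n)), f (v + intmx R N *m P) = f v) ->
  exists M : R, forall v, rn (f v) <= M.
Proof.
move=> hP cf pf.
have cr : continuous (fun v => rn (f v) : R).
  move=> v A /nbhs_normP[e /= e0 he]; have /continuous_rnP/(_ e e0)[d d0 hd] := cf v.
  apply/(@nbhs_rnP _ _ v ((fun v => rn (f v) : R) @^-1` A)); exists d => // w /hd hw.
  apply: he => /=; apply: le_lt_trans hw; rewrite ler_norml.
  have h1 := rn_rev (f w) (f v); have h2 := rn_rev (f v) (f w); rewrite rn_distC in h2.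
  by apply/andP; split; lra.
have [M [_ hM]] := compact_bounded (continuous_compact (continuous_subspaceT cr) (@fund_cell_compact P)).
exists (M + 1) => v; have [q [N [hq ->]]] := fund_cellP v hP; rewrite pf.
apply: le_trans (ler_norm _) _; apply: (hM (M + 1)); first by rewrite ltrDl.
by exists q.
Qed.

End Lattice.

Lemma connected_ind (T : topologicalType) (A Q : set T) : connected A ->
  (exists2 x, A x & Q x) ->
  (forall x, A x -> Q x -> \forall y \near x, A y -> Q y) ->
  (forall x, A x -> ~ Q x -> \forall y \near x, A y -> ~ Q y) ->
  forall x, A x -> Q x.
Proof.
move=> cA [x0 Ax0 Qx0] hQ hN x Ax.
suff E : A `&` Q = A by have [] : (A `&` Q) x by rewrite E.
apply: cA; first by exists x0.
  exists (interior [set y | A y -> Q y]); first exact: open_interior.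
  rewrite eqEsubset; split=> y [Ay hy]; split => //; first exact: hQ.
  by have := interior_subset hy; exact.
exists (~` interior [set y | A y -> ~ Q y]); first exact/open_closedC/open_interior.
rewrite eqEsubset; split=> y [Ay hy]; split => //.
  by move=> /interior_subset/(_ Ay).
by apply: contrapT => nQ; apply: hy; exact: hN.
Qed.

Section Calculus.
Variable R : realType.
Local Notation K := (Cx R).

Lemma jacE m n (f : 'rV[K]_m -> 'rV[K]_n) x v : v *m jacobian f x = 'd f x v.
Proof. by rewrite /jacobian mul_rV_lin1. Qed.

Lemma mulmx_lip m n p (B : 'M[K]_(n, p)) : exists2 C : R, 0 < C &
  forall A : 'M[K]_(m, n), rn (A *m B) <= C * rn A.
Proof.
pose C := \sum_(j < p) \sum_(a < n) rn (B a j) + 1.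
have S0 : 0 <= \sum_(j < p) \sum_(a < n) rn (B a j).
  by apply: sumr_ge0 => a _; apply: sumr_ge0 => b _; exact: rn_ge0.
have C0 : 0 < C by rewrite ltr_wpDl.
exists C => // A; apply/ler_addgt0Pr => /= e e0; apply: ltW.
apply/rn_mx_lt => [|i j]; first by rewrite ltr_wpDl // mulr_ge0 ?rn_ge0 // ltW.
rewrite mxE; apply: le_lt_trans (rn_sum _ _ _) _.
apply: (@le_lt_trans _ _ (C * rn A)); last by rewrite ltrDl.
apply: (@le_trans _ _ (\sum_(a < n) rn (B a j) * rn A)).
  by apply: ler_sum => a _; rewrite rnM mulrC ler_wpM2l ?rn_ge0 // rn_mx_le.
rewrite -mulr_suml ler_wpM2r ?rn_ge0 // /C (bigD1 j) //= -addrA lerDl addr_ge0 //.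
by apply: sumr_ge0 => a _; apply: sumr_ge0 => b _; exact: rn_ge0.
Qed.

Lemma mulmx_continuous m n p (B : 'M[K]_(n, p)) :
  continuous (fun A : 'M[K]_(m, n) => A *m B).
Proof.
have [C C0 hC] := @mulmx_lip m n p B.
move=> A; apply/continuous_rnP => e e0; exists (e / C) => [|A' h]; first exact: divr_gt0.
by rewrite -mulmxBl; apply: le_lt_trans (hC _) _; rewrite mulrC -ltr_pdivlMr.
Qed.

(* The inverse branch of a differentiable immersion is differentiable as soon
   as it is continuous. *)
Lemma diff_branch (V W : normedModType K) n (f : V -> 'rV[K]_n) (psi : 'rV[K]_n -> W)
    (chi : V -> W) (T : W -> 'rV[K]_n) (C : R) a :
  linear T -> (forall w, rn (T w) <= C * rn w) ->
  {for a, continuous f} -> differentiable psi (f a) -> differentiable chi a ->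
  (\forall v \near a, psi (f v) = chi v) ->
  (forall k, T ('d psi (f a) k) = k) -> differentiable f a.
Proof.
move=> Tlin TC cf dpsi dchi E Tinv.
pose Tm : {linear W -> 'rV[K]_n} := HB.pack T (@GRing.isLinear.Build K W _ _ T Tlin).
have TE w : T w = Tm w by [].
have C1 : 0 < `|C| + 1 by rewrite ltr_wpDl.
have TC' w : rn (T w) <= (`|C| + 1) * rn w.
  apply: le_trans (TC w) _; rewrite ler_wpM2r ?rn_ge0 //.
  by apply: le_trans (ler_norm C) _; rewrite lerDl.
have Tc : continuous Tm.
  move=> w; apply/continuous_rnP => e e0; exists (e / (`|C| + 1)) => [|w' h]; first exact: divr_gt0.
  by rewrite -linearB; apply: le_lt_trans (TC' _) _; rewrite mulrC -ltr_pdivlMr.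
pose L := Tm \o 'd chi a.
have Lc : continuous L.
  by move=> x; apply: continuous_comp; [exact: diff_continuous|exact: Tc].
have [LB LB0 hLB] : exists2 B : R, 0 < B & forall h, rn (L h) <= B * rn h.
  have [_ /gt0_ofReal[k k0 ->] hk] := linear_lipschitz (diff_continuous dchi).
  exists ((`|C| + 1) * k) => [|h]; first exact: mulr_gt0.
  apply: le_trans (TC' _) _; rewrite -mulrA ler_wpM2l ?(ltW C1) //.
  by have := hk h; rewrite !rnE -ofRealM ler_ofReal.
have [||D _] := @est_diff R V 'rV[K]_n f a (Tm \o 'd chi a) => //.
move=> e e0; pose A := LB + 2; pose B := (`|C| + 1) * (2 * A + 1).
have A0 : 0 < A by rewrite ltr_wpDl // ltW.
have B0 : 0 < B by rewrite mulr_gt0 // ltr_wpDl // mulr_ge0 // ltW.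
pose e1 := Num.min (e / B) ((`|C| + 1)^-1 / 2).
have e10 : 0 < e1 by rewrite lt_min !divr_gt0 ?invr_gt0.
have e1a : e1 * B <= e by rewrite -ler_pdivlMr // ge_min lexx.
have e1b : (`|C| + 1) * e1 <= 2^-1.
  by rewrite mulrC -ler_pdivlMr // mulrC ge_min lexx orbT.
have [d1 d10 h1] := diff_est dpsi e10; have [d2 d20 h2] := diff_est dchi e10.
have /continuous_rnP/(_ _ d10)[d3 d30 h3] := cf.
have /nbhs_rnP[d4 d40 h4] := E.
exists (Num.min (Num.min d2 d3) d4) => [|h]; first by rewrite !lt_min d20 d30.
rewrite !lt_min => /andP[/andP[hh2 hh3] hh4].
pose k := f (a + h) - f a.
have hk : rn k < d1 by apply: h3; rewrite addrC addKr.
have E1 := h1 k hk; have E2 := h2 h hh2.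
rewrite /k subrKC h4 in E1; last by rewrite addrC addKr.
have Ea : psi (f a) = chi a by apply: h4; rewrite subrr rn0.
rewrite Ea -/k in E1.
have kE : k - L h = T ((chi (a + h) - chi a - 'd chi a h) - (chi (a + h) - chi a - 'd psi (f a) k)).
  by rewrite opprB [X in T X]addrC addrA subrK TE linearB -!TE Tinv.
have kb : rn (k - L h) <= (`|C| + 1) * (e1 * rn h + e1 * rn k).
  by rewrite kE; apply: le_trans (TC' _) _; rewrite ler_wpM2l ?(ltW C1) //;
    apply: le_trans (rnB _ _) _; exact: lerD.
have kb2 : rn k <= 2 * A * rn h.
  have h5 : rn k <= rn (k - L h) + rn (L h) by rewrite -{1}(subrK (L h) k) rnD.
  have h6 := hLB h; have h0 := rn_ge0 h; have k0 := rn_ge0 k.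
  have h7 : rn k <= 2^-1 * (rn h + rn k) + LB * rn h.
    apply: le_trans h5 _; apply: lerD => //; apply: le_trans kb _.
    by rewrite -mulrDr mulrA ler_wpM2r // addr_ge0.
  rewrite /A; move: h7 h0 k0; clear; move: (rn k) (rn h) => x y.
  by move=> h7 h0 k0; lra.
apply: le_trans kb _.
have h0 := rn_ge0 h.
apply: (@le_trans _ _ (e1 * B * rn h)); last by rewrite ler_wpM2r.
rewrite /B -mulrDr mulrCA -!mulrA ler_wpM2l ?(ltW e10) // ler_wpM2l ?(ltW C1) //.
by rewrite mulrDl mul1r addrC lerD2r.
Qed.

Lemma diff0_const (V : normedModType K) (f : V -> K) x (s M : R) : 0 < s ->
  dball f x (6 * s) M -> (forall y, rn (y - x) <= 6 * s -> forall h, 'd f y h = 0) ->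
  forall y, rn (y - x) <= s -> f y = f x.
Proof.
move=> s0 H H0 y hy; apply/eqP; rewrite -subr_eq0 -rn_eq0 eq_le rn_ge0 andbT.
pose D := 16 * M / s ^+ 2 * s ^+ 2.
apply: (@ler_geometric R _ D) => n.
pose N := (2 ^ n.+1)%N; have N0 : (0 < N)%N by rewrite expn_gt0.
have NR : 0 < N%:R :> R by rewrite ltr0n.
pose h := (ofReal N%:R^-1) *: (y - x).
have hh : rn h <= s / N%:R.
  by rewrite rnZ rn_ofReal gtr0_norm ?invr_gt0 // mulrC ler_pdivrMr // divfK ?gt_eqF.
have N2 : 2 <= N%:R :> R by rewrite ler_nat /N expnS leq_pmulr // expn_gt0.
have hs : rn h <= s / 2.
  by apply: le_trans hh _; rewrite ler_wpM2l ?(ltW s0) // lef_pV2 ?posrE.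
have hj j : (j <= N)%N -> rn (x + h *+ j - x) <= s.
  move=> jN; rewrite addrC addKr -scaler_nat rnZ.
  have -> : rn (j%:R : K) = j%:R by rewrite -ofReal_nat rn_ofReal ger0_norm.
  apply: le_trans (ler_wpM2l (ler0n _ _) hh) _; rewrite mulrA ler_pdivrMr // mulrC.
  by rewrite ler_wpM2l ?(ltW s0) // ler_nat.
have M0 := dball_M0 s0 H.
have step j : (j <= N)%N -> rn (f (x + h *+ j) - f x) <= j%:R * (16 * M / s ^+ 2 * (s / N%:R) ^+ 2).
  elim: j => [|j IH] jN; first by rewrite mulr0n addr0 subrr rn0 mul0r.
  apply: le_trans (rn_tri _ (f (x + h *+ j)) _) _.
  rewrite -natr1 mulrDl mul1r [X in _ <= X]addrC; apply: lerD; last by apply: IH; exact: ltnW.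
  have hx := hj j (ltnW jN).
  have hx4 : rn (x + h *+ j - x) <= 4 * s by apply: le_trans hx _; lra.
  have hx6 : rn (x + h *+ j - x) <= 6 * s by apply: le_trans hx _; lra.
  have := dball_taylor s0 H hx4 hs.
  rewrite (H0 _ hx6) subr0 -addrA -mulrSr => /le_trans; apply.
  rewrite ler_wpM2l ?mulr_ge0 // ?invr_ge0 ?exprn_ge0 ?(ltW s0) //.
  by apply: lerXn2r; rewrite ?nnegrE ?rn_ge0 ?divr_ge0 ?(ltW s0) ?(ltW NR).
have := step N (leqnn _).
have -> : x + h *+ N = y.
  rewrite /h -scaler_nat scalerA -ofReal_nat -ofRealM mulfV ?gt_eqF // ofReal1 scale1r.
  by rewrite subrKC.
move=> /le_trans; apply; rewrite /D.
have -> : N%:R * (16 * M / s ^+ 2 * (s / N%:R) ^+ 2) = 16 * M / s ^+ 2 * s ^+ 2 / N%:R.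
  by field; rewrite !gt_eqF.
rewrite ler_wpM2l ?mulr_ge0 ?invr_ge0 ?exprn_ge0 ?(ltW s0) //.
rewrite lef_pV2 ?posrE ?exprn_gt0 // /N natrX exprS ler_peMl ?exprn_ge0 // ler1n //.
Qed.

End Calculus.

(** * Lifting maps to the universal cover of a torus *)

Section NearConst.
Variable R : realType.
Local Notation K := (Cx R).

Lemma near_diff0_const (V : normedModType K) (f : V -> K) x :
  (\forall y \near x, differentiable f y) ->
  (\forall y \near x, forall h, 'd f y h = 0) -> \forall y \near x, f y = f x.
Proof.
move=> df /nbhs_rnP[d d0 hd].
have [s [M [s0 H]]] := dball_near df (ltr0Sn _ 5 : 0 < 6 :> R).
pose t := Num.min s (d / 12); have t0 : 0 < t by rewrite lt_min s0 divr_gt0.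
have ts : t <= s by rewrite ge_min lexx.
have td : 12 * t <= d by rewrite mulrC -ler_pdivlMr // ge_min lexx orbT.
apply/nbhs_rnP; exists t => // y /ltW; apply: (diff0_const t0 (M := M)).
  by apply: dball_sub H _; rewrite subrr rn0; lra.
by move=> z hz; apply: hd; apply: le_lt_trans hz _; lra.
Qed.

End NearConst.

Section Uniformization.
Variables (R : realType) (r : nat).
Variables (M : complexManifold R r) (X : complexManifold R (r + r)).
Variable proj : X -> M.
Local Notation K := (Cx R).

Lemma unif_cont u p P : uniformizes proj u p P -> continuous p.
Proof. by move=> [_ h _ _ _] v; have [] := h v I. Qed.

Lemma unif_diff u p P v d : uniformizes proj u p P -> atlas X d -> chart_dom d (p v) ->
  differentiable (chart_map d \o p) v.
Proof.
move=> [_ h _ _ _] ad dv; have [_ hd] := h v I.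
exact: (hd (Chart setT id id) d erefl ad I dv).
Qed.

Lemma unif_shift u p P v (N : 'rV[int]_(r + r)) : uniformizes proj u p P ->
  p (v + intmx R N *m P) = p v.
Proof. by move=> [_ _ _ h _]; apply/h; exists N; rewrite addrC addKr. Qed.

Lemma unif_nbhs u p P v0 (e : R) : uniformizes proj u p P -> 0 < e ->
  exists O, nbhs (p v0) O /\ forall v, O (p v) ->
    exists N : 'rV[int]_(r + r), rn (v - v0 - intmx R N *m P) < e.
Proof.
move=> U e0; have [hP _ _ hpp _] := U; have pc := unif_cont U.
pose B := [set q : 'rV[K]_r | forall N : 'rV[int]_(r + r), e <= rn (q - v0 - intmx R N *m P)].
have cB : closed B.
  rewrite -openC openE => q /= /existsNP[N /negP]; rewrite -ltNge => hN.
  apply/nbhs_rnP; exists (e - rn (q - v0 - intmx R N *m P)); first by rewrite subr_gt0.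
  move=> q' hq' /(_ N); apply/negP; rewrite -ltNge.
  have -> : q' - v0 - intmx R N *m P = (q' - q) + (q - v0 - intmx R N *m P).
    by rewrite !addrA subrK.
  by apply: le_lt_trans (rnD _ _) _; rewrite -ltrBrDr.
have cK : compact (fund_cell P `&` B) by apply: compact_closedI => //; exact: fund_cell_compact.
have cl : closed (p @` (fund_cell P `&` B)).
  apply: compact_closed; first exact: space_hausdorff.
  by apply: continuous_compact cK; exact: continuous_subspaceT.
exists (~` (p @` (fund_cell P `&` B))); split.
  apply: open_nbhs_nbhs; split; first exact: closed_openC.
  move=> [q [_ Bq] /hpp[N qN]]; have := Bq N.
  by rewrite qN subrr rn0 leNgt e0.
move=> v hv; have [q [N [fq vE]]] := fund_cellP v hP.
have : ~ B q.
  by move=> Bq; apply: hv; exists q => //; rewrite vE (unif_shift _ _ U).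
move=> /existsNP[N' /negP]; rewrite -ltNge => hN'.
exists (N + N'); rewrite vE; apply: le_lt_trans hN'.
have -> : intmx R (N + N') = intmx R N + intmx R N'.
  by apply/matrixP => i j; rewrite !mxE intrD.
rewrite mulmxDl opprD addrA (addrAC q) -(addrA (q - v0)) subrr addr0 //.
Qed.

Lemma unif_discrete u p P : uniformizes proj u p P -> exists2 e : R, 0 < e &
  forall v w, p v = p w -> rn (v - w) < e -> v = w.
Proof.
move=> [hP _ _ h _]; have [e e0 he] := lattice_discrete hP; exists e => // v w /h[N vw].
rewrite vw => /he N0; apply/eqP; rewrite -subr_eq0 vw N0.
by rewrite (_ : intmx R 0 = 0) ?mul0mx //; apply/matrixP => i j; rewrite !mxE.
Qed.

Section Lift.
Variables (u : M) (p : 'rV[K]_r -> X) (P : 'M[K]_(r + r, r)).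
Hypothesis U : uniformizes proj u p P.
Variable V : normedModType K.

Lemma lift_uniq (f1 f2 : V -> 'rV[K]_r) a : {for a, continuous f1} -> {for a, continuous f2} ->
  (\forall x \near a, p (f1 x) = p (f2 x)) ->
  \forall x \near a, f1 x = f2 x + (f1 a - f2 a).
Proof.
move=> /continuous_rnP c1 /continuous_rnP c2 /nbhs_rnP[d d0 hd].
have [hP _ _ hpp _] := U; have [e e0 he] := lattice_discrete hP.
have e2 : 0 < e / 2 by exact: divr_gt0.
have [d1 d10 h1] := c1 _ e2; have [d2 d20 h2] := c2 _ e2.
apply/nbhs_rnP; exists (Num.min d (Num.min d1 d2)) => [|x]; first by rewrite !lt_min d0 d10.
rewrite !lt_min => /and3P[xd /h1 x1 /h2 x2].
have /hpp[N hN] := hd x xd; have /hpp[N0 hN0] : p (f1 a) = p (f2 a) by apply: hd; rewrite subrr rn0.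
have E : intmx R (N - N0) *m P = (f1 x - f1 a) - (f2 x - f2 a).
  have -> : intmx R (N - N0) = intmx R N - intmx R N0.
    by apply/matrixP => i j; rewrite !mxE intrD intrN.
  by rewrite mulmxBl -hN -hN0 !opprB addrACA [RHS]addrACA (addrC (- _)).
have /he N00 : rn (intmx R (N - N0) *m P) < e.
  by rewrite E (splitr e); apply: le_lt_trans (rnB _ _) _; rewrite ltrD.
have : N = N0 by apply/eqP; rewrite -subr_eq0 N00.
by move=> NN; rewrite hN0 -NN -hN subrKC.
Qed.

Variables (chi : V -> X) (a0 : V) (v0 : 'rV[K]_r).
Hypotheses (chi0 : p v0 = chi a0) (chi_c : \forall x \near a0, {for x, continuous chi})
  (chi_r : \forall x \near a0, proj (chi x) = u).

Lemma local_lift : exists f : V -> 'rV[K]_r, f a0 = v0 /\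
  \forall x \near a0, p (f x) = chi x /\ {for x, continuous f}.
Proof.
have [e e0 he] := unif_discrete U; have [_ _ hr _ _] := U.
have e4 : 0 < e / 4 by exact: divr_gt0.
pose f x := xget v0 [set v | rn (v - v0) < e / 4 /\ p v = chi x].
have [B [B1 B2]] := unif_nbhs v0 U e4.
have C0 := nbhs_singleton chi_c.
have CO : \forall x \near a0, B (chi x) by apply: C0; rewrite -chi0.
have fP : \forall x \near a0, rn (f x - v0) < e / 4 /\ p (f x) = chi x.
  near=> x; rewrite /f; case: xgetP => [v _ //|] H; exfalso.
  have : (range p) (chi x) by rewrite hr; near: x.
  move=> [w _ wx]; have : B (p w) by rewrite wx; near: x.
  move=> /B2[N hN]; apply: (H (w - intmx R N *m P)); split; first by rewrite addrAC.
  by rewrite -wx -(unif_shift (w - intmx R N *m P) N U) subrK.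
have f0 : f a0 = v0.
  have [h1 h2] := nbhs_singleton fP; apply: he; first by rewrite h2 chi0.
  by apply: lt_trans h1 _; rewrite ltr_pdivrMr // ltr_pMr // ltr1n.
exists f; split => //.
have fP' := nbhs_interior fP; have cc := nbhs_interior chi_c.
near=> x.
have [h1 h2] : rn (f x - v0) < e / 4 /\ p (f x) = chi x.
  by apply: (@interior_subset _ [set x | rn (f x - v0) < e / 4 /\ p (f x) = chi x]); near: x.
split => //; apply/continuous_rnP => e' e'0.
pose e1 := Num.min e' (e / 4); have e10 : 0 < e1 by rewrite lt_min e'0.
have [B' [B1' B2']] := unif_nbhs (f x) U e10.
have CX : {for x, continuous chi} by near: x.
have N1 : \forall y \near x, B' (chi y) by apply: CX; rewrite -h2.
have N2 : \forall y \near x, rn (f y - v0) < e / 4 /\ p (f y) = chi y by near: x; exact: fP'.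
have /nbhs_rnP[d d0 hd] : \forall y \near x, B' (chi y) /\ (rn (f y - v0) < e / 4 /\ p (f y) = chi y).
  by apply: filterI.
exists d => // y /hd[/= Oy [g1 g2]].
have : B' (p (f y)) by rewrite g2.
move=> /B2'[N hN].
have e1e : e1 <= e / 4 by rewrite ge_min lexx orbT.
have e1e' : e1 <= e' by rewrite ge_min lexx.
have fE : f y - intmx R N *m P = f y.
  apply: he; first by rewrite -(unif_shift (f y - intmx R N *m P) N U) subrK.
  rewrite addrC addKr rnN.
  have -> : intmx R N *m P = ((f y - v0) - (f x - v0)) - (f y - f x - intmx R N *m P).
    by rewrite (opprB (f x)) addrA subrK opprB subrKC.
  apply: le_lt_trans (rnB _ _) _; apply: le_lt_trans (lerD (rnB _ _) (lexx _)) _.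
  lra.
by move: hN; rewrite addrAC fE => /lt_le_trans; apply.
Unshelve. all: by end_near. Qed.

Lemma lift_diff (f : V -> 'rV[K]_r) x : {for x, continuous f} ->
  (\forall y \near x, p (f y) = chi y) ->
  (forall d, atlas X d -> chart_dom d (chi x) -> differentiable (chart_map d \o chi) x) ->
  differentiable f x.
Proof.
move=> cf E dchi; have px : p (f x) = chi x := nbhs_singleton E.
have [d ad dx] := atlas_cover (p (f x)).
have [_ _ _ _ /(_ (f x) d ad dx) rf] := U.
have [B hB] := row_freeP rf.
have [C C0 hC] := @mulmx_lip R 1 _ _ B.
apply: (@diff_branch R V _ r f (chart_map d \o p) (chart_map d \o chi) (fun w => w *m B) C x) => //.
- by move=> k a b; rewrite mulmxDl scalemxAl.
- exact: unif_diff U ad dx.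
- by apply: dchi => //; rewrite -px.
- by near=> y; rewrite /= (near E y).
- by move=> k; rewrite -jacE -mulmxA hB mulmx1.
Unshelve. all: by end_near. Qed.

End Lift.
End Uniformization.

(** * A calculus of holomorphic functions *)

Section NearLemmas.
Variable R : realType.
Local Notation K := (Cx R).

Lemma diff_near_shift (V W : normedModType K) (f g : V -> W) x c : differentiable g x ->
  (\forall y \near x, f y = g y + c) ->
  differentiable f x /\ 'd f x = 'd g x :> (V -> W).
Proof.
move=> dg /nbhs_rnP[d d0 hd]; apply: est_diff; first exact: diff_continuous.
move=> e e0; have [d' d'0 hd'] := diff_est dg e0.
exists (Num.min d d') => [|h]; first by rewrite lt_min d0.
rewrite lt_min => /andP[h1 /hd' h2]; rewrite !hd ?subrr ?rn0 //; last by rewrite addrC addKr.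
by rewrite opprD addrACA subrr addr0.
Qed.

Lemma clopen_all (V : normedModType K) (Q : V -> Prop) : Q 0 ->
  (forall x, Q x -> \forall y \near x, Q y) ->
  (forall x, ~ Q x -> \forall y \near x, ~ Q y) -> forall x, Q x.
Proof.
move=> Q0 h1 h2 x; pose l (t : R) : V := ofReal t *: x.
have lc : continuous l.
  move=> t A /nbhs_rnP[e e0 he]; have p : 0 < 1 + rn x by have := rn_ge0 x; lra.
  apply/nbhs_normP; exists (e / (1 + rn x)) => /=; first exact: divr_gt0.
  move=> s /=; rewrite ltr_pdivlMr // => hs; apply: he.
  rewrite /l -scalerBl -ofRealB rnZ rn_ofReal distrC; apply: le_lt_trans hs.
  by rewrite ler_wpM2l // lerDr.
have : [set t | Q (l t)] 1.
  apply: (@connected_ind _ `[(0 : R), 1]%classic [set t | Q (l t)]).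
  - exact: segment_connected.
  - by exists 0; rewrite /= ?in_itv /= ?lexx ?ler01 // /l scale0r.
  - by move=> t _ /h1/(lc t) h; near=> s => _; near: s; exact: h.
  - by move=> t _ /h2/(lc t) h; near=> s => _; near: s; exact: h.
  - by rewrite /= in_itv /= ler01 lexx.
by rewrite /= /l scale1r.
Unshelve. all: by end_near. Qed.

Lemma near_neq (S T : topologicalType) (f g : S -> T) x : hausdorff_space T ->
  {for x, continuous f} -> {for x, continuous g} -> f x <> g x ->
  \forall y \near x, f y <> g y.
Proof.
rewrite open_hausdorff => H cf cg /eqP fg; have [[A B] /= [Ax Bx] [oA oB AB]] := H _ _ fg.
have nA : \forall y \near x, A (f y) by apply: cf; apply: open_nbhs_nbhs; split=> //; exact/set_mem.
have nB : \forall y \near x, B (g y) by apply: cg; apply: open_nbhs_nbhs; split=> //; exact/set_mem.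
near=> y => fgy; move/eqP: AB; rewrite -subset0; apply; split; last first.
  by have : B (g y); [near: y|rewrite -fgy; exact].
by near: y.
Unshelve. all: by end_near. Qed.

Lemma diff_coord (V : normedModType K) m n (f : V -> 'M[K]_(m, n)) i j x :
  differentiable f x -> differentiable (fun y => f y i j) x /\
  forall h, 'd (fun y => f y i j) x h = ('d f x h) i j.
Proof.
move=> df; have dc := @differentiable_coord K m n (f x) i j.
split; first exact: (@differentiable_comp _ _ _ _ f (fun A : 'M[K]_(m, n) => A i j)).
have Llin : linear ((fun h => ('d f x h) i j) : V -> K^o).
  by move=> k a b; rewrite linearP !mxE.
pose Lm : {linear V -> (K : normedModType K)} :=
  HB.pack (fun h => ('d f x h) i j) (@GRing.isLinear.Build K V (K : normedModType K) _ _ Llin).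
have Lc : continuous Lm.
  move=> h; apply/continuous_rnP => e e0.
  have dfc : continuous ('d f x) := diff_continuous df.
  have /continuous_rnP/(_ e e0)[d d0 hd] := dfc h.
  exists d => // y /hd; apply: le_lt_trans.
  by have := rn_mx_le ('d f x y - 'd f x h) i j; rewrite !mxE.
have [|_ E] := @est_diff R V K (fun y => f y i j) x Lm Lc; last by move=> h; rewrite E.
move=> e e0; have [d d0 hd] := diff_est df e0; exists d => // h /hd; apply: le_trans.
by have := rn_mx_le (f (x + h) - f x - 'd f x h) i j; rewrite !mxE.
Qed.

Lemma diff_mx (V : normedModType K) m n (f : V -> 'M[K]_(m, n)) x :
  (forall i j, differentiable (fun y => f y i j) x) -> differentiable f x.
Proof.
move=> df; have -> : f = \sum_(i < m) \sum_(j < n) (fun y => f y i j *: delta_mx i j).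
  apply/funext => y; rewrite [LHS]matrix_sum_delta fct_sumE; apply: eq_bigr => i _.
  by rewrite fct_sumE.
apply: differentiable_sum => i; apply: differentiable_sum => j.
exact: differentiableZl.
Qed.

Lemma diff_delta (V : normedModType K) n (f : 'rV[K]_n -> V) x h :
  'd f x h = \sum_i h 0 i *: 'd f x (delta_mx 0 i).
Proof. by rewrite {1}(row_sum_delta h) linear_sum; apply: eq_bigr => i _; rewrite linearZ. Qed.

End NearLemmas.


(* Locked, so that unification never unfolds derivatives. *)
HB.lock Definition pd (R : realType) (V : normedModType (Cx R)) (f : V -> Cx R) (x h : V) : Cx R :=
  'd f x h.
HB.lock Definition hol (R : realType) (V : normedModType (Cx R)) (f : V -> Cx R) (x : V) : Prop :=
  \forall y \near x, differentiable f y.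

Section Hol.
Variable R : realType.
Local Notation K := (Cx R).
Variable V : normedModType K.
Implicit Types (f g : V -> K) (x h k : V).

Lemma holE f x : hol f x <-> \forall y \near x, differentiable f y.
Proof. by rewrite hol.unlock. Qed.

Lemma pdE f x h : pd f x h = 'd f x h.
Proof. by rewrite pd.unlock. Qed.

Lemma hol_diff f x : hol f x -> differentiable f x.
Proof. by move=> /holE/nbhs_singleton. Qed.

Lemma hol_cont f x : hol f x -> {for x, continuous f}.
Proof. by move=> /hol_diff/differentiable_continuous. Qed.

Lemma hol_near f x : hol f x -> \forall y \near x, hol f y.
Proof. by move=> /holE/nbhs_interior; apply: filterS => y hy; exact/holE. Qed.

Lemma hol_near_all (I : finType) (f : I -> V -> K) x : (forall i, hol (f i) x) ->
  \forall y \near x, forall i, hol (f i) y.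
Proof. by move=> H; apply: filter_forall => i; exact: hol_near. Qed.

Lemma hol_eq g f x : (\forall y \near x, f y = g y) -> hol g x -> hol f x.
Proof.
move=> /nbhs_interior E /holE H; apply/holE; near=> y.
have dg : differentiable g y by near: y.
have e : \forall z \near y, f z = g z + 0.
  have : interior (fun z => f z = g z) y by near: y.
  by apply: filterS => z ->; rewrite addr0.
by have [] := diff_near_shift dg e.
Unshelve. all: by end_near. Qed.

Lemma pd_eq g f x h : (\forall y \near x, f y = g y) -> hol g x -> pd f x h = pd g x h.
Proof.
move=> E /hol_diff dg.
have e : \forall z \near x, f z = g z + 0 by apply: filterS E => z ->; rewrite addr0.
have [_ e2] := diff_near_shift dg e; rewrite !pdE.
exact: (congr1 (fun T : V -> K => T h) e2).
Qed.

Lemma pdDr f x h k : pd f x (h + k) = pd f x h + pd f x k.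
Proof. by rewrite !pdE linearD. Qed.

Lemma pdZr f x a h : pd f x (a *: h) = a * pd f x h.
Proof. by rewrite !pdE linearZ. Qed.

Lemma pd0r f x : pd f x 0 = 0.
Proof. by rewrite -(scale0r 0) pdZr mul0r. Qed.

Lemma hol_cst a x : hol (fun=> a) x.
Proof. by apply/holE; near=> y; exact: differentiable_cst. Unshelve. all: by end_near. Qed.

Lemma pd_cst a x h : pd (fun=> a) x h = 0.
Proof. by rewrite pdE; have /(congr1 (fun T => T h)) := @diff_cst K V (K : normedModType K) a x; apply. Qed.

Lemma holD f g x : hol f x -> hol g x -> hol (fun y => f y + g y) x.
Proof. by move=> /holE df /holE dg; apply/holE; apply: filterS2 df dg => y; exact: differentiableD. Qed.

Lemma pdD f g x h : hol f x -> hol g x -> pd (fun y => f y + g y) x h = pd f x h + pd g x h.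
Proof.
move=> /hol_diff df /hol_diff dg; rewrite !pdE.
exact: (congr1 (fun T : V -> K => T h) (diffD df dg)).
Qed.

Lemma holM f g x : hol f x -> hol g x -> hol (fun y => f y * g y) x.
Proof. by move=> /holE df /holE dg; apply/holE; apply: filterS2 df dg => y; exact: differentiableM. Qed.

Lemma pdM f g x h : hol f x -> hol g x ->
  pd (fun y => f y * g y) x h = pd f x h * g x + f x * pd g x h.
Proof.
move=> /hol_diff df /hol_diff dg; rewrite !pdE [RHS]addrC [X in _ = _ + X]mulrC.
exact: (congr1 (fun T : V -> K => T h) (diffM df dg)).
Qed.

Lemma holN f x : hol f x -> hol (fun y => - f y) x.
Proof. by move=> /holE df; apply/holE; apply: filterS df => y; exact: differentiableN. Qed.

Lemma pdN f x h : hol f x -> pd (fun y => - f y) x h = - pd f x h.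
Proof.
move=> /hol_diff df; rewrite !pdE; exact: (congr1 (fun T : V -> K => T h) (diffN df)).
Qed.

Lemma holB f g x : hol f x -> hol g x -> hol (fun y => f y - g y) x.
Proof. by move=> df /holN dg; exact: holD. Qed.

Lemma pdB f g x h : hol f x -> hol g x -> pd (fun y => f y - g y) x h = pd f x h - pd g x h.
Proof. by move=> df dg; rewrite (pdD h df (holN dg)) pdN. Qed.

Lemma holZ a f x : hol f x -> hol (fun y => a * f y) x.
Proof. exact: holM (hol_cst a x). Qed.

Lemma pdZ a f x h : hol f x -> pd (fun y => a * f y) x h = a * pd f x h.
Proof. by move=> df; rewrite (pdM h (hol_cst a x) df) pd_cst mul0r add0r. Qed.

Lemma hol_sum I (s : seq I) (f : I -> V -> K) x : (forall i, hol (f i) x) ->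
  hol (fun y => \sum_(i <- s) f i y) x.
Proof.
move=> hf; elim: s => [|i s IH].
  by apply: hol_eq (hol_cst 0 x); near=> y; rewrite big_nil.
by apply: hol_eq (holD (hf i) IH); near=> y; rewrite big_cons.
Unshelve. all: by end_near. Qed.

Lemma pd_sum I (s : seq I) (f : I -> V -> K) x h : (forall i, hol (f i) x) ->
  pd (fun y => \sum_(i <- s) f i y) x h = \sum_(i <- s) pd (f i) x h.
Proof.
move=> hf; elim: s => [|i s IH].
  rewrite big_nil (pd_eq h _ (hol_cst 0 x)) ?pd_cst //.
  by near=> y; rewrite big_nil.
rewrite big_cons -IH -(pdD h (hf i) (hol_sum s hf)).
by apply: pd_eq (holD (hf i) (hol_sum s hf)); near=> y; rewrite big_cons.
Unshelve. all: by end_near. Qed.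

Lemma holV f x : hol f x -> f x != 0 -> hol (fun y => (f y)^-1) x.
Proof.
move=> H fx; have /holE df := H; apply/holE.
have /continuous_rnP/(_ (rn (f x)))[|d d0 hd] := hol_cont H; first by rewrite rn_gt0.
have nz : \forall y \near x, f y != 0.
  apply/nbhs_rnP; exists d => // y /hd h; apply/eqP => fy.
  by move: h; rewrite fy sub0r rnN ltxx.
by apply: filterS2 df nz => y; exact: differentiableV.
Qed.

Lemma hol_pd f x h : hol f x -> hol (fun y => pd f y h) x.
Proof.
move=> H; apply/holE; apply: filterS (hol_near H) => y /holE Hy.
have [d _] := diff_diff Hy h; have -> : (fun z => pd f z h) = (fun z => 'd f z h) by apply/funext => z; rewrite pdE.
exact: d.
Qed.

Lemma pdC f x h k : hol f x -> pd (fun y => pd f y h) x k = pd (fun y => pd f y k) x h.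
Proof.
move=> /holE H; have [_ E] := diff_diff H h; rewrite !pdE.
have e v : (fun y => pd f y v) = (fun y => 'd f y v) by apply/funext => z; rewrite pdE.
by rewrite !e; exact: E.
Qed.

Lemma hol_shift f x k : hol f (x + k) -> hol (fun y => f (y + k)) x.
Proof.
move=> /holE/nbhs_rnP[e e0 he]; apply/holE/nbhs_rnP; exists e => // y hy.
have dy : differentiable f (y + k) by apply: he; rewrite opprD addrACA subrr addr0.
by have [] := diff_shift dy.
Qed.

Lemma pd_shift f x k h : hol f (x + k) -> pd (fun y => f (y + k)) x h = pd f (x + k) h.
Proof. by move=> /hol_diff dy; have [_ E] := diff_shift dy; rewrite !pdE; exact: E. Qed.

Lemma pd0_near_const f x : hol f x -> (\forall y \near x, forall h, pd f y h = 0) ->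
  \forall y \near x, f y = f x.
Proof.
move=> /holE H E; apply: near_diff0_const => //.
by apply: filterS E => y e h; rewrite -pdE.
Qed.

Lemma pd_eq_near_all (I : finType) (f g : I -> V -> K) x :
  (forall i, hol (f i) x) -> (forall i, hol (g i) x) ->
  (\forall y \near x, forall i h, pd (f i) y h = pd (g i) y h) ->
  \forall y \near x, forall i, f i y - g i y = f i x - g i x.
Proof.
move=> hf hg E; apply: filter_forall => i.
apply: (pd0_near_const (holB (hf i) (hg i))); near=> y => h.
have fy : hol (f i) y by near: y; exact: hol_near.
have gy : hol (g i) y by near: y; exact: hol_near.
have e : forall i h, pd (f i) y h = pd (g i) y h by near: y.
by rewrite (pdB h fy gy) e subrr.
Unshelve. all: by end_near. Qed.

Lemma pd0_const f : (forall x, hol f x) -> (forall x h, pd f x h = 0) -> forall x, f x = f 0.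
Proof.
move=> H E; apply: clopen_all => // x fx.
  by rewrite -fx; apply: pd0_near_const => //; near=> y; exact: E.
apply: near_neq fx; [exact: norm_hausdorff|exact: hol_cont|].
by apply: hol_cont; exact: hol_cst.
Unshelve. all: by end_near. Qed.

Lemma hol_liouville f (M : R) : (forall x, hol f x) -> (forall x, rn (f x) <= M) ->
  forall x y, f x = f y.
Proof. by move=> H; apply: liouville => x; exact: hol_diff. Qed.

Lemma hol_coord m n (g : V -> 'M[K]_(m, n)) x i j : (\forall y \near x, differentiable g y) ->
  hol (fun y => g y i j) x.
Proof. by move=> dg; apply/holE; apply: filterS dg => y /(diff_coord i j)[]. Qed.

Lemma pd_coord m n (g : V -> 'M[K]_(m, n)) x h i j : differentiable g x ->
  pd (fun y => g y i j) x h = ('d g x h) i j.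
Proof. by move=> /(diff_coord i j)[_ e]; rewrite pdE. Qed.

Lemma hol_mx m n (g : V -> 'M[K]_(m, n)) x : (forall i j, hol (fun y => g y i j) x) ->
  \forall y \near x, differentiable g y.
Proof.
move=> H; suff : \forall y \near x, forall i j, differentiable (fun z => g z i j) y.
  by apply: filterS => y; exact: diff_mx.
by apply: filter_forall => i; apply: filter_forall => j; exact/holE.
Qed.

End Hol.

Section HolComp.
Variable R : realType.
Local Notation K := (Cx R).

Lemma hol_dcomp (V W : normedModType K) (g : V -> W) (f : W -> K) (x : V) :
  (\forall y \near x, differentiable g y) -> hol f (g x) -> hol (fun y => f (g y)) x.
Proof.
move=> dg Hf; have cg := differentiable_continuous (nbhs_singleton dg).
apply/holE; have := cg _ (hol_near Hf); apply: filterS2 dg => y dy fy.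
exact: (@differentiable_comp _ _ _ _ g f y dy (hol_diff fy)).
Qed.

Lemma pd_dcomp (V W : normedModType K) (g : V -> W) (f : W -> K) (x h : V) :
  differentiable g x -> hol f (g x) -> pd (fun y => f (g y)) x h = pd f (g x) ('d g x h).
Proof.
move=> dg /hol_diff df; rewrite !pdE.
exact: (congr1 (fun T : V -> K => T h) (diff_comp dg df)).
Qed.

End HolComp.

Section HolMatrix.
Variable R : realType.
Local Notation K := (Cx R).

Lemma pd_delta n (f : 'rV[K]_n -> K) x h : pd f x h = \sum_i h 0 i * pd f x (delta_mx 0 i).
Proof. by rewrite pdE diff_delta; apply: eq_bigr => i _; rewrite pdE. Qed.

Lemma hol_entry m n i j (x : 'M[K]_(m, n)) : hol (fun y : 'M[K]_(m, n) => y i j) x.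
Proof.
apply: (@hol_coord R _ m n (fun y : 'M[K]_(m, n) => y)).
near=> y; exact: ex_diff.
Unshelve. all: by end_near. Qed.

Lemma pd_entry m n i j (x h : 'M[K]_(m, n)) : pd (fun y : 'M[K]_(m, n) => y i j) x h = h i j.
Proof.
rewrite (@pd_coord R _ m n (fun y : 'M[K]_(m, n) => y)); last exact: ex_diff.
by rewrite diff_val.
Qed.

Lemma hol_mulmx (V : normedModType K) m n p (A : V -> 'M[K]_(m, n)) (B : V -> 'M[K]_(n, p)) x i j :
  (forall i j, hol (fun y => A y i j) x) -> (forall i j, hol (fun y => B y i j) x) ->
  hol (fun y => (A y *m B y) i j) x.
Proof.
move=> hA hB; apply: hol_eq (hol_sum (index_enum _) (fun k => holM (hA i k) (hB k j))).
by near=> y; rewrite mxE.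
Unshelve. all: by end_near. Qed.

Lemma pd_mulmx (V : normedModType K) m n p (A : V -> 'M[K]_(m, n)) (B : V -> 'M[K]_(n, p)) x h i j :
  (forall i j, hol (fun y => A y i j) x) -> (forall i j, hol (fun y => B y i j) x) ->
  pd (fun y => (A y *m B y) i j) x h =
  ((\matrix_(i, j) pd (fun y => A y i j) x h) *m B x +
   A x *m (\matrix_(i, j) pd (fun y => B y i j) x h)) i j.
Proof.
move=> hA hB; have hh k := holM (hA i k) (hB k j).
have E : \forall y \near x, (A y *m B y) i j = \sum_k A y i k * B y k j by near=> y; rewrite mxE.
rewrite (pd_eq h E (hol_sum _ hh)) (pd_sum _ _ hh) !mxE -big_split; apply: eq_bigr => k _.
by rewrite (pdM h (hA i k) (hB k j)) !mxE.
Unshelve. all: by end_near. Qed.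

Section Comp.
Variables (V : normedModType K) (n : nat) (g : V -> 'rV[K]_n) (f : 'rV[K]_n -> K) (x : V).
Hypotheses (hg : forall i, hol (fun y => g y 0 i) x) (hf : hol f (g x)).

Let dg : \forall y \near x, differentiable g y.
Proof. by apply: hol_mx => i j; rewrite ord1. Qed.

Lemma hol_comp : hol (fun y => f (g y)) x.
Proof. exact: hol_dcomp. Qed.

Lemma pd_comp h : pd (fun y => f (g y)) x h =
  \sum_i pd f (g x) (delta_mx 0 i) * pd (fun y => g y 0 i) x h.
Proof.
have d1 := nbhs_singleton dg; rewrite pd_dcomp // pd_delta; apply: eq_bigr => i _.
by rewrite mulrC (pd_coord _ _ _ d1).
Qed.
End Comp.

End HolMatrix.

(** * Uniqueness of uniformizations *)

Lemma shift_cont (R : realType) (V : normedModType (Cx R)) (l v : V) :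
  {for v, continuous (fun y => y + l)}.
Proof.
apply/continuous_rnP => e e0; exists e => // y.
by rewrite opprD addrACA subrr addr0.
Qed.

Lemma near_shift (R : realType) (V : normedModType (Cx R)) (Q : V -> Prop) (v l : V) :
  (\forall x \near v + l, Q x) -> \forall x \near v, Q (x + l).
Proof.
move=> /nbhs_rnP[e e0 he]; apply/nbhs_rnP; exists e => // y hy; apply: he.
by rewrite opprD addrACA subrr addr0.
Qed.

Section Unique.
Variables (R : realType) (r : nat).
Variables (M : complexManifold R r) (X : complexManifold R (r + r)).
Variable proj : X -> M.
Local Notation K := (Cx R).
Local Notation V := 'rV[K]_r.

Lemma unif_unique u p P p' P' : uniformizes proj u p P -> uniformizes proj u p' P' ->
  exists (F : 'M[K]_r) (v0 : V) (N : 'M[int]_(r + r)), [/\ F \in unitmx,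
    forall v, p' v = p (v *m F + v0) & P' *m F = intmx R N *m P].
Proof.
move=> U U'; have [hP _ hr hpp _] := U; have [hP' _ hr' hpp' _] := U'.
have pc := unif_cont U; have pc' := unif_cont U'.
have proj' v : proj (p' v) = u.
  by have h : (range p') (p' v) by [exists v]; rewrite hr' in h.
have lift (a : V) : exists f : V -> V, [/\ \forall x \near a, p (f x) = p' x,
    \forall x \near a, {for x, continuous f} & forall j, hol (fun x => f x 0 j) a].
  have [v0 _ hv0] : (range p) (p' a) by rewrite hr /=.
  have [||f [_ H]] := local_lift U (chi := p') hv0.
  - by near=> x; exact: pc'.
  - by near=> x; exact: proj'.
  exists f; split; [by apply: filterS H => x []|by apply: filterS H => x []|move=> j].
  apply: hol_coord; have H' := nbhs_interior H; near=> x.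
  have [h1 h2] : p (f x) = p' x /\ {for x, continuous f} by near: x.
  apply: (@lift_diff R r M X proj u p P U V p' f x h2).
    have h3 : (interior [set x | p (f x) = p' x /\ {for x, continuous f}]) x by near: x.
    by near=> y; have [] : [set x | p (f x) = p' x /\ {for x, continuous f}] y by near: y.
  by move=> d ad dx; exact: (unif_diff U').
have [ff hff] := choice lift.
pose g (a : V) (i j : 'I_r) : K := pd (fun x => ff a x 0 j) a (delta_mx 0 i).
have glue (f : V -> V) (a : V) : {for a, continuous f} -> (forall j, hol (fun x => f x 0 j) a) ->
    (\forall x \near a, p (f x) = p' x) -> forall i j,
    g a i j = pd (fun x => f x 0 j) a (delta_mx 0 i).
  move=> cf df E i j; have [e1 /nbhs_singleton ca da] := hff a.
  have : \forall x \near a, ff a x = f x + (ff a a - f a).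
    by apply: (lift_uniq U ca cf); apply: filterS2 e1 E => x -> ->.
  move=> H; have H' : \forall x \near a, ff a x 0 j = f x 0 j + (ff a a - f a) 0 j.
    by apply: filterS H => y ->; rewrite !mxE.
  rewrite /g (pd_eq _ H'); last exact: holD (df j) (hol_cst _ _).
  by rewrite (pdD _ (df j) (hol_cst _ _)) pd_cst addr0.
have gnear (a : V) : \forall x \near a, forall i j, g x i j = pd (fun y => ff a y 0 j) x (delta_mx 0 i).
  have [/nbhs_interior e1 c1 d1] := hff a.
  have d2 : \forall x \near a, forall j, hol (fun y => ff a y 0 j) x by exact: hol_near_all d1.
  near=> x => i j; apply: glue; [by near: x|by near: x|].
  have : interior (fun x => p (ff a x) = p' x) x by near: x.
  exact: filterS.
have gdiff i j (a : V) : hol (fun x => g x i j) a.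
  have [_ _ /(_ j)/(hol_pd (delta_mx 0 i))] := hff a; apply: hol_eq.
  by apply: filterS (gnear a) => y; apply.
have gper i j (v : V) (N : 'rV[int]_(r + r)) : g (v + intmx R N *m P') i j = g v i j.
  set l := intmx R N *m P'.
  have [e1 /nbhs_singleton cl dl] := hff (v + l).
  rewrite (glue (fun y : V => ff (v + l) (y + l)) v).
  - by rewrite (@pd_shift R V (fun y => ff (v + l) y 0 j) v l _ (dl j)).
  - apply: (@continuous_comp _ _ _ (fun y : V => y + l) (ff (v + l)) v _ cl).
    exact: (@shift_cont R V).
  - by move=> k; exact: (@hol_shift R V (fun y => ff (v + l) y 0 k)).
  - apply: filterS (@near_shift R V _ v l e1) => x ->; exact: (unif_shift x N U').
have gconst i j (v : V) : g v i j = g 0 i j.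
  have cg : continuous (fun x => g x i j) by move=> x; exact: hol_cont.
  have [B hB] := periodic_bounded hP' cg (gper i j).
  exact: (hol_liouville (gdiff i j) hB).
pose F : 'M[K]_r := \matrix_(i, j) g 0 i j.
have [v0 _ hv0] : (range p) (p' 0) by rewrite hr /=.
have hid (x : V) i j : hol (fun y : V => y i j) x := hol_entry i j x.
have hcF (x : V) i j : hol (fun _ : V => F i j) x := hol_cst (F i j) x.
have hF (x : V) j : hol (fun x : V => (x *m F) 0 j) x := hol_mulmx 0 j (hid x) (hcF x).
have dF (x : V) j i : pd (fun x : V => (x *m F) 0 j) x (delta_mx 0 i) = F i j.
  rewrite (pd_mulmx _ 0 j (hid x) (hcF x)).
  have -> : \matrix_(i', j') pd (fun y : V => y i' j') x (delta_mx 0 i) = delta_mx 0 i.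
    by apply/matrixP => a b; rewrite mxE pd_entry.
  have -> : \matrix_(i', j') pd (fun _ : V => F i' j') x (delta_mx 0 i) = 0.
    by apply/matrixP => a b; rewrite !mxE pd_cst.
  by rewrite mulmx0 addr0 -rowE mxE.
have main (v : V) : p' v = p (v *m F + v0).
  move: v; apply: clopen_all; first by rewrite mul0mx add0r.
  - move=> a Wa; have [e1 _ d1] := hff a.
    have cst : \forall x \near a, forall j, ff a x 0 j - (x *m F) 0 j = ff a a 0 j - (a *m F) 0 j.
      apply: (pd_eq_near_all d1 (fun j => hF a j)).
      near=> x.
      have G : forall i j, g x i j = pd (fun y => ff a y 0 j) x (delta_mx 0 i) by near: x; exact: gnear.
      move=> j h; rewrite pd_delta [RHS]pd_delta; apply: eq_bigr => i _.
      by rewrite dF mxE -(gconst i j x) G.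
    have pa : p (ff a a) = p (a *m F + v0) by rewrite -Wa; exact: (nbhs_singleton e1).
    have [N hN] := (hpp _ _).1 pa.
    near=> x; have px : p (ff a x) = p' x by near: x.
    have xE : ff a x = (x *m F + v0) + intmx R N *m P.
      rewrite -hN; apply/rowP => j; have : forall j, ff a x 0 j - (x *m F) 0 j = ff a a 0 j - (a *m F) 0 j by near: x.
      move=> /(_ j) Ej; rewrite -(subrK ((x *m F) 0 j) (ff a x 0 j)) Ej.
      rewrite !mxE; move: (ff a a 0 j) (\sum_k _) (\sum_k _) (v0 0 j) => s1 s2 s3 s4.
      by rewrite !opprD !addrA; ring.
    by rewrite -px xE (unif_shift _ _ U).
  - move=> a Wa; have ca : {for a, continuous (fun v : V => p (v *m F + v0))}.
      apply: (@continuous_comp _ _ _ (fun v : V => v *m F + v0) p a); last exact: pc.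
      apply: (@continuous_comp _ _ _ (fun v : V => v *m F) (fun v : V => v + v0) a).
        exact: mulmx_continuous.
      exact: (@shift_cont R V v0 (a *m F)).
    exact: (near_neq (@space_hausdorff _ _ X) (pc' a) ca Wa).
have rowN (a : 'I_(r + r)) : exists N : 'rV[int]_(r + r), row a P' *m F = intmx R N *m P.
  have : p (row a P' *m F + v0) = p v0.
    have e1 : intmx R (delta_mx 0 a : 'rV[int]_(r + r)) *m P' = row a P'.
      rewrite rowE; congr (_ *m _); apply/matrixP => i j; rewrite !mxE.
      by case: (_ && _).
    rewrite -main hv0 -e1 -[X in p' X]add0r (unif_shift _ _ U') //.
  by move=> /hpp[N]; rewrite addrK => ->; exists N.
have [N hN] := choice rowN.
exists F, v0, (\matrix_a N a); split => //.
- rewrite -row_free_unit -kermx_eq0; apply/eqP/row_matrixP => i; rewrite row0.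
  set x := row i _; have xF : x *m F = 0 by apply/sub_kermxP; exact: row_sub.
  have [e e0 he] := unif_discrete U'.
  have p1 : 0 < 1 + rn x by have := rn_ge0 x; lra.
  pose t := ofReal (e / (1 + rn x)).
  have tx0 : t *: x = 0.
    apply: he; first by rewrite !main -scalemxAl xF scaler0 mul0mx.
    rewrite subr0 rnZ rn_ofReal gtr0_norm ?divr_gt0 // mulrAC ltr_pdivrMr //.
    by rewrite ltr_pM2l // ltrDr.
  have t0 : t != 0 by rewrite ofReal_eq0 gt_eqF // divr_gt0.
  by apply: (scalerI t0); rewrite tx0 scaler0.
- apply/row_matrixP => a; rewrite row_mul hN row_mul; congr (_ *m _).
  by apply/matrixP => i j; rewrite !mxE ord1.
Unshelve. all: by end_near. Qed.

End Unique.

Section Loops.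
Variables (R : realType) (r : nat).
Variables (M : complexManifold R r) (X : complexManifold R (r + r)).
Variable proj : X -> M.
Local Notation K := (Cx R).
Local Notation V := 'rV[K]_r.

Lemma within_rn (h : R -> V) (A : set R) : {within A, continuous h} ->
  forall t, A t -> forall e : R, 0 < e -> \forall s \near t, A s -> rn (h s - h t) < e.
Proof.
move=> /subspace_continuousP H t At e e0.
have B : nbhs (h t) [set y | rn (y - h t) < e] by apply/nbhs_rnP; exists e.
exact: (H t At _ B).
Qed.

Lemma loop_class_change u p P p' P' F v0 g n n' : uniformizes proj u p P ->
  (forall v, p' v = p (v *m F + v0)) ->
  loop_class p P g n -> loop_class p' P' g n' ->
  intmx R n' *m P' *m F = intmx R n *m P.
Proof.
move=> U pE [h [ch gh hn]] [h' [ch' gh' hn']].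
have [hP _ _ hpp _] := U; have [e e0 he] := lattice_discrete hP.
pose A : set R := `[0, 1]%classic.
have A0 : A 0 by rewrite /A /= in_itv /= lexx ler01.
have A1 : A 1 by rewrite /A /= in_itv /= lexx ler01.
pose k t := h' t *m F + v0 - h t.
have kN t : A t -> exists N : 'rV[int]_(r + r), k t = intmx R N *m P.
  by rewrite /A /= in_itv => /= t01; apply/hpp; rewrite -pE -gh // gh'.
have [C C0 hC] := @mulmx_lip R 1 _ _ F.
have kc t : A t -> \forall s \near t, A s -> k s = k t.
  move=> At.
  have e1 : 0 < e / 2 / C by rewrite !divr_gt0.
  have e2 : 0 < e / 2 by rewrite divr_gt0.
  have n1 := within_rn ch' At e1; have n2 := within_rn ch At e2.
  near=> s => As.
  have s1 : rn (h' s - h' t) < e / 2 / C by move: As; near: s.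
  have s2 : rn (h s - h t) < e / 2 by move: As; near: s.
  have [N hN] := kN s As; have [N0 hN0] := kN t At.
  have E : k s - k t = (h' s - h' t) *m F - (h s - h t).
    by rewrite /k mulmxBl !opprD !opprK addrACA (addrACA _ v0) subrr addr0.
  have E2 : k s - k t = intmx R (N - N0) *m P.
    rewrite hN hN0 -mulmxBl; congr (_ *m _).
    by apply/matrixP => i j; rewrite !mxE intrD intrN.
  apply/eqP; rewrite -subr_eq0 E2.
  have /he -> : rn (intmx R (N - N0) *m P) < e.
    rewrite -E2 E; apply: le_lt_trans (rnB _ _) _; rewrite (splitr e) ltr_leD ?ltW //.
    by apply: le_lt_trans (hC _) _; rewrite mulrC -ltr_pdivlMr.
  by rewrite (_ : intmx R 0 = 0) ?mul0mx //; apply/matrixP => i j; rewrite !mxE.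
have : k 1 = k 0.
  apply: (@connected_ind R A (fun t => k t = k 0)); rewrite //.
  - exact: segment_connected.
  - by exists 0.
  - by move=> t At kt; apply: filterS (kc t At) => s H /H ->.
  - by move=> t At kt; apply: filterS (kc t At) => s H /H ->.
rewrite -hn' -hn /k mulmxBl => E.
apply/rowP => j; have := congr1 (fun w : V => w 0 j) E.
rewrite !mxE; move: (\sum_i _) (\sum_i _) => x y.
move: (h 1 0 j) (h 0 0 j) (v0 0 j) => a b c Ej.
have -> : y - x = (y + c - a) - (x + c - b) + (a - b) by ring.
by rewrite Ej subrr add0r.
Unshelve. all: by end_near. Qed.

End Loops.

(** * Pullback of closed 2-forms *)

HB.lock Definition sesq (K : pzRingType) m (x : 'rV[K]_m) (A : 'M[K]_m) (y : 'rV[K]_m) : K :=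
  (x *m A *m y^T) 0 0.

Section Sesq.
Variables (K : comPzRingType) (m : nat).
Implicit Types (x y : 'rV[K]_m) (A : 'M[K]_m).

Lemma sesqE x A y : sesq x A y = (x *m A *m y^T) 0 0.
Proof. by rewrite sesq.unlock. Qed.

Lemma sesq_asym x A y : A^T = - A -> sesq x A y = - sesq y A x.
Proof.
move=> asym; rewrite !sesqE; have -> : x *m A *m y^T = (y *m A^T *m x^T)^T.
  by rewrite !trmx_mul !trmxK mulmxA.
by rewrite mxE asym mulmxN mulNmx mxE.
Qed.

Lemma sesq_sum x A y : sesq x A y = \sum_a \sum_b x 0 a * y 0 b * A a b.
Proof.
rewrite sesqE mxE; under eq_bigr => b _ do rewrite mxE mulr_suml.
rewrite exchange_big; apply: eq_bigr => a _; apply: eq_bigr => b _.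
by rewrite mxE mulrAC.
Qed.

(* The cyclic sum over the three index positions of a tensor d with vanishing
   cyclic sum. *)
Lemma sesq_cyclic x y z (d : 'I_m -> 'I_m -> 'I_m -> K) :
  (forall a b c, d b c a + d c a b + d a b c = 0) ->
  let D (u : 'rV[K]_m) := \matrix_(i, j) \sum_c u 0 c * d i j c in
  sesq x (D z) y + sesq y (D x) z + sesq z (D y) x = 0.
Proof.
move=> cl D.
have ex (x' y' z' : 'rV[K]_m) : sesq x' (D z') y' =
    \sum_a \sum_b \sum_c x' 0 a * y' 0 b * z' 0 c * d a b c.
  rewrite sesq_sum; apply: eq_bigr => a _; apply: eq_bigr => b _.
  by rewrite mxE mulr_sumr; apply: eq_bigr => c _; rewrite mulrA.
rewrite !ex.
have -> : \sum_a \sum_b \sum_c y 0 a * z 0 b * x 0 c * d a b c =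
    \sum_a \sum_b \sum_c x 0 a * y 0 b * z 0 c * d b c a.
  rewrite [RHS]exchange_big; apply: eq_bigr => b _; rewrite exchange_big.
  by apply: eq_bigr => c _; apply: eq_bigr => a _; congr (_ * _); rewrite mulrC mulrA.
have -> : \sum_a \sum_b \sum_c z 0 a * x 0 b * y 0 c * d a b c =
    \sum_a \sum_b \sum_c x 0 a * y 0 b * z 0 c * d c a b.
  rewrite exchange_big; apply: eq_bigr => a _; rewrite exchange_big.
  by apply: eq_bigr => b _; apply: eq_bigr => c _; congr (_ * _); rewrite -mulrA mulrC.
rewrite -!big_split big1 // => a _; rewrite -!big_split big1 // => b _.
rewrite -!big_split big1 // => c _ /=; rewrite -!mulrDr.
by rewrite -addrA addrC cl mulr0.
Qed.

Lemma sesqDl x x' A y : sesq (x + x') A y = sesq x A y + sesq x' A y.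
Proof. by rewrite !sesqE !mulmxDl mxE. Qed.

Lemma sesqDr x A y y' : sesq x A (y + y') = sesq x A y + sesq x A y'.
Proof. by rewrite !sesqE linearD /= mulmxDr mxE. Qed.

Lemma sesqZr a x A y : sesq x A (a *: y) = a * sesq x A y.
Proof. by rewrite !sesqE linearZ /= -scalemxAr mxE. Qed.

Lemma sesqZ a x A y : sesq x (a *: A) y = a * sesq x A y.
Proof. by rewrite !sesqE -scalemxAr -scalemxAl mxE. Qed.

Lemma cyclic_cancel (a b c x y z : K) : a + b + c = 0 ->
  (x + a + y) + (- z + b - x) + (- y + c + z) = 0.
Proof. by move=> E; rewrite -[RHS]E; ring. Qed.

End Sesq.

Lemma sesq_mulmx (K : comPzRingType) m n (x : 'rV[K]_m) (B : 'M[K]_(m, n)) A (y : 'rV[K]_m) :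
  sesq (x *m B) A (y *m B) = sesq x (B *m A *m B^T) y.
Proof. by rewrite !sesqE trmx_mul !mulmxA. Qed.

Section ClosedPullback.
Variable R : realType.
Local Notation K := (Cx R).
Variables (V : normedModType K) (m : nat) (phi : V -> 'rV[K]_m) (La : 'rV[K]_m -> 'M[K]_m) (w : V).
Hypothesis hphi : forall j, hol (fun y => phi y 0 j) w.
Hypothesis hLa : forall i j, hol (fun z => La z i j) (phi w).

Let T h : V -> 'rV[K]_m := fun y => \row_j pd (fun y => phi y 0 j) y h.

Let hT h i j : hol (fun y => T h y i j) w.
Proof.
apply: (hol_eq _ (hol_pd h (hphi j))); near=> y; by rewrite mxE.
Unshelve. all: by end_near. Qed.

Let hTt h i j : hol (fun y => (T h y)^T i j) w.
Proof.
apply: (hol_eq _ (hT h j i)); near=> y; by rewrite mxE.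
Unshelve. all: by end_near. Qed.

Let hLp i j : hol (fun y => La (phi y) i j) w.
Proof. exact: (@hol_comp R V m phi (fun z => La z i j)). Qed.

Let hTL h i j : hol (fun y => (T h y *m La (phi y)) i j) w.
Proof. exact: hol_mulmx. Qed.

Lemma pullback_hol h k : hol (fun y => sesq (T h y) (La (phi y)) (T k y)) w.
Proof.
apply: (hol_eq _ (hol_mulmx 0 0 (hTL h) (hTt k))).
by near=> y; rewrite sesqE.
Unshelve. all: by end_near. Qed.

Let S h l : 'rV[K]_m := \row_j pd (fun y => pd (fun y => phi y 0 j) y h) w l.
Let D l : 'M[K]_m := \matrix_(i, j) \sum_c T l w 0 c * pd (fun z => La z i j) (phi w) (delta_mx 0 c).

Lemma pullback_pd h k l : pd (fun y => sesq (T h y) (La (phi y)) (T k y)) w l =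
  sesq (S h l) (La (phi w)) (T k w) + sesq (T h w) (D l) (T k w) + sesq (T h w) (La (phi w)) (S k l).
Proof.
have eS h' : \matrix_(i, j) pd (fun y => T h' y i j) w l = S h' l.
  apply/matrixP => i j; rewrite !mxE; apply: (pd_eq _ _ (hol_pd _ (hphi j))).
  by near=> y; rewrite mxE.
have eSt h' : \matrix_(i, j) pd (fun y => (T h' y)^T i j) w l = (S h' l)^T.
  apply/matrixP => i j; rewrite !mxE; apply: (pd_eq _ _ (hol_pd _ (hphi i))).
  by near=> y; rewrite !mxE.
have eD : \matrix_(i, j) pd (fun y => La (phi y) i j) w l = D l.
  apply/matrixP => i j; rewrite !mxE (@pd_comp R V m phi (fun z => La z i j)) //.
  by apply: eq_bigr => c _; rewrite mxE mulrC.
have e2 : \matrix_(i, j) pd (fun y => (T h y *m La (phi y)) i j) w l =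
    S h l *m La (phi w) + T h w *m D l.
  apply/matrixP => i j; rewrite mxE; apply: (etrans (pd_mulmx l i j (hT h) hLp)).
  exact: (congr2 (fun A B : 'M[K]_(_, _) => (A *m La (phi w) + T h w *m B) i j) (eS h) eD).
have e0 : \forall y \near w, sesq (T h y) (La (phi y)) (T k y) = (T h y *m La (phi y) *m (T k y)^T) 0 0.
  by near=> y; rewrite sesqE.
apply: (etrans (pd_eq _ e0 (hol_mulmx 0 0 (hTL h) (hTt k)))).
apply: (etrans (pd_mulmx l 0 0 (hTL h) (hTt k))).
apply: (etrans (congr2 (fun A B : 'M[K]_(_, _) => (A *m (T k w)^T + T h w *m La (phi w) *m B) 0 0) e2 (eSt k))).
by rewrite mulmxDl !sesqE mxE [X in X + _ = _]mxE.
Unshelve. all: by end_near. Qed.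

Lemma pullback_closed : (La (phi w))^T = - La (phi w) ->
  (forall i j k, pd (fun z => La z j k) (phi w) (delta_mx 0 i) +
     pd (fun z => La z k i) (phi w) (delta_mx 0 j) + pd (fun z => La z i j) (phi w) (delta_mx 0 k) = 0) ->
  forall h k l,
  pd (fun y => sesq (T h y) (La (phi y)) (T k y)) w l +
  pd (fun y => sesq (T k y) (La (phi y)) (T l y)) w h +
  pd (fun y => sesq (T l y) (La (phi y)) (T h y)) w k = 0.
Proof.
move=> asym cl h k l; have sS h' l' : S h' l' = S l' h' by apply/rowP => j; rewrite !mxE; exact: pdC.
have third := sesq_cyclic (T h w) (T k w) (T l w) (d := fun i j c => pd (fun z => La z i j) (phi w) (delta_mx 0 c))
  (fun a b c => cl a b c).
rewrite (pullback_pd h k l) (pullback_pd k l h) (pullback_pd l h k).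
rewrite (sS k h) (sS l h) (sS l k) (sesq_asym (S h k) (T l w) asym).
rewrite (sesq_asym (S k l) (T h w) asym) (sesq_asym (T k w) (S h l) asym).
exact: cyclic_cancel third.
Qed.

End ClosedPullback.

Section ChartLemmas.
Variables (R : realType) (n : nat) (Y : complexManifold R n).
Local Notation K := (Cx R).
Variable c : chart Y 'rV[K]_n.
Hypothesis ac : atlas Y c.

Lemma chart_dom_near (x : Y) : chart_dom c x -> \forall y \near x, chart_dom c y.
Proof. by move=> dx; have [oD _ _ _ _] := atlas_is_chart ac; exact: open_nbhs_nbhs. Qed.

Lemma chart_mapK (x : Y) : chart_dom c x -> chart_inv c (chart_map c x) = x.
Proof. by have [_ _ h _ _] := atlas_is_chart ac; exact: h. Qed.

Lemma chart_near_inv (x : Y) (Q : Y -> Prop) : chart_dom c x -> (\forall y \near x, Q y) ->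
  \forall z \near chart_map c x, Q (chart_inv c z).
Proof.
move=> dx Qx; have [_ _ h _ ci] := atlas_is_chart ac.
have ci1 := ci (chart_map c x) (imageP _ dx); apply: ci1; rewrite h //.
Qed.

Lemma chart_near_map (x : Y) (Q : 'rV[K]_n -> Prop) : chart_dom c x ->
  (\forall z \near chart_map c x, Q z) -> \forall y \near x, Q (chart_map c y).
Proof. by move=> dx Qx; have [_ _ _ cm _] := atlas_is_chart ac; exact: (cm _ dx). Qed.

Lemma chart_near_invK (x : Y) : chart_dom c x ->
  \forall z \near chart_map c x, chart_dom c (chart_inv c z) /\ chart_map c (chart_inv c z) = z.
Proof.
move=> dx; have [_ oD h _ _] := atlas_is_chart ac.
have : nbhs (chart_map c x) (chart_map c @` chart_dom c) by apply: open_nbhs_nbhs; split=> //; exact: imageP.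
by apply: filterS => z [y dy <-]; rewrite h.
Qed.

Lemma chart_near_pull (x : Y) (Q : Y -> Prop) : chart_dom c x ->
  (\forall z \near chart_map c x, Q (chart_inv c z)) -> \forall y \near x, Q y.
Proof.
move=> dx /(chart_near_map dx) H; apply: filterS2 (chart_dom_near dx) H => y dy.
by rewrite chart_mapK.
Qed.

End ChartLemmas.

Section Omega.
Variables (R : realType) (r : nat) (X : complexManifold R (r + r)).
Local Notation K := (Cx R).
Variable V : normedModType K.

Definition hmap (Psi : V -> X) (w : V) : Prop := \forall y \near w,
  {for y, continuous Psi} /\
  forall d, atlas X d -> chart_dom d (Psi y) -> differentiable (chart_map d \o Psi) y.

Lemma hmap_near Psi w : hmap Psi w -> \forall y \near w, hmap Psi y.
Proof. exact: nbhs_interior. Qed.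

(* d(g o Psi) at w in the direction h. *)
Definition tv m (g : X -> 'rV[K]_m) (Psi : V -> X) (w h : V) : 'rV[K]_m :=
  \row_j pd (fun y => g (Psi y) 0 j) w h.

Lemma tvE m (g : X -> 'rV[K]_m) Psi w h : differentiable (g \o Psi) w -> tv g Psi w h = 'd (g \o Psi) w h.
Proof. by move=> D; apply/rowP => j; rewrite mxE (@pd_coord R V 1 m (g \o Psi)). Qed.

Section At.
Variables (Psi : V -> X) (w : V).
Hypothesis hPsi : hmap Psi w.

Lemma hmap_dom d : atlas X d -> chart_dom d (Psi w) -> \forall y \near w, chart_dom d (Psi y).
Proof.
by move=> ad dx; have [cw _] := nbhs_singleton hPsi; apply: cw; exact: chart_dom_near.
Qed.

Lemma hmap_hol d j : atlas X d -> chart_dom d (Psi w) -> hol (fun y => chart_map d (Psi y) 0 j) w.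
Proof.
move=> ad dx; apply: (@hol_coord R V 1 _ (chart_map d \o Psi)).
by apply: filterS2 hPsi (hmap_dom ad dx) => y [_ h] dy; exact: h.
Qed.

Lemma tv_push m (g : X -> 'rV[K]_m) d h : atlas X d -> chart_dom d (Psi w) ->
  differentiable (g \o chart_inv d) (chart_map d (Psi w)) ->
  tv g Psi w h = tv (chart_map d) Psi w h *m jacobian (g \o chart_inv d) (chart_map d (Psi w)).
Proof.
move=> ad dx dg; have [_ hd] := nbhs_singleton hPsi; have dphi := hd d ad dx.
have D := differentiable_comp dphi dg.
have E : \forall y \near w, (g \o Psi) y = ((g \o chart_inv d) \o (chart_map d \o Psi)) y + 0.
  by apply: filterS (hmap_dom ad dx) => y dy /=; rewrite chart_mapK // addr0.
have [D' E'] := diff_near_shift D E.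
rewrite (tvE h D') (tvE h dphi) jacE.
apply: (etrans (congr1 (fun T : V -> 'rV[K]_m => T h) E')).
exact: (congr1 (fun T : V -> 'rV[K]_m => T h) (diff_comp dphi dg)).
Qed.

End At.

Variable L : chart X 'rV[K]_(r + r) -> X -> 'M[K]_(r + r).
Hypothesis hL : holomorphic_2form L.

Definition om d Psi w h k : K :=
  sesq (tv (chart_map d) Psi w h) (L d (Psi w)) (tv (chart_map d) Psi w k).

Lemma om_indep d d' Psi w h k : hmap Psi w -> atlas X d -> atlas X d' ->
  chart_dom d (Psi w) -> chart_dom d' (Psi w) -> om d Psi w h k = om d' Psi w h k.
Proof.
move=> hP ad ad' dx dx'; have dg := atlas_compatible ad ad' dx dx'.
rewrite /om (tv_push hP h ad dx dg) (tv_push hP k ad dx dg) sesq_mulmx.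
by have [_ ->] := hL.
Qed.

Definition dof (x : X) := s2val (cid2 (atlas_cover x)).
Lemma dof_atlas x : atlas X (dof x). Proof. exact: (s2valP (cid2 (atlas_cover x))). Qed.
Lemma dof_dom x : chart_dom (dof x) x. Proof. exact: (s2valP' (cid2 (atlas_cover x))). Qed.

(* The pullback Psi^* L at w, evaluated on h and k. *)
Definition omega Psi w h k : K := om (dof (Psi w)) Psi w h k.

Lemma omegaE d Psi w h k : hmap Psi w -> atlas X d -> chart_dom d (Psi w) ->
  omega Psi w h k = om d Psi w h k.
Proof. by move=> hP ad dx; apply: om_indep => //; [exact: dof_atlas|exact: dof_dom]. Qed.

Lemma omega_near d Psi w h k : hmap Psi w -> atlas X d -> chart_dom d (Psi w) ->
  \forall y \near w, omega Psi y h k = om d Psi y h k.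
Proof.
move=> hP ad dx; apply: filterS2 (hmap_near hP) (hmap_dom hP ad dx) => y hy dy.
exact: omegaE.
Qed.

Lemma L_hol d x i j : atlas X d -> chart_dom d x ->
  hol (fun z => (L d \o chart_inv d) z i j) (chart_map d x).
Proof.
move=> ad dx; apply: hol_coord; have [hL1 _] := hL; have [hd _] := hL1 d ad.
have N := chart_near_invK ad dx; near=> z.
have [dz zE] : chart_dom d (chart_inv d z) /\ chart_map d (chart_inv d z) = z by near: z.
have [_ h] := hd _ dz; rewrite -zE.
exact: (h d (Chart setT id id) ad erefl dz I).
Unshelve. all: by end_near. Qed.

Section Chart.
Variables (Psi : V -> X) (w : V) (d : chart X 'rV[K]_(r + r)).
Hypotheses (hP : hmap Psi w) (ad : atlas X d) (dx : chart_dom d (Psi w)).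

Let om_near h k : \forall y \near w, omega Psi y h k =
  sesq (tv (chart_map d) Psi y h) ((L d \o chart_inv d) (chart_map d (Psi y))) (tv (chart_map d) Psi y k).
Proof.
apply: filterS2 (omega_near h k hP ad dx) (hmap_dom hP ad dx) => y -> dy.
by rewrite /om /= chart_mapK.
Qed.

Let hphi j : hol (fun y => chart_map d (Psi y) 0 j) w.
Proof. exact: hmap_hol. Qed.

Let hLa i j : hol (fun z => (L d \o chart_inv d) z i j) (chart_map d (Psi w)).
Proof. exact: L_hol. Qed.

Let hom h k : hol (fun y => sesq (tv (chart_map d) Psi y h) ((L d \o chart_inv d) (chart_map d (Psi y)))
  (tv (chart_map d) Psi y k)) w.
Proof. exact: (@pullback_hol R V _ (fun y => chart_map d (Psi y)) (L d \o chart_inv d) w). Qed.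

Lemma omega_hol_aux h k : hol (fun y => omega Psi y h k) w.
Proof. exact: hol_eq (om_near h k) (hom h k). Qed.

Lemma omega_closed_aux : closed_2form L -> forall h k l,
  pd (fun y => omega Psi y h k) w l + pd (fun y => omega Psi y k l) w h +
  pd (fun y => omega Psi y l h) w k = 0.
Proof.
move=> cL h k l.
rewrite (pd_eq l (om_near h k) (hom h k)) (pd_eq h (om_near k l) (hom k l)) (pd_eq k (om_near l h) (hom l h)).
apply: (@pullback_closed R V _ (fun y => chart_map d (Psi y)) (L d \o chart_inv d) w) => //.
  by rewrite /= chart_mapK //; have [/(_ d ad)[_ h1] _] := hL; exact: h1.
move=> a b c0; have := cL d ad _ dx a b c0.
have dL : differentiable (L d \o chart_inv d) (chart_map d (Psi w)).
  have [hL1 _] := hL; have [hd _] := hL1 d ad; have [_ h1] := hd _ dx.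
  exact: (h1 d (Chart setT id id) ad erefl dx I).
by rewrite /= !(pd_coord _ _ _ dL).
Qed.

Lemma omega_asym_aux h k : omega Psi w h k = - omega Psi w k h.
Proof.
rewrite !(omegaE _ _ hP ad dx) /om; apply: sesq_asym.
by have [/(_ d ad)[_ h1] _] := hL; exact: h1.
Qed.

End Chart.

Section Props.
Variables (Psi : V -> X) (w : V).
Hypothesis hP : hmap Psi w.
Let ad := dof_atlas (Psi w).
Let dx := dof_dom (Psi w).

Lemma omega_hol h k : hol (fun y => omega Psi y h k) w.
Proof. exact: omega_hol_aux hP ad dx h k. Qed.

Lemma omega_closed : closed_2form L -> forall h k l,
  pd (fun y => omega Psi y h k) w l + pd (fun y => omega Psi y k l) w h +
  pd (fun y => omega Psi y l h) w k = 0.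
Proof. exact: omega_closed_aux hP ad dx. Qed.

Lemma omega_asym h k : omega Psi w h k = - omega Psi w k h.
Proof. exact: omega_asym_aux hP ad dx h k. Qed.
End Props.

Lemma tvDr m (g : X -> 'rV[K]_m) Psi w h k : tv g Psi w (h + k) = tv g Psi w h + tv g Psi w k.
Proof. by apply/rowP => j; rewrite !mxE pdDr. Qed.

Lemma tvZr m (g : X -> 'rV[K]_m) Psi w a h : tv g Psi w (a *: h) = a *: tv g Psi w h.
Proof. by apply/rowP => j; rewrite !mxE pdZr. Qed.

Lemma omegaDl Psi w h h' k : omega Psi w (h + h') k = omega Psi w h k + omega Psi w h' k.
Proof. by rewrite /omega /om tvDr sesqDl. Qed.

Lemma omegaDr Psi w h k k' : omega Psi w h (k + k') = omega Psi w h k + omega Psi w h k'.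
Proof. by rewrite /omega /om tvDr sesqDr. Qed.

Lemma omegaZr Psi w a h k : omega Psi w h (a *: k) = a * omega Psi w h k.
Proof. by rewrite /omega /om tvZr sesqZr. Qed.

End Omega.

(* The differential of f at x is l. *)
Definition isd (R : realType) (V W : normedModType (Cx R)) (f : V -> W) (x : V) (l : V -> W) : Prop :=
  differentiable f x /\ forall h, 'd f x h = l h.

Section Isd.
Variable R : realType.
Local Notation K := (Cx R).

Section Rules.
Variables V W W' : normedModType K.
Implicit Types (f : V -> W) (x : V).

Lemma isd_lin (l : {linear V -> W}) x : continuous l -> isd l x l.
Proof.
move=> cl; split; first exact: linear_differentiable.
by move=> h; exact: (congr1 (fun T : V -> W => T h) (diff_lin x cl)).
Qed.

Lemma isd_cst (a : W) x : isd (fun=> a) x (fun=> 0).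
Proof.
split=> [|h]; first exact: differentiable_cst.
by have /(congr1 (fun T => T h)) := @diff_cst K V W a x; apply.
Qed.

Lemma isd_pair f (g : V -> W') x l m : isd f x l -> isd g x m ->
  isd (fun y => (f y, g y)) x (fun h => (l h, m h)).
Proof.
move=> [df El] [dg Em]; split=> [|h]; first exact: differentiable_pair.
apply: (etrans (congr1 (fun T : V -> W * W' => T h) (diff_pair df dg))).
by rewrite /= El Em.
Qed.

Lemma isd_comp f (g : W -> W') x l m : isd f x l -> isd g (f x) m ->
  isd (fun y => g (f y)) x (fun h => m (l h)).
Proof.
move=> [df El] [dg Em]; split=> [|h]; first exact: (differentiable_comp df dg).
apply: (etrans (congr1 (fun T : V -> W' => T h) (diff_comp df dg))).
by rewrite /= El Em.
Qed.

Lemma isdD f (g : V -> W) x l m : isd f x l -> isd g x m ->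
  isd (fun y => f y + g y) x (fun h => l h + m h).
Proof.
move=> [df El] [dg Em]; split=> [|h]; first exact: differentiableD.
apply: (etrans (congr1 (fun T : V -> W => T h) (diffD df dg))).
exact: (congr2 (fun a b : W => a + b) (El h) (Em h)).
Qed.

Lemma isd_id x : isd (fun y : V => y) x (fun h => h).
Proof. by split=> [|h]; [exact: ex_diff|rewrite diff_val]. Qed.

End Rules.

Lemma isd_fst (V W : normedModType K) (x : V * W) : isd (fst : V * W -> V) x fst.
Proof.
have lf : linear (fst : V * W -> V) by [].
pose l : {linear (V * W)%type -> V} := HB.pack (fst : V * W -> V) (@GRing.isLinear.Build K _ _ _ _ lf).
by apply: (@isd_lin _ _ l) => y; exact: cvg_fst.
Qed.

Lemma isd_snd (V W : normedModType K) (x : V * W) : isd (snd : V * W -> W) x snd.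
Proof.
have lf : linear (snd : V * W -> W) by [].
pose l : {linear (V * W)%type -> W} := HB.pack (snd : V * W -> W) (@GRing.isLinear.Build K _ _ _ _ lf).
by apply: (@isd_lin _ _ l) => y; exact: cvg_snd.
Qed.


Lemma pd_isd (V W : normedModType K) (g : V -> W) (f : W -> K) (x h : V) l :
  isd g x l -> hol f (g x) -> pd (fun y => f (g y)) x h = pd f (g x) (l h).
Proof. by move=> [dg El] hf; rewrite pd_dcomp // El. Qed.

Lemma isd_rV (V : normedModType K) n (f : V -> 'rV[K]_n) x :
  (forall j, hol (fun y => f y 0 j) x) ->
  isd f x (fun h => \row_j pd (fun y => f y 0 j) x h).
Proof.
move=> hf; have df : differentiable f x.
  by apply: diff_mx => i j; rewrite ord1; exact: hol_diff.
by split=> // h; apply/rowP => j; rewrite mxE (pd_coord _ _ _ df).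
Qed.

End Isd.

Section Slices.
Variables (R : realType) (r : nat) (X : complexManifold R (r + r)).
Local Notation K := (Cx R).
Variables V V' : normedModType K.
Variables (s : V' -> V) (l : V' -> V' -> V) (x : V').
Hypothesis ds : \forall y \near x, isd s y (l y).

Lemma hmap_comp (Psi : V -> X) : hmap Psi (s x) -> hmap (fun y => Psi (s y)) x.
Proof.
move=> H; have cs : {for x, continuous s} by have [d _] := nbhs_singleton ds; exact: differentiable_continuous.
have H' := cs _ H; rewrite /hmap; near=> y.
have [dy _] : isd s y (l y) by near: y.
have [cy hy] : (fun y => {for y, continuous Psi} /\
  forall d, atlas X d -> chart_dom d (Psi y) -> differentiable (chart_map d \o Psi) y) (s y).
  by near: y; exact: H'.
split=> [|d ad dd]; first exact: (continuous_comp (differentiable_continuous dy) cy).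
exact: (@differentiable_comp _ _ _ _ s (chart_map d \o Psi) y dy (hy d ad dd)).
Unshelve. all: by end_near. Qed.

Lemma tv_comp m (g : X -> 'rV[K]_m) (Psi : V -> X) h :
  (forall j, hol (fun y => g (Psi y) 0 j) (s x)) ->
  tv g (fun y => Psi (s y)) x h = tv g Psi (s x) (l x h).
Proof.
move=> hg; apply/rowP => j; rewrite !mxE.
exact: (@pd_isd R V' V s (fun y => g (Psi y) 0 j) x h _ (nbhs_singleton ds)).
Qed.

Lemma omega_comp (L : chart X 'rV[K]_(r + r) -> X -> 'M[K]_(r + r)) (Psi : V -> X) h k :
  hmap Psi (s x) -> omega L (fun y => Psi (s y)) x h k = omega L Psi (s x) (l x h) (l x k).
Proof.
move=> H; have hh j := hmap_hol H j (dof_atlas (Psi (s x))) (dof_dom (Psi (s x))).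
by rewrite /omega /om !(tv_comp _ hh).
Qed.

End Slices.

(** * Torus charts and the flow *)

Section PairTopology.
Variables S T T' : topologicalType.

Lemma cont_pair (f : S -> T) (g : S -> T') x : {for x, continuous f} -> {for x, continuous g} ->
  {for x, continuous (fun y => (f y, g y))}.
Proof. by move=> cf cg; exact: (cvg_pair cf cg). Qed.

Lemma cont_fst (x : T * T') : {for x, continuous fst}. Proof. exact: cvg_fst. Qed.
Lemma cont_snd (x : T * T') : {for x, continuous snd}. Proof. exact: cvg_snd. Qed.

Lemma cont_comp (f : S -> T) (g : T -> T') x : {for x, continuous f} ->
  {for f x, continuous g} -> {for x, continuous (fun y => g (f y))}.
Proof. exact: continuous_comp. Qed.

Lemma cont_near (f : S -> T) x (Q : T -> Prop) : {for x, continuous f} ->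
  (\forall y \near f x, Q y) -> \forall y \near x, Q (f y).
Proof. by move=> cf; exact: cf. Qed.

End PairTopology.

Lemma diff_second (R : realType) (V W W' : normedModType (Cx R)) (g : W -> W') (x : V * W) :
  differentiable g x.2 -> differentiable (fun y : V * W => (y.1, g y.2)) x.
Proof.
have ex (y : W) : differentiable g y -> isd g y ('d g y) by move=> dg; split.
move=> /ex i0; by have [] := isd_pair (isd_fst x) (isd_comp (isd_snd x) i0).
Qed.

Section FiberCharts.
Variables (R : realType) (r : nat) (M : complexManifold R r) (X : complexManifold R (r + r)).
Variable proj : X -> M.
Local Notation K := (Cx R).
Local Notation V := ('rV[K]_r).
Variables (U : set M) (Phi : M * 'rV[K]_r -> X) (P : M -> 'M[K]_(r + r, r)).
Hypothesis TC : torus_chart proj U Phi P.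
Variables (c : chart M 'rV[K]_r).
Hypothesis ac : atlas M c.
Local Notation inv := (chart_inv c).

Definition chart_ok (z : V) := [/\ chart_dom c (inv z), chart_map c (inv z) = z & U (inv z)].

Lemma chart_okP u : chart_dom c u -> U u -> chart_ok (chart_map c u).
Proof. by move=> du Uu; rewrite /chart_ok chart_mapK. Qed.

Lemma chart_ok_near z : chart_ok z -> \forall y \near z, chart_ok y.
Proof.
move=> [dz zE Uz]; have [oU _ _ _] := TC; rewrite -zE.
have n1 := chart_near_invK ac dz.
have n2 := @chart_near_inv R r M c ac _ U dz (open_nbhs_nbhs (conj oU Uz)).
near=> y; have [dy yE] : chart_dom c (inv y) /\ chart_map c (inv y) = y by near: y.
by split=> //; near: y.
Unshelve. all: by end_near. Qed.

Lemma chart_ok_inv_cont z : chart_ok z -> {for z, continuous inv}.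
Proof.
move=> [dz zE _]; have [_ _ _ _ h] := atlas_is_chart ac; apply: h.
by exists (inv z).
Qed.

Definition Phi1 (p : V * V) : X := Phi (inv p.1, p.2).

Lemma proj_Phi1 p : chart_ok p.1 -> proj (Phi1 p) = inv p.1.
Proof.
move=> [_ _ Up]; have [_ _ _ /(_ _ Up)[_ _ hr _ _]] := TC.
by have : (range (fun v => Phi (inv p.1, v))) (Phi1 p) by [exists p.2]; rewrite hr.
Qed.

Lemma Phi1_at p : chart_ok p.1 -> {for p, continuous Phi1} /\
  forall d, atlas X d -> chart_dom d (Phi1 p) -> differentiable (chart_map d \o Phi1) p.
Proof.
move=> okp; have [dp pE Up] := okp; have [_ _ hPhi _] := TC.
have [cPhi dPhi] := hPhi (inv p.1, p.2) (conj Up I); split=> [|d ad dd].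
  have cc : {for p, continuous (fun p : V * V => (inv p.1, p.2))}.
    apply: (@cont_pair _ _ _ (fun p : V * V => inv p.1) snd); last exact: cont_snd.
    by apply: (@cont_comp _ _ _ (fst : V * V -> V) inv p); [exact: cont_fst|exact: chart_ok_inv_cont].
  exact: (@continuous_comp _ _ _ (fun p : V * V => (inv p.1, p.2)) Phi p cc cPhi).
have := dPhi (prod_chart c (Chart setT id id)) d _ ad (conj dp I) dd.
rewrite /= pE -surjective_pairing; apply.
by exists c, (Chart setT id id).
Qed.

Lemma Phi1_hmap p : chart_ok p.1 -> hmap Phi1 p.
Proof.
move=> /chart_ok_near H.
have H' : \forall q \near p, chart_ok q.1 := cont_near (@cont_fst _ _ p) H.
rewrite /hmap; near=> q; apply: Phi1_at; by near: q.
Unshelve. all: by end_near. Qed.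

Local Notation E := ((K^o : normedModType K) * (V * V))%type.
Variables (D : set (K * M)) (lift : K * X -> X).
Hypothesis lact : local_action [set z | D (z.1, proj z.2)] lift.
Hypothesis Dopen : open D.

Definition flow_ok (w : E) := chart_ok w.2.1 /\ D (w.1, inv w.2.1).
Definition Psi (w : E) : X := lift (w.1, Phi1 w.2).

Lemma flow_ok_near w : flow_ok w -> \forall y \near w, flow_ok y.
Proof.
move=> [ow Dw].
have c1 : {for w, continuous (fun w : E => w.2.1)}.
  by apply: (@cont_comp _ _ _ (snd : E -> (V * V)%type) fst w); [exact: cont_snd|exact: cont_fst].
have n1 := cont_near c1 (chart_ok_near ow).
have c2 : {for w, continuous (fun w : E => (w.1 : K, inv w.2.1))}.
  apply: (@cont_pair _ _ _ (fst : E -> K) (fun w : E => inv w.2.1)); first exact: cont_fst.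
  by apply: (@cont_comp _ _ _ (fun w : E => w.2.1) inv w); [exact: c1|exact: chart_ok_inv_cont].
have n2 := cont_near c2 (open_nbhs_nbhs (conj Dopen Dw)).
by near=> y; split; near: y.
Unshelve. all: by end_near. Qed.

Lemma Psi_at w : flow_ok w -> {for w, continuous Psi} /\
  forall d, atlas X d -> chart_dom d (Psi w) -> differentiable (chart_map d \o Psi) w.
Proof.
move=> [ow Dw]; have [_ _ hlift _ _] := lact.
have Dx : D (w.1, proj (Phi1 w.2)) by rewrite proj_Phi1.
have [cl dl] := hlift (w.1, Phi1 w.2) Dx; have [cP dP] := Phi1_at ow; split=> [|d ad dd].
  have cc : {for w, continuous (fun w : E => (w.1 : K, Phi1 w.2))}.
    apply: (@cont_pair _ _ _ (fst : E -> K) (fun w : E => Phi1 w.2)); first exact: cont_fst.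
    by apply: (@cont_comp _ _ _ (snd : E -> (V * V)%type) Phi1 w); [exact: cont_snd|exact: cP].
  exact: (@continuous_comp _ _ _ (fun w : E => (w.1 : K, Phi1 w.2)) lift w cc cl).
pose d0 := dof (Phi1 w.2).
have ad0 : atlas X d0 := dof_atlas _; have dd0 : chart_dom d0 (Phi1 w.2) := dof_dom _.
have D2 := dl (prod_chart (Chart setT id id) d0) d
  (ex_intro _ (Chart setT id id) (ex_intro _ d0 (And3 erefl ad0 erefl))) ad (conj I dd0) dd.
pose fin (y : E) : (K^o : normedModType K) * 'rV[K]_(r + r) := (y.1, chart_map d0 (Phi1 y.2)).
pose fout (y : (K^o : normedModType K) * 'rV[K]_(r + r)) := chart_map d
   (lift (chart_inv (prod_chart (Chart setT (id : K^o -> K^o) id) d0) y)).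
have D1 : differentiable fin w := @diff_second R (K^o) (V * V)%type _ (chart_map d0 \o Phi1) w (dP d0 ad0 dd0).
have D3 : differentiable (fout \o fin) w := @differentiable_comp _ _ _ _ fin fout w D1 D2.
have N : \forall y \near w, chart_dom d0 (Phi1 y.2) :=
  cont_near (@cont_snd _ _ w) (hmap_dom (Phi1_hmap ow) ad0 dd0).
have N' : \forall y \near w, (chart_map d \o Psi) y = (fout \o fin) y + 0.
  by apply: filterS N => y dy; rewrite addr0 /fout /fin /= chart_mapK.
by have [] := diff_near_shift D3 N'.
Qed.

Lemma Psi_hmap w : flow_ok w -> hmap Psi w.
Proof.
move=> /flow_ok_near H; rewrite /hmap; near=> q; apply: Psi_at; by near: q.
Unshelve. all: by end_near. Qed.

End FiberCharts.

Lemma omega_eq (R : realType) r (X : complexManifold R (r + r)) (V : normedModType (Cx R))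
  (L : chart X 'rV[Cx R]_(r + r) -> X -> 'M[Cx R]_(r + r)) (Psi Psi' : V -> X) w h k :
  (\forall y \near w, Psi y = Psi' y) -> hmap Psi' w -> omega L Psi w h k = omega L Psi' w h k.
Proof.
move=> E H; rewrite /omega /om (nbhs_singleton E).
have e l : tv (chart_map (dof (Psi' w))) Psi w l = tv (chart_map (dof (Psi' w))) Psi' w l.
  apply/rowP => j; rewrite !mxE; apply: pd_eq; first by apply: filterS E => y ->.
  exact: (hmap_hol H j (dof_atlas (Psi' w)) (dof_dom (Psi' w))).
by rewrite !e.
Qed.

Lemma hmap_isd (R : realType) r (X : complexManifold R (r + r)) (V : normedModType (Cx R)) (Psi : V -> X) w d :
  hmap Psi w -> atlas X d -> chart_dom d (Psi w) ->
  isd (chart_map d \o Psi) w (tv (chart_map d) Psi w).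
Proof.
move=> H ad dd; have [_ hd] := nbhs_singleton H; have D := hd d ad dd.
by split=> // h; rewrite tvE.
Qed.

Section Special.
Variables (R : realType) (r : nat) (M : complexManifold R r) (X : complexManifold R (r + r)).
Variable proj : X -> M.
Local Notation K := (Cx R).
Local Notation V := ('rV[K]_r).
Local Notation V2 := (V * V)%type.
Local Notation E := ((K^o : normedModType K) * (V * V))%type.
Variables (U : set M) (Phi : M * 'rV[K]_r -> X) (P : M -> 'M[K]_(r + r, r)).
Hypothesis TC : torus_chart proj U Phi P.
Variables (c : chart M 'rV[K]_r).
Hypothesis ac : atlas M c.
Local Notation inv := (chart_inv c).
Variable L : chart X 'rV[K]_(r + r) -> X -> 'M[K]_(r + r).
Hypotheses (hproj : holomorphic_on (atlas X) (atlas M) setT proj).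
Hypotheses (hL : holomorphic_2form L) (cL : closed_2form L) (nL : nondegenerate_2form L)
  (vL : vanishes_on_fibers proj L).
Local Notation Phi1 := (Phi1 Phi c).
Local Notation ok := (chart_ok U c).

Lemma tv_proj p h : ok p.1 -> tv (fun x => chart_map c (proj x)) Phi1 p h = h.1.
Proof.
move=> okp; apply/rowP => j; rewrite mxE.
have N : \forall q \near p, chart_map c (proj (Phi1 q)) 0 j = q.1 0 j.
  have N1 := cont_near (@cont_fst _ _ p) (chart_ok_near TC ac okp).
  by apply: filterS N1 => q okq; rewrite (proj_Phi1 TC okq); have [_ -> _] := okq.
have H : hol (fun q : V2 => q.1 0 j) p.
  by apply: (@hol_dcomp R _ _ fst (fun y : V => y 0 j)); [near=> y; have [] := isd_fst y|exact: hol_entry].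
rewrite (pd_eq h N H).
by rewrite (@pd_isd R _ _ fst (fun y : V => y 0 j) p h _ (isd_fst p)) ?pd_entry //; exact: hol_entry.
Unshelve. all: by end_near. Qed.

Let pjac (d : chart X 'rV[K]_(r + r)) (p : V2) := jacobian ((chart_map c \o proj) \o chart_inv d) (chart_map d (Phi1 p)).

Lemma tv_proj_push d p h : ok p.1 -> atlas X d -> chart_dom d (Phi1 p) ->
  h.1 = tv (chart_map d) Phi1 p h *m pjac d p.
Proof.
move=> okp ad dd; rewrite -(tv_proj h okp).
apply: (@tv_push R r X _ Phi1 p (Phi1_hmap TC ac okp) r (chart_map c \o proj) d h ad dd).
have [_ hp] := hproj (I : setT (Phi1 p)).
by apply: (hp d c ad ac dd); rewrite (proj_Phi1 TC okp); have [] := okp.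
Qed.

Lemma omega_vertical p h k : ok p.1 -> h.1 = 0 -> k.1 = 0 -> omega L Phi1 p h k = 0.
Proof.
move=> okp h1 k1; pose d := dof (Phi1 p).
have ad : atlas X d := dof_atlas _; have dd : chart_dom d (Phi1 p) := dof_dom _.
rewrite /omega /om sesqE -/d (vL ad ac dd) ?mxE //.
- by rewrite (proj_Phi1 TC okp); have [] := okp.
- by apply: (etrans (esym (tv_proj_push h okp ad dd))).
- by apply: (etrans (esym (tv_proj_push k okp ad dd))).
Qed.

Lemma isd_inr (z : V) (v : V) : isd (fun v : V => (z, v) : V2) v (fun y => (0, y)).
Proof. exact: (isd_pair (isd_cst z v) (isd_id v)). Qed.

Lemma tv_inj d p h : ok p.1 -> atlas X d -> chart_dom d (Phi1 p) ->
  tv (chart_map d) Phi1 p h = 0 -> h = 0.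
Proof.
move=> okp ad dd h0; have h1 : h.1 = 0 by rewrite (tv_proj_push h okp ad dd) h0 mul0mx.
case: p okp dd h0 => z v /= okp dd h0; case: h h1 h0 => /= _ y -> h0; congr pair.
have ds : \forall v \near v, isd (fun v : V => (z, v) : V2) v (fun y => (0, y)) by near=> v'; exact: isd_inr.
have hP := Phi1_hmap TC ac (p := (z, v)) okp.
have := @tv_comp R r X _ _ (fun v : V => (z, v) : V2) _ v ds _ (chart_map d) Phi1 y
  (fun j => hmap_hol hP j ad dd).
rewrite h0; have hS := @hmap_comp R r X _ _ (fun v : V => (z, v) : V2) _ v ds Phi1 hP.
have [Dd _] := hmap_isd hS ad dd.
rewrite (tvE y Dd) -jacE => /eqP y0.
have [_ _ Up] := okp; have [_ _ _ /(_ _ Up)[_ _ _ _ /(_ v d ad dd) rf]] := TC.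
have [B hB] := row_freeP rf.
by rewrite -(mulmx1 y) -hB mulmxA; move/eqP: y0 => ->; rewrite mul0mx.
Unshelve. all: by end_near. Qed.

Lemma tv_linear (d : chart X 'rV[K]_(r + r)) p a h k : tv (chart_map d) Phi1 p (a *: h + k) =
  a *: tv (chart_map d) Phi1 p h + tv (chart_map d) Phi1 p k.
Proof. by rewrite tvDr tvZr. Qed.

Lemma omega_nondeg p y : ok p.1 ->
  (forall i, omega L Phi1 p (delta_mx 0 i, 0) (0, y) = 0) -> y = 0.
Proof.
move=> okp H; pose d := dof (Phi1 p).
have ad : atlas X d := dof_atlas _; have dd : chart_dom d (Phi1 p) := dof_dom _.
pose t := tv (chart_map d) Phi1 p.
pose B : 'M[K]_(r + r) := col_mx (\matrix_i t (delta_mx 0 i, 0)) (\matrix_i t (0, delta_mx 0 i)).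
have tsum m (f : 'I_m -> V2) (a : 'I_m -> K) : t (\sum_i a i *: f i) = \sum_i a i *: t (f i).
  rewrite /t; elim/big_rec2: _ => [|i u v _ <-].
    by rewrite -(scale0r (0 : V2)) tvZr scale0r.
  exact: tv_linear.
have BE x : x *m B = t (lsubmx x, rsubmx x).
  rewrite -{1}(hsubmxK x) /B mul_row_col !mulmx_sum_row.
  under eq_bigr do rewrite rowK; under [X in _ + X]eq_bigr do rewrite rowK.
  rewrite -(tsum _ (fun i => (delta_mx 0 i, 0))) -(tsum _ (fun i => (0, delta_mx 0 i))) /t -tvDr.
  congr (tv _ _ _ _).
  have s1 n (f : 'I_n -> V) : \sum_i (f i, 0 : V) = (\sum_i f i, 0).
    by elim/big_rec2: _ => [//|i a b _ ->]; congr pair; rewrite /= add0r.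
  have s2 n (f : 'I_n -> V) : \sum_i (0 : V, f i) = (0, \sum_i f i).
    by elim/big_rec2: _ => [//|i a b _ ->]; congr pair; rewrite /= add0r.
  have z1 (a : K) (x1 : V) : a *: ((x1, 0) : V2) = (a *: x1, 0) by congr pair; rewrite /= scaler0.
  have z2 (a : K) (x1 : V) : a *: ((0, x1) : V2) = (0, a *: x1) by congr pair; rewrite /= scaler0.
  under eq_bigr do rewrite z1; under [X in _ + X]eq_bigr do rewrite z2.
  rewrite s1 s2 -!row_sum_delta; congr pair; rewrite /= ?addr0 ?add0r //.
have Bu : B \in unitmx.
  rewrite -row_free_unit -kermx_eq0; apply/eqP/row_matrixP => i; rewrite row0.
  set x := row i _; have xB : x *m B = 0 by apply/sub_kermxP; exact: row_sub.
  rewrite BE in xB; have [xl xr] := tv_inj okp ad dd xB.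
  by rewrite -(hsubmxK x) xl xr row_mx0.
have Z : B *m L d (Phi1 p) *m (t (0, y))^T = 0.
  apply/colP => i; rewrite [RHS]mxE.
  have -> : (B *m L d (Phi1 p) *m (t (0, y))^T) i 0 = sesq (row i B) (L d (Phi1 p)) (t (0, y)).
    by rewrite sesqE -!row_mul [RHS]mxE.
  have -> : row i B = t (match fintype.split i with inl j => (delta_mx 0 j, 0) | inr j => (0, delta_mx 0 j) end).
    by apply/rowP => j; rewrite mxE /B mxE; case: (fintype.split i) => k; rewrite mxE.
  case: (fintype.split i) => k; first exact: H.
  exact: (@omega_vertical p (0, delta_mx 0 k) (0, y)).
have t0 : t (0, y) = 0.
  have nd := nL ad dd.
  apply: trmx_inj; rewrite trmx0 -(mul1mx (t (0, y))^T) -(mulVmx nd) -mulmxA.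
  rewrite -(mul1mx (L d (Phi1 p) *m _)) -(mulVmx Bu) -(mulmxA _ B) (mulmxA B) Z.
  by rewrite !mulmx0.
by have [] := tv_inj okp ad dd t0.
Qed.

End Special.

(** * The special coordinates *)

Definition lvec (R : realType) r (M : complexManifold R r) (P : M -> 'M[Cx R]_(r + r, r))
    (c : chart M 'rV[Cx R]_r) (N : 'rV[int]_(r + r)) (z : 'rV[Cx R]_r) : 'rV[Cx R]_r :=
  intmx R N *m P (chart_inv c z).

Lemma lin_rV (R : realType) n (l : 'rV[Cx R]_n -> Cx R) y :
  (forall a y y', l (a *: y + y') = a * l y + l y') -> l y = \sum_k y 0 k * l (delta_mx 0 k).
Proof.
move=> H; have l0 : l 0 = 0.
  by have := H 1 0 0; rewrite scaler0 addr0 mul1r => /eqP; rewrite -subr_eq subrr => /eqP.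
rewrite {1}(row_sum_delta y); elim/big_rec2: _ => [|k u v _ <-]; first exact: l0.
exact: H.
Qed.

Section Periods.
Variables (R : realType) (r : nat) (M : complexManifold R r) (X : complexManifold R (r + r)).
Variable proj : X -> M.
Local Notation K := (Cx R).
Local Notation V := ('rV[K]_r).
Local Notation V2 := (V * V)%type.
Local Notation E := ((K^o : normedModType K) * (V * V))%type.
Variables (U : set M) (Phi : M * 'rV[K]_r -> X) (P : M -> 'M[K]_(r + r, r)).
Hypothesis TC : torus_chart proj U Phi P.
Variables (c : chart M 'rV[K]_r).
Hypothesis ac : atlas M c.
Local Notation inv := (chart_inv c).
Variable L : chart X 'rV[K]_(r + r) -> X -> 'M[K]_(r + r).
Hypotheses (hproj : holomorphic_on (atlas X) (atlas M) setT proj).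
Hypotheses (hL : holomorphic_2form L) (cL : closed_2form L) (nL : nondegenerate_2form L)
  (vL : vanishes_on_fibers proj L).
Local Notation Phi1 := (Phi1 Phi c).
Local Notation ok := (chart_ok U c).
Variables (D : set (K * M)) (lift : K * X -> X).
Hypothesis lact : local_action [set z | D (z.1, proj z.2)] lift.
Hypotheses (Dopen : open D) (D1 : forall u, D (1, u)).
Hypothesis sc : forall l x, D (l, proj x) -> scales_2form_at L l (fun y => lift (l, y)) x.
Local Notation Psi := (Psi Phi c lift).
Local Notation fok := (flow_ok U c D).

Let one : K^o := 1.

Lemma lift1 x : lift (1, x) = x.
Proof. by have [_ _ _ h _] := lact. Qed.

Lemma fok1 z v : ok z -> fok (one, (z, v)).
Proof. by move=> okz; split. Qed.

Lemma isd_slice (l : K^o) (p : V2) : isd (fun p : V2 => (l, p) : E) p (fun h => (0, h)).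
Proof. exact: (isd_pair (isd_cst l p) (isd_id p)). Qed.

Lemma omega_slice l p h k : fok (l, p) ->
  omega L (fun p => Psi (l, p)) p h k = omega L Psi (l, p) (0, h) (0, k).
Proof.
move=> ow; have ds : \forall q \near p, isd (fun p : V2 => (l, p) : E) q (fun h => (0, h)).
  by near=> q; exact: isd_slice.
exact: (@omega_comp R r X _ _ (fun p : V2 => (l, p) : E) _ p ds L Psi h k (Psi_hmap TC ac lact Dopen ow)).
Unshelve. all: by end_near. Qed.

Lemma Psi1 p : Psi (1, p) = Phi1 p.
Proof. exact: lift1. Qed.

Lemma omega_Phi1 p h k : ok p.1 -> omega L Phi1 p h k = omega L Psi (one, p) (0, h) (0, k).
Proof.
case: p => z v okp; rewrite -omega_slice; last exact: fok1.
by congr (omega L _ _ _ _); apply/funext => p; rewrite Psi1.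
Qed.

Lemma isd_snd_pair (V1 W1 : normedModType K) (l : V1) (y : W1) : isd (fun y : W1 => (l, y)) y (fun h => (0, h)).
Proof. exact: (isd_pair (isd_cst l y) (isd_id y)). Qed.

Lemma omega_scale l p h k : fok (l, p) ->
  omega L Psi (l, p) (0, h) (0, k) = l * omega L Psi (one, p) (0, h) (0, k).
Proof.
move=> ow; have [/= okp Dl] := ow; rewrite -omega_slice // -omega_Phi1 //.
pose d := dof (Phi1 p); pose d' := dof (Psi (l, p)).
have ad : atlas X d := dof_atlas _; have dd : chart_dom d (Phi1 p) := dof_dom _.
have ad' : atlas X d' := dof_atlas _; have dd' : chart_dom d' (Psi (l, p)) := dof_dom _.
have Dx : D (l, proj (Phi1 p)) by rewrite (proj_Phi1 TC okp).
have dg : differentiable ((fun x => chart_map d' (lift (l, x))) \o chart_inv d) (chart_map d (Phi1 p)).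
  have [_ _ hlift _ _] := lact; have [_ dl] := hlift (l, Phi1 p) Dx.
  have D2 := dl (prod_chart (Chart setT id id) d) d'
    (ex_intro _ (Chart setT id id) (ex_intro _ d (And3 erefl ad erefl))) ad' (conj I dd) dd'.
  have [D3 _] := @isd_snd_pair K^o 'rV[K]_(r + r) l (chart_map d (Phi1 p)).
  exact: (@differentiable_comp _ _ _ _ (fun y => (l : K^o, y)) _ _ D3 D2).
have T v : tv (chart_map d') (fun p => Psi (l, p)) p v =
    tv (chart_map d) Phi1 p v *m jacobian ((fun x => chart_map d' (lift (l, x))) \o chart_inv d) (chart_map d (Phi1 p)).
  exact: (@tv_push R r X _ Phi1 p (Phi1_hmap TC ac okp) _ (fun x => chart_map d' (lift (l, x))) d v ad dd dg).
rewrite /omega /om -/d' -/d !T sesq_mulmx -sesqZ; congr (sesq _ _ _).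
exact: (sc Dx ad ad' dd dd').
Qed.

Section Shift.
Variable N : 'rV[int]_(r + r).
Local Notation n := (lvec P c N).

Lemma P_hol z i j : ok z -> hol (fun z => P (inv z) i j) z.
Proof.
move=> okz; apply: (@hol_coord R V _ _ (fun z => P (inv z))).
have nz := chart_ok_near TC ac okz; have [_ hP _ _] := TC.
near=> y; have [dy yE Uy] : ok y by near: y.
have [_ h] := hP _ Uy; rewrite -yE.
exact: (h c (Chart setT id id) ac erefl dy I).
Unshelve. all: by end_near. Qed.

Lemma n_hol z j : ok z -> hol (fun z => n z 0 j) z.
Proof.
move=> okz; apply: (hol_mulmx (A := fun=> intmx R N)) => a b; last exact: P_hol.
exact: hol_cst.
Qed.

Let dn z h : V := \row_j pd (fun z => n z 0 j) z h.

Let tau (w : E) : E := (w.1, (w.2.1, w.2.2 + n w.2.1)).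
Let dtau (w h : E) : E := (h.1, (h.2.1, h.2.2 + dn w.2.1 h.2.1)).

Lemma isd_tau w : ok w.2.1 -> isd tau w (dtau w).
Proof.
move=> okw; have i1 : isd (fun w : E => w.2.1) w (fun h => h.2.1).
  exact: (isd_comp (isd_snd w) (isd_fst w.2)).
have i2 : isd (fun w : E => w.2.2) w (fun h => h.2.2).
  exact: (isd_comp (isd_snd w) (isd_snd w.2)).
have i3 : isd n w.2.1 (dn w.2.1) by apply: isd_rV => j; exact: n_hol.
exact: (isd_pair (isd_fst w) (isd_pair i1 (isdD i2 (isd_comp i1 i3)))).
Qed.

Lemma Psi_tau w : ok w.2.1 -> Psi (tau w) = Psi w.
Proof.
move=> [_ _ Uw]; rewrite /Psi /Phi1 /=; congr (lift (_, _)).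
have [_ _ _ /(_ _ Uw) hu] := TC.
exact: (unif_shift w.2.2 N hu).
Qed.

(* The translation tau by a period depends on z, so that it shears d_z into d_v:
   this produces the last term of B_per. *)
Lemma omega_tau w h k : fok w -> omega L Psi w h k = omega L Psi (tau w) (dtau w h) (dtau w k).
Proof.
move=> ow; have [okw Dw] := ow.
have nw := flow_ok_near TC ac Dopen ow.
have okt : fok (tau w) by [].
have ds : \forall y \near w, isd tau y (dtau y).
  by apply: filterS nw => y [oky _]; exact: isd_tau.
rewrite -(@omega_comp R r X _ _ tau _ w ds L Psi h k (Psi_hmap TC ac lact Dopen okt)).
apply: omega_eq; first by apply: filterS nw => y [oky _]; rewrite Psi_tau.
exact: (@hmap_comp R r X _ _ tau _ w ds Psi (Psi_hmap TC ac lact Dopen okt)).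
Qed.

Let dtauL z v : dtau (one, (z, v)) (1, (0, 0)) = (1, (0, 0)).
Proof.
congr (_, (_, _)); rewrite /= add0r; apply/rowP => j.
by rewrite mxE pd0r mxE.
Qed.

Let dtauU z v h : dtau (one, (z, v)) (0, (h, 0)) = (0, (h, 0)) + (0, (0, dn z h)).
Proof. by rewrite /dtau /=; congr (_, (_, _)); rewrite /= ?add0r ?addr0. Qed.

Let dtauV z v y : dtau (one, (z, v)) (0, (0, y)) = (0, (0, y)).
Proof.
congr (_, (_, _)); rewrite /= -[RHS]addr0; congr (_ + _); apply/rowP => j.
by rewrite mxE pd0r mxE.
Qed.

Lemma vv0 z v y y' : ok z -> omega L Psi (one, (z, v)) (0, (0, y)) (0, (0, y')) = 0.
Proof.
move=> okz; rewrite -omega_Phi1 //.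
exact: (omega_vertical TC ac hproj vL).
Qed.

Lemma G_per z v h y : ok z -> omega L Psi (one, (z, v)) (0, (h, 0)) (0, (0, y)) =
  omega L Psi (one, (z, v + n z)) (0, (h, 0)) (0, (0, y)).
Proof.
by move=> okz; rewrite omega_tau ?dtauV ?dtauU; [rewrite omegaDl vv0 // addr0|exact: fok1].
Qed.

Lemma X_per z v y : ok z -> omega L Psi (one, (z, v)) (1, (0, 0)) (0, (0, y)) =
  omega L Psi (one, (z, v + n z)) (1, (0, 0)) (0, (0, y)).
Proof. by move=> okz; rewrite omega_tau ?dtauV ?dtauL //; exact: fok1. Qed.

Lemma B_per z v h : ok z -> omega L Psi (one, (z, v)) (1, (0, 0)) (0, (h, 0)) =
  omega L Psi (one, (z, v + n z)) (1, (0, 0)) (0, (h, 0)) +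
  omega L Psi (one, (z, v + n z)) (1, (0, 0)) (0, (0, dn z h)).
Proof. by move=> okz; rewrite omega_tau ?dtauU ?dtauL ?omegaDr //; exact: fok1. Qed.

End Shift.

Let F h k (w : E) := omega L Psi w h k.
Let hF h k w : fok w -> hol (F h k) w.
Proof. by move=> ow; apply: omega_hol => //; exact: (Psi_hmap TC ac lact Dopen). Qed.

Let isdV (z v : V) : isd (fun v : V => (one, (z, v)) : E) v (fun y => (0, (0, y))).
Proof. exact: (isd_pair (isd_cst one v) (isd_pair (isd_cst z v) (isd_id v))). Qed.

Let isdU (z v : V) : isd (fun z : V => (one, (z, v)) : E) z (fun h => (0, (h, 0))).
Proof. exact: (isd_pair (isd_cst one z) (isd_pair (isd_id z) (isd_cst v z))). Qed.

Let isdL (l : K^o) (p : V2) : isd (fun l : K^o => (l, p) : E) l (fun a => (a, 0)).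
Proof. exact: (isd_pair (isd_id l) (isd_cst p l)). Qed.

Lemma hol_sliceV (f : E -> K) z v : hol f (one, (z, v)) -> hol (fun v : V => f (one, (z, v))) v.
Proof. by apply: (@hol_dcomp R V E); near=> y; have [] := isdV z y. Unshelve. all: by end_near. Qed.

Lemma hol_sliceU (f : E -> K) z v : hol f (one, (z, v)) -> hol (fun z : V => f (one, (z, v))) z.
Proof. by apply: (@hol_dcomp R V E); near=> y; have [] := isdU y v. Unshelve. all: by end_near. Qed.

Lemma fiber_const (f : V -> K) z : ok z -> (forall v, hol f v) ->
  (forall v (N : 'rV[int]_(r + r)), f (v + lvec P c N z) = f v) -> forall v, f v = f 0.
Proof.
move=> [_ _ Uz] hf pf v; have [_ _ _ /(_ _ Uz)[hP _ _ _ _]] := TC.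
have cf : continuous f by move=> x; exact: hol_cont.
have [B hB] := periodic_bounded hP cf pf.
exact: (hol_liouville hf hB).
Qed.

Lemma G_const z v h y : ok z -> F (0, (h, 0)) (0, (0, y)) (one, (z, v)) = F (0, (h, 0)) (0, (0, y)) (one, (z, 0)).
Proof.
move=> okz; apply: (fiber_const (f := fun v => F (0, (h, 0)) (0, (0, y)) (one, (z, v))) okz) => [v'|v' N].
  by apply: hol_sliceV; apply: hF; exact: fok1.
by rewrite /F [RHS](G_per N).
Qed.

Lemma X_const z v y : ok z -> F (1, (0, 0)) (0, (0, y)) (one, (z, v)) = F (1, (0, 0)) (0, (0, y)) (one, (z, 0)).
Proof.
move=> okz; apply: (fiber_const (f := fun v => F (1, (0, 0)) (0, (0, y)) (one, (z, v))) okz) => [v'|v' N].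
  by apply: hol_sliceV; apply: hF; exact: fok1.
by rewrite /F [RHS](X_per N).
Qed.

Lemma scale_pd z v h y : ok z -> pd (F (0, (h, 0)) (0, (0, y))) (one, (z, v)) (1, (0, 0)) =
  F (0, (h, 0)) (0, (0, y)) (one, (z, v)).
Proof.
move=> okz; have ow := fok1 v okz; have hf := hF (0, (h, 0)) (0, (0, y)) ow.
have n1 : \forall l \near one, fok (l, (z, v)).
  have cl : {for one, continuous (fun l : K^o => (l, (z, v)) : E)}.
    apply: (@cont_pair _ _ _ (fun l : K^o => l) (fun=> (z, v))); first exact: cvg_id.
    exact: (@cst_continuous K^o V2 (z, v) one).
  exact: cont_near cl (flow_ok_near TC ac Dopen ow).
have hid : hol (fun l : K^o => l : K) one by apply/holE; near=> l; exact: ex_diff.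
pose C := F (0, (h, 0)) (0, (0, y)) (one, (z, v)).
have N : \forall l \near one, F (0, (h, 0)) (0, (0, y)) (l, (z, v)) = l * C.
  by apply: filterS n1 => l ol; rewrite /F (omega_scale (h, 0) (0, y) ol).
have E1 := @pd_isd R K^o E (fun l => (l, (z, v))) (F (0, (h, 0)) (0, (0, y))) one 1 _ (isdL one (z, v)) hf.
apply: (etrans (esym E1)); rewrite (pd_eq _ N (holM hid (hol_cst C one))).
rewrite (pdM _ hid (hol_cst C one)) pd_cst mulr0 addr0 pdE diff_val mul1r //.
Unshelve. all: by end_near. Qed.

Lemma B_pd z v h y : ok z -> pd (fun v => F (1, (0, 0)) (0, (h, 0)) (one, (z, v))) v y =
  pd (fun z => F (1, (0, 0)) (0, (0, y)) (one, (z, 0))) z h - F (0, (h, 0)) (0, (0, y)) (one, (z, 0)).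
Proof.
move=> okz; have ow := fok1 v okz; have hP := Psi_hmap TC ac lact Dopen ow.
rewrite (pd_isd (f := F (1, (0, 0)) (0, (h, 0))) y (isdV z v) (hF _ _ ow)).
have := omega_closed hL hP cL (1, (0, 0)) (0, (h, 0)) (0, (0, y)).
have := scale_pd v h y okz; rewrite (G_const v h y okz) /F => ->.
have hXv := hol_sliceU (hF (1, (0, 0)) (0, (0, y)) ow).
have N1 : \forall z' \near z, F (0, (0, y)) (1, (0, 0)) (one, (z', v)) = - F (1, (0, 0)) (0, (0, y)) (one, (z', v)).
  near=> z'; have okz' : ok z' by near: z'; exact: (chart_ok_near TC ac okz).
  exact: (omega_asym hL (Psi_hmap TC ac lact Dopen (fok1 v okz'))).
have N2 : \forall z' \near z, F (1, (0, 0)) (0, (0, y)) (one, (z', 0)) = F (1, (0, 0)) (0, (0, y)) (one, (z', v)).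
  near=> z'; have okz' : ok z' by near: z'; exact: (chart_ok_near TC ac okz).
  exact: (esym (X_const v y okz')).
have E3 := pd_isd (f := F (0, (0, y)) (1, (0, 0))) h (isdU z v) (hF _ _ ow).
rewrite -[X in _ + X = 0]E3 (pd_eq h N1 (holN hXv)) pdN // (pd_eq h N2 hXv).
move=> /eqP; rewrite subr_eq0 addrC => /eqP <-.
by rewrite addrC addrK.
Unshelve. all: by end_near. Qed.

(* The blocks xi and B of the header. *)
Definition liouville_form z : V := \row_k F (1, (0, 0)) (0, (0, delta_mx 0 k)) (one, (z, 0)).
Definition form_block z : 'M[K]_r := \matrix_(i, k) F (0, (delta_mx 0 i, 0)) (0, (0, delta_mx 0 k)) (one, (z, 0)).


Let eVlin a y y' : (0, (0, a *: y + y')) = a *: (0, (0, y)) + (0, (0, y')) :> E.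
Proof. by congr (_, (_, _)); rewrite /= ?scaler0 ?addr0. Qed.

Lemma X_lin z y : F (1, (0, 0)) (0, (0, y)) (one, (z, 0)) = \sum_k y 0 k * liouville_form z 0 k.
Proof.
apply: (etrans (lin_rV (l := fun y => F (1, (0, 0)) (0, (0, y)) (one, (z, 0))) y _)) => [a y1 y2|].
  by rewrite /F eVlin omegaDr omegaZr.
by apply: eq_bigr => k _; rewrite mxE.
Qed.

Lemma G_lin z i y : F (0, (delta_mx 0 i, 0)) (0, (0, y)) (one, (z, 0)) = \sum_k y 0 k * form_block z i k.
Proof.
apply: (etrans (lin_rV (l := fun y => F (0, (delta_mx 0 i, 0)) (0, (0, y)) (one, (z, 0))) y _)) => [a y1 y2|].
  by rewrite /F eVlin omegaDr omegaZr.
by apply: eq_bigr => k _; rewrite mxE.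
Qed.

Lemma liouville_hol z k : ok z -> hol (fun z => liouville_form z 0 k) z.
Proof.
move=> okz; apply: (hol_eq _ (hol_sliceU (hF (1, (0, 0)) (0, (0, delta_mx 0 k)) (fok1 0 okz)))).
by near=> y; rewrite mxE.
Unshelve. all: by end_near. Qed.

Lemma special_periods z N i : ok z ->
  pd (fun z => (liouville_form z *m (lvec P c N z)^T) 0 0) z (delta_mx 0 i) =
  (form_block z *m (lvec P c N z)^T) i 0.
Proof.
move=> okz; have hxi k := liouville_hol k okz; have hn k := n_hol N k okz.
pose ck k := pd (fun z => liouville_form z 0 k) z (delta_mx 0 i) - form_block z i k.
pose b v := F (1, (0, 0)) (0, (delta_mx 0 i, 0)) (one, (z, v)).
have hb v : hol b v by apply: hol_sliceV; apply: hF; exact: fok1.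
have bpd v y : pd b v y = \sum_k y 0 k * ck k.
  rewrite /b B_pd // G_lin.
  have hz k := holZ (y 0 k) (hxi k).
  have N1 : \forall z' \near z, F (1, (0, 0)) (0, (0, y)) (one, (z', 0)) = \sum_k y 0 k * liouville_form z' 0 k.
    by near=> z'; exact: X_lin.
  rewrite (pd_eq _ N1 (hol_sum _ hz)) (pd_sum _ _ hz) -sumrB; apply: eq_bigr => k _.
  by rewrite pdZ // /ck mulrBr.
have hl v : hol (fun v : V => \sum_k v 0 k * ck k) v.
  by apply: hol_sum => k; apply: holM; [exact: hol_entry|exact: hol_cst].
have lpd v y : pd (fun v : V => \sum_k v 0 k * ck k) v y = \sum_k y 0 k * ck k.
  have hz k := holM (hol_entry 0 k v) (hol_cst (ck k) v).
  rewrite (pd_sum _ _ hz); apply: eq_bigr => k _.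
  by rewrite (pdM _ (hol_entry 0 k v) (hol_cst (ck k) v)) pd_entry pd_cst mulr0 addr0.
have := pd0_const (fun v => holB (hb v) (hl v)) _ (lvec P c N z).
have H0 v h : pd (fun v => b v - \sum_k v 0 k * ck k) v h = 0 by rewrite pdB // bpd lpd subrr.
move=> /(_ H0); rewrite [X in _ = _ - X]big1 ?subr0 => [bn|k _]; last by rewrite mxE mul0r.
have := B_per N 0 (delta_mx 0 i) okz; rewrite add0r => B.
pose d : V := \row_j pd (fun z => lvec P c N z 0 j) z (delta_mx 0 i).
pose S := \sum_k d 0 k * liouville_form z 0 k.
have SE : S = - \sum_k lvec P c N z 0 k * ck k.
  have E0 : b 0 = b (lvec P c N z) + S.
    apply: (etrans B); congr (_ + _); apply: (etrans (X_const _ d okz)); exact: X_lin.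
  by apply: (addrI (b (lvec P c N z))); rewrite -E0 -bn.
have E1 : \forall z' \near z, (liouville_form z' *m (lvec P c N z')^T) 0 0 = \sum_k liouville_form z' 0 k * lvec P c N z' 0 k.
  by near=> z'; rewrite mxE; apply: eq_bigr => k _; rewrite [X in _ * X]mxE.
have hz k := holM (hxi k) (hn k).
rewrite (pd_eq _ E1 (hol_sum _ hz)) (pd_sum _ _ hz) mxE.
under eq_bigr => k _ do rewrite (pdM _ (hxi k) (hn k)).
rewrite big_split /=.
have -> : \sum_k liouville_form z 0 k * pd (fun z => lvec P c N z 0 k) z (delta_mx 0 i) = S.
  by apply: eq_bigr => k _; rewrite [d 0 k]mxE mulrC.
rewrite SE -sumrB; apply: eq_bigr => k _; rewrite [X in _ = _ * X]mxE /ck.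
by rewrite [X in X - _]mulrC -mulrBr opprB addrC subrK mulrC.
Unshelve. all: by end_near. Qed.

Lemma form_block_inj z (y : V) : ok z -> form_block z *m y^T = 0 -> y = 0.
Proof.
move=> okz H; apply: (omega_nondeg TC ac hproj nL vL (p := (z, 0)) okz) => i.
rewrite omega_Phi1 //; apply: (etrans (G_lin z i y)).
have E0 : (form_block z *m y^T) i 0 = 0 by rewrite H mxE.
apply: (etrans _ E0); rewrite [RHS]mxE.
by apply: eq_bigr => k _; rewrite [X in _ = _ * X]mxE mulrC.
Qed.

End Periods.

Lemma liouville_potential (R : realType) (r : nat) (G : SKGeometry R r) (U : set (base G)) Phi P
    (c : chart (base G) 'rV[Cx R]_r) :
  scale_invariant G -> torus_chart (@Defs.proj R r G) U Phi P -> atlas (base G) c ->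
  exists (xi : 'rV[Cx R]_r -> 'rV[Cx R]_r) (B : 'rV[Cx R]_r -> 'M[Cx R]_r),
  forall z, chart_ok U c z ->
    [/\ forall k, hol (fun z => xi z 0 k) z,
        forall y : 'rV_r, B z *m y^T = 0 -> y = 0
      & forall N i, pd (fun z => (xi z *m (lvec P c N z)^T) 0 0) z (delta_mx 0 i) =
          (B z *m (lvec P c N z)^T) i 0].
Proof.
move=> [D [act [lift [aact _ lact _ sc]]]] TC ac.
have [Dopen _] : open D /\ (forall l u, D (l, u) -> l != 0) by have [] := aact.
have D1 u : D (1, u).
  have [_ /(_ u)[W [e [_ Wu e0 H]]] _ _ _] := aact; apply: H => //.
  by rewrite subrr normr0 -{1}(ofReal0 R) ltr_ofReal.
have [hproj _] := sk_torus_family G.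
have hL := sk_form_holomorphic G; have cL := @sk_form_closed _ _ G.
exists (liouville_form Phi c (Defs.form G) lift), (form_block Phi c (Defs.form G) lift) => z okz; split.
- by move=> k; exact: (liouville_hol TC ac hL lact Dopen D1).
- by move=> y; exact: (form_block_inj TC ac hproj (@sk_form_nondegenerate _ _ G) (@sk_form_fibers _ _ G) lact Dopen D1).
- by move=> N i; exact: (special_periods TC ac hproj hL cL (@sk_form_fibers _ _ G) lact Dopen D1 sc).
Qed.

(** * Baire's theorem and the identity theorem *)

Section Baire.
Variables (R : realType) (n : nat).
Local Notation K := (Cx R).
Local Notation V := 'rV[K]_n.

Let P1 : 'M[K]_(n + n, n) := col_mx 1%:M (cpx 0 1 : K)%:M.

Let realify_P1 : realify P1 = 1%:M.
Proof.
rewrite /realify /P1 !map_col_mx -block_mxEh [RHS]scalar_mx_block.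
congr block_mx; apply/matrixP => i j; rewrite !mxE; case: (i == j); rewrite /= ?mulr1n ?mulr0n ?cpx_Re ?cpx_Im //; by ring.
Qed.

Let phi (c : 'rV[R]_(n + n)) : V := cmx c *m P1.

Let realify_phi c : realify (phi c) = c.
Proof. by rewrite /phi realifyM realify_P1 mulmx1. Qed.

Let phi_realify v : phi (realify v) = v.
Proof. by apply: realify_inj; rewrite realify_phi. Qed.

Let phi_cont : continuous phi. Proof. exact: cmx_continuous. Qed.

Let phi_near c (Q Q' : _ -> Prop) : (\forall v \near phi c, Q v) -> (forall c', Q (phi c') -> Q' c') ->
  nbhs c Q'.
Proof. by move=> H imp; apply: (@filterS _ _ (nbhs_filter c) _ _ _ (phi_cont H)) => c' /imp. Qed.

Let realify_near (v : V) (Q : 'rV[R]_(n + n) -> Prop) : (\forall c \near realify v, Q c) ->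
  \forall w \near v, Q (realify w).
Proof.
move=> /nbhs_ballP[e /= e0 he]; apply/nbhs_rnP; exists e => // w hw; apply: he; split=> // i j.
rewrite /ball /= ord1 !mxE; case: (fintype.split j) => k; rewrite !mxE distrC.
  have <- : complex.Re ((w - v) 0 k) = complex.Re (w 0 k) - complex.Re (v 0 k) by rewrite !mxE raddfB.
  by apply: le_lt_trans (rn_Re _) _; apply: le_lt_trans (rn_mx_le _ _ _) hw.
have <- : complex.Im ((w - v) 0 k) = complex.Im (w 0 k) - complex.Im (v 0 k) by rewrite !mxE raddfB.
by apply: le_lt_trans (rn_Im _) _; apply: le_lt_trans (rn_mx_le _ _ _) hw.
Qed.

Lemma baire_rV (z0 : V) (e : R) (I : countType) (A : I -> set V) : 0 < e ->
  (forall i x, rn (x - z0) < e -> ~ A i x -> \forall y \near x, ~ A i y) ->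
  (forall x, rn (x - z0) < e -> exists i, A i x) ->
  exists i x, rn (x - z0) < e /\ \forall y \near x, A i y.
Proof.
move=> e0 cA cov; apply: contrapT => H.
have e2 : 0 < e / 2 by rewrite divr_gt0.
have e2e : e / 2 < e by rewrite ltr_pdivrMr // ltr_pMr // ltr1n.
pose O i : set 'rV[R]_(n + n) := [set c | ~ (rn (phi c - z0) <= e / 2 /\ A i (phi c))].
have oO i : open (O i).
  rewrite openE => c Oc.
  have [h|h] := ltP (e / 2) (rn (phi c - z0)).
    have d0 : 0 < rn (phi c - z0) - e / 2 by rewrite subr_gt0.
    have N : \forall y \near phi c, e / 2 < rn (y - z0).
      apply/nbhs_rnP; exists (rn (phi c - z0) - e / 2) => // y hy.
      have := rn_tri (phi c) y z0; rewrite (rn_distC (phi c) y); move: hy; clear.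
      by move: (rn _) (rn _) (rn _) => a b d; lra.
    by apply: (phi_near N) => c' /= hy [/(lt_le_trans hy)]; rewrite ltxx.
  have nA : ~ A i (phi c) by move=> a; apply: Oc; split.
  by apply: (phi_near (cA i _ (le_lt_trans h e2e) nA)) => c' /= hy [_ /hy].
pose F k := if unpickle k is Some i then O i else setT.
have odF : forall k, open (F k) /\ dense (F k).
  move=> k; rewrite /F; case: (unpickle k) => [i|]; last first.
    by split; [exact: openT|move=> W W0 _; rewrite setIT].
  split=> // W W0 oW; apply: contrapT => WO; case: W0 => c0 Wc0.
  have WA c : W c -> rn (phi c - z0) <= e / 2 /\ A i (phi c).
    by move=> Wc; apply: contrapT => h; apply: WO; exists c.
  apply: H; exists i, (phi c0); split; first by apply: le_lt_trans e2e; have [] := WA _ Wc0.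
  have N : \forall y \near phi c0, W (realify y).
    by apply: realify_near; rewrite realify_phi; exact: open_nbhs_nbhs.
  by near=> y; have [|_] := WA (realify y); [near: y|rewrite phi_realify].
pose T : completeNormedModType R := HB.pack 'rV[R]_(n + n)
  (Complete.on 'rV[R]_(n + n)) (NormedModule.on 'rV[R]_(n + n)).
have dF : dense (\bigcap_i F i) := @Baire R T F odF.
pose W : set 'rV[R]_(n + n) := [set c | rn (phi c - z0) < e / 2].
have oW : open W.
  rewrite openE => c Wc.
  have N : \forall y \near phi c, rn (y - z0) < e / 2.
    apply/nbhs_rnP; exists (e / 2 - rn (phi c - z0)); first by rewrite subr_gt0.
    move=> y; have := rn_tri y (phi c) z0; clear.
    by move: (rn _) (rn _) (rn _) => a b d; lra.
  exact: (phi_near N).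
have W0 : W !=set0 by exists (realify z0); rewrite /W /= phi_realify subrr rn0.
clear T; have [c [Wc Fc]] := dF W W0 oW.
have [|i Ai] := cov (phi c); first exact: lt_trans e2e.
have := Fc (pickle i) Logic.I; rewrite /F pickleK; apply; split=> //; exact: ltW.
Unshelve. all: by end_near. Qed.

End Baire.

Section Identity.
Variables (R : realType) (V : normedModType (Cx R)).
Local Notation K := (Cx R).
Implicit Types f : V -> K.

Lemma identity_local f x : hol f x ->
  \forall x' \near x, (\forall y \near x', f y = 0) -> \forall y \near x, f y = 0.
Proof.
move=> /holE df; have [s [M [s0 H]]] := dball_near df (ltr0Sn _ 3 : 0 < 4 :> R).
apply/nbhs_rnP; exists (s / 4) => [|x' hx' h]; first by rewrite divr_gt0.
have H' : dball f x' (2 * s) M by apply: dball_sub H _; lra.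
apply/nbhs_rnP; exists (s / 4) => [|y hy]; first by rewrite divr_gt0.
apply: (identity_ball s0 H' h); have := rn_tri y x x'; rewrite (rn_distC x).
move: hx' hy s0; clear; move: (rn _) (rn _) (rn _) => a b d; lra.
Qed.

Lemma identity_segment f z2 z1 :
  (forall t : R, 0 <= t <= 1 -> hol f (z2 + ofReal t *: (z1 - z2))) ->
  (\forall y \near z2, f y = 0) -> \forall y \near z1, f y = 0.
Proof.
move=> hf H; pose l (t : R) : V := z2 + ofReal t *: (z1 - z2).
have lc : continuous l.
  move=> t A /nbhs_rnP[e e0 he]; have p : 0 < 1 + rn (z1 - z2) by have := rn_ge0 (z1 - z2); lra.
  apply/nbhs_normP; exists (e / (1 + rn (z1 - z2))) => /=; first exact: divr_gt0.
  move=> s /=; rewrite ltr_pdivlMr // => hs; apply: he.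
  rewrite /l opprD addrACA subrr add0r -scalerBl -ofRealB rnZ rn_ofReal distrC; apply: le_lt_trans hs.
  by rewrite ler_wpM2l // lerDr.
have -> : z1 = l 1 by rewrite /l ofReal1 scale1r subrKC.
apply: (@connected_ind _ `[(0 : R), 1]%classic (fun t => \forall y \near l t, f y = 0)).
- exact: segment_connected.
- by exists 0; rewrite /= ?in_itv /= ?lexx ?ler01 // /l ofReal0 scale0r addr0.
- by move=> t _ /nbhs_interior/(lc t) h; near=> s => _; near: s; exact: h.
- move=> t; rewrite /= in_itv => /hf/identity_local/(lc t) h nt; near=> s => _ hs; apply: nt.
  by move: hs; near: s; exact: h.
- by rewrite /= in_itv /= ler01 lexx.
Unshelve. all: by end_near. Qed.

End Identity.

(** * Constancy of the lattice up to linear change *)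

Lemma near_all2 (T : topologicalType) (x : T) (I J : finType) (Q : I -> J -> T -> Prop) :
  (forall i j, \forall y \near x, Q i j y) -> \forall y \near x, forall i j, Q i j y.
Proof. by move=> H; apply: filter_forall => i; apply: filter_forall => j; exact: H. Qed.

Section Constancy.
Variables (R : realType) (r : nat) (M : complexManifold R r) (X : complexManifold R (r + r)).
Variable proj : X -> M.
Local Notation K := (Cx R).
Local Notation V := ('rV[K]_r).

Lemma unif_lattice_sub u p P p' P' (Q : 'M[K]_(r + r, r)) : uniformizes proj u p P ->
  uniformizes proj u p' P' -> (P^T <= Q^T)%MS ->
  exists N : 'M[int]_(r + r), (P'^T <= (intmx R N *m Q)^T)%MS.
Proof.
move=> hp hp' /submxP[C PE]; have [F [v0 [N [uF _ PF]]]] := unif_unique hp hp'.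
exists N; have -> : P' = intmx R N *m P *m invmx F by rewrite -PF mulmxK.
apply/submxP; exists ((invmx F)^T *m C).
by rewrite trmx_mul trmx_mul PE !trmx_mul !mulmxA.
Qed.

Definition weakly_constant (u : M) : Prop := exists U Phi P, [/\ torus_chart proj U Phi P, U u
  & exists Q : 'M[K]_(r + r, r), \forall w \near u, ((P w)^T <= Q^T)%MS].

Lemma weakly_constant_near u : weakly_constant u -> \forall w \near u, weakly_constant w.
Proof.
move=> [U [Phi [P [TC Uu [Q /nbhs_interior hQ]]]]]; have [oU _ _ _] := TC.
have nU := open_nbhs_nbhs (conj oU Uu).
by near=> w; exists U, Phi, P; split=> //; [near: w|exists Q; near: w].
Unshelve. all: by end_near. Qed.

Section Chart.
Variables (U : set M) (Phi : M * 'rV[K]_r -> X) (P : M -> 'M[K]_(r + r, r)).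
Hypothesis TC : torus_chart proj U Phi P.
Variables (c : chart M 'rV[K]_r).
Hypothesis ac : atlas M c.
Local Notation inv := (chart_inv c).
Local Notation ok := (chart_ok U c).

Lemma cokernel_hol m (C : 'M[K]_(r + r, m)) z i j : ok z ->
  hol (fun z => ((P (inv z))^T *m C) i j) z.
Proof.
move=> okz; apply: (hol_mulmx (A := fun z => (P (inv z))^T) (B := fun=> C)) => a b; last exact: hol_cst.
apply: (hol_eq _ (P_hol TC ac b a okz)).
by near=> y; rewrite mxE.
Unshelve. all: by end_near. Qed.

Lemma submx_closed (Q : 'M[K]_(r + r, r)) z : ok z -> ~ ((P (inv z))^T <= Q^T)%MS ->
  \forall y \near z, ~ ((P (inv y))^T <= Q^T)%MS.
Proof.
move=> okz /negP; rewrite submxE => nz.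
have [i [j nij]] : exists i j, ((P (inv z))^T *m cokermx Q^T) i j <> 0.
  apply: contrapT => h; case/eqP: nz; apply/matrixP => i j; rewrite [RHS]mxE.
  by apply: contrapT => h'; apply: h; exists i, j.
have hc := cokernel_hol (cokermx Q^T) i j okz.
have N := near_neq (@norm_hausdorff _ _) (hol_cont hc) (hol_cont (hol_cst 0 z)) nij.
near=> y; apply/negP; rewrite submxE; apply/eqP => /matrixP/(_ i j).
by rewrite [RHS]mxE; near: y.
Unshelve. all: by end_near. Qed.

Lemma submx_identity (Q : 'M[K]_(r + r, r)) (z1 z2 : V) (d : R) :
  (forall z, rn (z - z1) < d -> ok z) -> rn (z2 - z1) < d ->
  (\forall y \near z2, ((P (inv y))^T <= Q^T)%MS) -> \forall y \near z1, ((P (inv y))^T <= Q^T)%MS.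
Proof.
move=> okd hz2 H.
have seg (t : R) : 0 <= t <= 1 -> ok (z2 + ofReal t *: (z1 - z2)).
  move=> /andP[t0 t1]; apply: okd.
  have -> : z2 + ofReal t *: (z1 - z2) - z1 = ofReal (1 - t) *: (z2 - z1).
    by rewrite ofRealB ofReal1 scalerBl scale1r addrAC -(opprB z2 z1) scalerN.
  rewrite rnZ rn_ofReal ger0_norm ?subr_ge0 //; apply: le_lt_trans hz2.
  by rewrite ler_piMl ?rn_ge0 // gerBl.
have E i j : \forall y \near z1, ((P (inv y))^T *m cokermx Q^T) i j = 0.
  apply: (@identity_segment R V _ z2) => [t /seg|]; first exact: cokernel_hol.
  by near=> y; have : ((P (inv y))^T <= Q^T)%MS by [near: y]; rewrite submxE => /eqP ->; rewrite mxE.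
near=> y; have Ey : forall i j, ((P (inv y))^T *m cokermx Q^T) i j = 0 by near: y; exact: (near_all2 E).
by rewrite submxE; apply/eqP/matrixP => i j; rewrite [RHS]mxE.
Unshelve. all: by end_near. Qed.

End Chart.

Lemma weak_propagate U Phi P u1 : torus_chart proj U Phi P -> U u1 ->
  (forall Q : M -> Prop, (\forall u \near u1, Q u) -> exists2 u2, Q u2 & weakly_constant u2) ->
  exists Q : 'M[K]_(r + r, r), \forall w \near u1, ((P w)^T <= Q^T)%MS.
Proof.
move=> TC Uu1 acc; have [c ac dc] := atlas_cover u1; pose inv := chart_inv c.
have okz1 := chart_okP ac dc Uu1; pose z1 := chart_map c u1.
have /nbhs_rnP[d d0 hd] := chart_ok_near TC ac okz1.
have Nd : \forall z \near z1, rn (z - z1) < d by apply/nbhs_rnP; exists d.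
have N1 := chart_near_map ac dc Nd; have [oU _ _ _] := TC.
have N2 := chart_dom_near ac dc; have N3 := open_nbhs_nbhs (conj oU Uu1).
have [u2 [[h2 d2] U2u] [U2 [Phi2 [P2 [TC2 Uu2 [Q2 hQ2]]]]]] :=
  acc _ (@filterI _ _ (nbhs_filter u1) _ _ (@filterI _ _ (nbhs_filter u1) _ _ N1 N2) N3).
pose z2 := chart_map c u2; have okz2 := chart_okP ac d2 U2u.
have [oU2 _ _ _] := TC2; have N4 := open_nbhs_nbhs (conj oU2 Uu2).
have N5 := chart_near_inv ac d2 (@filterI _ _ (nbhs_filter u2) _ _ N4 hQ2).
have Nd2 : \forall z \near z2, rn (z - z1) < d.
  apply/nbhs_rnP; exists (d - rn (z2 - z1)) => [|z]; first by rewrite subr_gt0.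
  have := rn_tri z z2 z1; clear; move: (rn _) (rn _) (rn _) => a b e; lra.
have /nbhs_rnP[e e0 he] := @filterI _ _ (nbhs_filter z2) _ _ Nd2 N5.
have okd : forall z, rn (z - z1) < d -> chart_ok U c z := hd.
pose A (N : 'M[int]_(r + r)) : set V := [set z | ((P (inv z))^T <= (intmx R N *m Q2)^T)%MS].
have [||N [z3 [hz3 hA]]] := @baire_rV R r z2 e _ A e0.
- move=> N x /he[/okd okx _]; exact: (submx_closed TC ac okx).
- move=> x /he[/okd okx [U2x hx]]; have [_ _ Ux] := okx.
  have [_ _ _ /(_ _ Ux) hp'] := TC; have [_ _ _ /(_ _ U2x) hp] := TC2.
  exact: (unif_lattice_sub hp hp' hx).
have [hz3d _] := he _ hz3.
exists (intmx R N *m Q2); apply: (chart_near_pull ac dc).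
exact: (submx_identity TC ac okd hz3d hA).
Qed.

Lemma weak_all : connected [set: M] -> torus_family proj -> (exists u, weakly_constant u) ->
  forall U Phi P u, torus_chart proj U Phi P -> U u ->
  exists Q : 'M[K]_(r + r, r), \forall w \near u, ((P w)^T <= Q^T)%MS.
Proof.
move=> cM [_ tf] [u0 wu0].
have W u : weakly_constant u.
  apply: (@connected_ind _ setT weakly_constant cM) => //; first by exists u0.
  - by move=> x _ /weakly_constant_near; apply: filterS.
  - move=> x _ nw; apply: contrapT => H; apply: nw.
    have [U [Phi [P [Ux TC]]]] := tf x; exists U, Phi, P; split=> //.
    apply: (weak_propagate TC Ux) => Q hQ; apply: contrapT => H2; apply: H.
    by apply: filterS hQ => y Qy _ wy; apply: H2; exists y.
move=> U Phi P u TC Uu; apply: (weak_propagate TC Uu) => Q /nbhs_singleton Qu.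
by exists u.
Qed.

End Constancy.

Lemma ofReal_real (R : realType) (x : R) : ofReal x \is Num.real.
Proof. by rewrite realE -(ofReal0 R) !ler_ofReal -realE num_real. Qed.

Lemma intmx_unit (R : realType) r (Q P : 'M[Cx R]_(r + r, r)) (F : 'M[Cx R]_r) (N : 'M[int]_(r + r)) :
  is_lattice_basis Q -> F \in unitmx -> Q *m F = intmx R N *m P -> intmx R N \in unitmx.
Proof.
move=> hQ uF E; pose NR : 'M[R]_(r + r) := map_mx intr N.
have uR : NR \in unitmx.
  rewrite -row_free_unit -kermx_eq0; apply/eqP/row_matrixP => i; rewrite row0.
  set x := row i _; have xN : x *m NR = 0 by apply/sub_kermxP; exact: row_sub.
  have cx : cmx x *m intmx R N = 0.
    apply/rowP => j; rewrite intmx_cmx mxE mxE.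
    have := congr1 (fun A : 'rV[R]_(r + r) => ofReal (A 0 j)) xN.
    rewrite !mxE ofReal0 (big_morph _ (@ofRealD R) (ofReal0 R)) => E0; rewrite -[RHS]E0.
    by apply: eq_bigr => k _; rewrite ofRealM !mxE.
  have cQ : cmx x *m Q = 0.
    by rewrite -(mulmxK uF (cmx x *m Q)) -(mulmxA (cmx x)) E mulmxA cx !mul0mx.
  have c0 : cmx x = 0 by apply: hQ cQ => a; rewrite mxE; exact: ofReal_real.
  apply/rowP => j; rewrite [RHS]mxE; apply: (@ofReal_inj R).
  by have := congr1 (fun A : 'rV[Cx R]_(r + r) => A 0 j) c0; rewrite !mxE ofReal0.
move: uR; rewrite !unitmxE !det_map_mx !unitfE !intr_eq0 //.
Qed.

Section SplitWeak.
Variables (R : realType) (r : nat) (G : SKGeometry R r).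
Hypotheses (si : scale_invariant G) (cs : completely_split G).
Local Notation K := (Cx R).
Local Notation V := ('rV[K]_r).
Local Notation pr := (@Defs.proj R r G).

Section Chart.
Variables (U : set (base G)) (Phi : base G * V -> Defs.total G) (P : base G -> 'M[K]_(r + r, r)).
Hypothesis TC : torus_chart pr U Phi P.
Variable c : chart (base G) V.
Hypothesis ac : atlas (base G) c.
Local Notation ok := (chart_ok U c).
Variable N : 'M[int]_(r + r).
Let W z := intmx R N *m P (chart_inv c z).

Let W_hol z i j : ok z -> hol (fun z => W z i j) z.
Proof.
move=> okz; apply: (hol_mulmx (A := fun=> intmx R N)) => a b; first exact: hol_cst.
exact: (P_hol TC ac).
Qed.

Let rowW z a : row a (W z) = lvec P c (row a N) z.
Proof.
by rewrite row_mul /lvec; congr (_ *m _); apply/rowP => j; rewrite !mxE.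
Qed.

Definition proportional z := forall i k l,
  W z (lshift r i) k * W z (rshift r i) l = W z (lshift r i) l * W z (rshift r i) k.

Lemma proportional_closed z : ok z -> ~ proportional z -> \forall y \near z, ~ proportional y.
Proof.
move=> okz np.
have [i [k [l nikl]]] : exists i k l,
    W z (lshift r i) k * W z (rshift r i) l <> W z (lshift r i) l * W z (rshift r i) k.
  apply: contrapT => h; apply: np => i k l; apply: contrapT => h'; apply: h.
  by exists i, k, l.
have h1 := holM (W_hol (lshift r i) k okz) (W_hol (rshift r i) l okz).
have h2 := holM (W_hol (lshift r i) l okz) (W_hol (rshift r i) k okz).
have H := near_neq (@norm_hausdorff _ _) (hol_cont h1) (hol_cont h2) nikl.
near=> y => py; have hy : W y (lshift r i) k * W y (rshift r i) l <> W y (lshift r i) l * W y (rshift r i) k by near: y.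
by apply: hy; exact: py.
Unshelve. all: by end_near. Qed.

Hypothesis uN : intmx R N \in unitmx.

Lemma rowW_neq0 z a : ok z -> row a (W z) != 0.
Proof.
move=> [_ _ Uz]; have [_ _ _ /(_ _ Uz)[hP _ _ _ _]] := TC.
apply/eqP; rewrite row_mul => /hP h.
have e : row a (intmx R N) = 0 by apply: h => b; rewrite !mxE -ofReal_int; exact: ofReal_real.
have : row a (intmx R N) *m invmx (intmx R N) = row a 1%:M by rewrite -row_mul mulmxV.
rewrite e mul0mx => /rowP/(_ a); rewrite !mxE eqxx => /eqP.
by rewrite eq_sym oner_eq0.
Qed.

(* With alpha_a the value of the Liouville form on the a-th period, the relation
   alpha_(r+i) = tau_i alpha_i and d alpha_a = B (row a)^T give alpha_i d tau_i = 0,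
   while d alpha_i has no zero. *)
Lemma tau_const z i : ok z -> (\forall y \near z, proportional y) ->
  exists t : K, \forall y \near z, row (rshift r i) (W y) = t *: row (lshift r i) (W y).
Proof.
move=> okz pz; have [xi [B H]] := liouville_potential si TC ac.
have [k Wk] : exists k, W z (lshift r i) k != 0.
  apply: contrapT => h; have := rowW_neq0 (lshift r i) okz; case/negP; apply/eqP/rowP => k.
  by rewrite [LHS]mxE [RHS]mxE; apply/eqP; apply: contrapT => /negP h'; apply: h; exists k.
pose tau y := W y (rshift r i) k * (W y (lshift r i) k)^-1.
have ht : hol tau z by apply: holM; [exact: W_hol|apply: holV => //; exact: W_hol].
have n0 : \forall y \near z, W y (lshift r i) k <> 0.
  exact: (near_neq (@norm_hausdorff _ _) (hol_cont (W_hol (lshift r i) k okz)) (hol_cont (hol_cst 0 z)) (elimN eqP Wk)).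
have rel : \forall y \near z, row (rshift r i) (W y) = tau y *: row (lshift r i) (W y).
  near=> y; have py : proportional y by near: y.
  have y0 : W y (lshift r i) k <> 0 by near: y.
  apply/rowP => l; rewrite [LHS]mxE [RHS]mxE [X in _ = _ * X]mxE /tau.
  move/eqP: y0 => y0; apply: (mulfI y0); rewrite (py i k l).
  by rewrite mulrA (mulrC (W y (lshift r i) k)) divfK // mulrC.
pose al a y := (xi y *m (row a (W y))^T) 0 0.
have Hal y a j : ok y -> hol (al a) y /\ pd (al a) y (delta_mx 0 j) = (B y *m (row a (W y))^T) j 0.
  move=> oky; have [h1 _ h3] := H y oky.
  have E : al a = (fun z => (xi z *m (lvec P c (row a N) z)^T) 0 0).
    by apply/funext => w; rewrite /al rowW.
  rewrite E rowW; split; last exact: h3.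
  apply: (hol_mulmx (A := xi) (B := fun z => (lvec P c (row a N) z)^T)) => a' b.
    by rewrite ord1; exact: h1.
  apply: (hol_eq _ (n_hol TC ac (row a N) a' oky)); near=> w.
  by rewrite mxE ord1.
have oknear := chart_ok_near TC ac okz.
have dt0 : \forall y \near z, forall j, pd tau y (delta_mx 0 j) = 0.
  have key : \forall y \near z, forall j, pd tau y (delta_mx 0 j) * al (lshift r i) y = 0.
    have reli := nbhs_interior rel; have htn := hol_near ht.
    near=> y => j; have oky : ok y by near: y.
    have hty : hol tau y by near: y.
    have [h1 e1] := Hal y (lshift r i) j oky; have [h2 e2] := Hal y (rshift r i) j oky.
    have rely : \forall w \near y, row (rshift r i) (W w) = tau w *: row (lshift r i) (W w) by near: y.
    have E : \forall w \near y, al (rshift r i) w = tau w * al (lshift r i) w.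
      near=> w; have ew : row (rshift r i) (W w) = tau w *: row (lshift r i) (W w) by near: w.
      by rewrite /al ew linearZ /= -scalemxAr mxE.
    have e3 := pd_eq (delta_mx 0 j) E (holM hty h1).
    move: e2; rewrite e3 (pdM _ hty h1) e1 (nbhs_singleton rely) linearZ /= -scalemxAr [in RHS]mxE -[RHS]add0r.
    by move=> /addIr.
  have key' := nbhs_interior key; have htn := hol_near ht.
  near=> y => j; have oky : ok y by near: y.
  have hty : hol tau y by near: y.
  have keyy : \forall w \near y, forall j, pd tau w (delta_mx 0 j) * al (lshift r i) w = 0 by near: y.
  apply: contrapT => nz.
  have nzn := near_neq (@norm_hausdorff _ _) (hol_cont (hol_pd (delta_mx 0 j) hty)) (hol_cont (hol_cst 0 y)) nz.
  have al0 : \forall w \near y, al (lshift r i) w = 0.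
    near=> w; have kw : forall j, pd tau w (delta_mx 0 j) * al (lshift r i) w = 0 by near: w.
    have nw : pd tau w (delta_mx 0 j) <> 0 by near: w.
    by have /eqP := kw j; rewrite mulf_eq0 => /orP[/eqP/nw//|/eqP].
  have [_ Binj _] := H y oky.
  have : row (lshift r i) (W y) = 0.
    apply: Binj; apply/colP => j'; have [_ <-] := Hal y (lshift r i) j' oky.
    by rewrite (pd_eq _ al0 (hol_cst 0 y)) pd_cst mxE.
  by move/eqP; apply/negP; exact: rowW_neq0.
exists (tau z).
have tc : \forall y \near z, tau y = tau z.
  apply: (pd0_near_const ht); near=> y => h; rewrite pd_delta big1 // => j _.
  have dy : forall j, pd tau y (delta_mx 0 j) = 0 by near: y.
  by rewrite dy mulr0.
near=> y; have <- : tau y = tau z by near: y.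
by near: y.
Unshelve. all: by end_near. Qed.

Lemma proportional_weak z : ok z -> (\forall y \near z, proportional y) ->
  exists Q : 'M[K]_(r + r, r), \forall y \near z, ((P (chart_inv c y))^T <= Q^T)%MS.
Proof.
move=> okz pz; have [t ht] := choice (fun i => tau_const i okz pz).
exists (invmx (intmx R N) *m col_mx 1%:M (diag_mx (\row_i t i))).
have ht' : \forall y \near z, forall i (_ : 'I_1), row (rshift r i) (W y) = t i *: row (lshift r i) (W y).
  by apply: near_all2 => i _; exact: ht.
near=> y; have hy : forall i (_ : 'I_1), row (rshift r i) (W y) = t i *: row (lshift r i) (W y) by near: y.
apply/submxP; exists (usubmx (W y))^T; rewrite -trmx_mul; congr trmx.
rewrite -mulmxA mul_col_mx mul1mx -[LHS](mulKmx uN) -/(W y); congr (_ *m _).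
move: (W y) hy => Wy hy; rewrite -[LHS]vsubmxK; congr col_mx; apply/matrixP => i j.
have /rowP/(_ j) := hy i 0; rewrite mul_diag_mx !mxE //.
Unshelve. all: by end_near. Qed.

End Chart.

Lemma split_weak (u : base G) : exists u, weakly_constant pr u.
Proof.
have [S [oS dS hS]] := cs.
have [u1 [_ Su1]] := dS setT (ex_intro _ u Logic.I) openT.
have [_ /(_ u1)[U [Phi [P [Uu1 TC]]]]] := sk_torus_family G.
have [c ac dc] := atlas_cover u1; pose z1 := chart_map c u1.
have N1 := chart_ok_near TC ac (chart_okP ac dc Uu1).
have N2 := chart_near_inv ac dc (open_nbhs_nbhs (conj oS Su1)).
have /nbhs_rnP[e e0 he] := @filterI _ _ (nbhs_filter z1) _ _ N1 N2.
pose A (N : 'M[int]_(r + r)) : set V := [set z | intmx R N \in unitmx /\ proportional P c N z].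
have [||N [z3 [hz3 hA]]] := @baire_rV R r z1 e _ A e0.
- move=> N x /he[okx _] nA; have [uN|nuN] := boolP (intmx R N \in unitmx).
    have np : ~ proportional P c N x by move=> p; apply: nA.
    have H := proportional_closed TC ac okx np.
    near=> y => -[_ py]; have : ~ proportional P c N y by near: y.
    exact.
  by near=> y => -[]; rewrite (negbTE nuN).
- move=> x /he[[_ _ Ux] Sx]; have [Q [hQ [p hp]]] := hS _ Sx.
  have [_ _ _ /(_ _ Ux) hp'] := TC.
  have [F [v0 [N [uF _ QF]]]] := unif_unique hp' hp; exists N; split.
    by have [hPL _ _ _ _] := hp; exact: intmx_unit hPL uF QF.
  move=> i k l; rewrite -QF /product_lattice mul_col_mx !col_mxEu !col_mxEd !mul_diag_mx !mxE.
  by rewrite mulrACA [RHS]mulrACA; congr (_ * _); rewrite mulrC.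
have [okz3 _] := he _ hz3; have [uN _] := nbhs_singleton hA.
have hp : \forall y \near z3, proportional P c N y.
  by near=> y; have [] : A N y by near: y.
have [Q hQ] := proportional_weak TC ac uN okz3 hp.
have [d3 z3E U3] := okz3; exists (chart_inv c z3), U, Phi, P; split=> //; exists Q.
by apply: (chart_near_pull ac d3); rewrite z3E.
Unshelve. all: by end_near. Qed.

End SplitWeak.

(** * The modulus *)

Section Modulus.
Variables (R : realType) (r : nat) (M : complexManifold R r) (X : complexManifold R (r + r)).
Variable proj : X -> M.
Variable D : 'I_r -> nat.
Hypothesis D0 : forall i, (0 < D i)%N.
Local Notation K := (Cx R).
Local Notation V := ('rV[K]_r).
Local Notation Del := (diag_mx (\row_i (D i)%:R) : 'M[K]_r).

Lemma Del_unit : Del \in unitmx.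
Proof.
rewrite unitmxE det_diag unitfE; apply/prodf_neq0 => i _.
by rewrite mxE pnatr_eq0 -lt0n.
Qed.

Lemma modulus_uniq u s tau tau' : modulus proj u D s tau -> modulus proj u D s tau' -> tau = tau'.
Proof.
move=> [p [P [N [T [U hN uT E1 E2]]]]] [p' [P' [N' [T' [U' hN' uT' E1' E2']]]]].
have [F [v0 [N2 [uF pF _]]]] := unif_unique U U'.
have E : intmx R N' *m P' *m F = intmx R N *m P.
  have introw (A : 'M[int]_(r + r)) a : row a (intmx R A) = intmx R (row a A).
    by apply/rowP => j; rewrite !mxE.
  apply/row_matrixP => a; rewrite !row_mul !introw.
  exact: (loop_class_change U pF (hN a) (hN' a)).
set W := intmx R N' *m P' in E E1' E2'.
have uW : usubmx W \in unitmx.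
  by have := Del_unit; rewrite -E1' unitmx_mul => /andP[].
have TF : T' = F *m T.
  by rewrite -(mulKmx uW T') E1' -E1 -E -mul_usub_mx -mulmxA mulKmx.
by rewrite -E2 -E2' -E TF -mul_dsub_mx mulmxA.
Qed.

Section Lagrangian.
Variables (H : 'M[K]_r) (W : 'M[K]_(r + r, r)).
Hypothesis Hpos : forall v : 'rV[K]_r, v != 0 -> 0 < (map_mx Num.conj v *m H *m v^T) 0 0.
Let J : 'M[int]_(r + r) :=
  block_mx 0 (diag_mx (\row_i (D i)%:Z)) (- diag_mx (\row_i (D i)%:Z)) 0.
Let Ga := map_mx Num.conj W *m H *m W^T.
Hypothesis GaJ : forall a b, 'Im (Ga a b) = (J a b)%:~R.

Let real_mx m n (A : 'M[K]_(m, n)) := forall i j, A i j \is Num.real.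

Let conj_real m n (A : 'M[K]_(m, n)) : real_mx A -> map_mx Num.conj A = A.
Proof. by move=> h; apply/matrixP => i j; rewrite mxE conj_Creal. Qed.

Let Ga_block (b c : 'rV[K]_r) : real_mx b ->
  map_mx Num.conj (b *m usubmx W) *m H *m (c *m usubmx W)^T = b *m ulsubmx Ga *m c^T.
Proof.
move=> hb; rewrite (map_mxM Num.conj b (usubmx W)) (conj_real hb) trmx_mul !mulmxA; congr (_ *m _).
rewrite /Ga /ulsubmx -!mulmxA; congr (b *m _).
apply/matrixP => i j; rewrite !mxE; apply: eq_bigr => k _; rewrite !mxE; congr (_ * _).
by apply: eq_bigr => l _; rewrite !mxE.
Qed.

(* Pair with the second half of the basis. *)
Lemma real_combination0 (b : 'rV[K]_r) : real_mx b -> b *m usubmx W = 0 -> b = 0.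
Proof.
move=> hb b0; have G0 : b *m ursubmx Ga = 0.
  have -> : ursubmx Ga = usubmx (map_mx Num.conj W) *m H *m (dsubmx W)^T.
    apply/matrixP => i j; rewrite !mxE; apply: eq_bigr => k _; rewrite !mxE; congr (_ * _).
    by apply: eq_bigr => l _; rewrite !mxE.
  rewrite !mulmxA (_ : b *m _ = map_mx Num.conj (b *m usubmx W)); last first.
    by rewrite (map_mxM Num.conj b (usubmx W)) (conj_real hb) map_usubmx.
  by rewrite b0 map_mx0 !mul0mx.
apply/rowP => j; rewrite [RHS]mxE.
have : 'Im ((b *m ursubmx Ga) 0 j) = b 0 j * (D j)%:R.
  rewrite mxE raddf_sum (bigD1 j) //= big1 ?addr0 => [|i ij].
    rewrite ImMl // -/(ursubmx Ga j j) [ursubmx Ga j j]mxE mxE GaJ /J block_mxEur mxE mxE eqxx mulr1n.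
    by [].
  rewrite ImMl // [ursubmx Ga i j]mxE mxE GaJ /J block_mxEur mxE (negbTE ij) mulr0n mulr0 //.
rewrite G0 mxE raddf0 => /esym/eqP; rewrite mulf_eq0 pnatr_eq0 -[(D j == 0)%N]negbK -lt0n D0 orbF.
by move/eqP.
Qed.

(* If (a + i b) A = 0 for the first block A of W and real a, b, then w = b A has
   H(w, a A) = - i H(w, w), which is real because A spans an isotropic lattice. *)
Lemma lagrangian_unit : usubmx W \in unitmx.
Proof.
rewrite -row_free_unit -kermx_eq0; apply/eqP/row_matrixP => i; rewrite row0.
set x := row i _; have x0 : x *m usubmx W = 0 by apply/sub_kermxP; exact: row_sub.
pose a : 'rV[K]_r := \row_j 'Re (x 0 j); pose b : 'rV[K]_r := \row_j 'Im (x 0 j).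
have ra : real_mx a by move=> k j; rewrite mxE Creal_Re.
have rb : real_mx b by move=> k j; rewrite mxE Creal_Im.
have xab : x = a + 'i *: b by apply/rowP => j; rewrite !mxE -Crect.
have aE : a *m usubmx W = - 'i *: (b *m usubmx W).
  apply/eqP; rewrite scaleNr -addr_eq0 scalemxAl -mulmxDl -xab x0 //.
pose h := (map_mx Num.conj (b *m usubmx W) *m H *m (b *m usubmx W)^T) 0 0.
have GaR j k : ulsubmx Ga j k \is Num.real.
  by apply/Creal_ImP; rewrite mxE mxE GaJ /J block_mxEul mxE.
have hreal : h \is Num.real.
  rewrite /h (Ga_block b rb) mxE; apply: rpred_sum => k _; rewrite mxE [_^T _ _]mxE rpredM ?rb //.
  by apply: rpred_sum => l _; rewrite rpredM ?rb.
have hI : - 'i * h \is Num.real.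
  have -> : - 'i * h = (map_mx Num.conj (b *m usubmx W) *m H *m (a *m usubmx W)^T) 0 0.
    by rewrite aE linearZ /= -scalemxAr [RHS]mxE.
  rewrite (Ga_block a rb) mxE; apply: rpred_sum => k _; rewrite mxE [_^T _ _]mxE rpredM ?ra //.
  by apply: rpred_sum => l _; rewrite rpredM ?rb.
have h0 : h = 0.
  move/Creal_ImP: hI; rewrite mulNr raddfN /= mulrC ImMl // Im_i mulr1 => /eqP.
  by rewrite oppr_eq0 => /eqP.
have bW : b *m usubmx W = 0.
  by apply/eqP; apply: contraT => /Hpos; rewrite -/h h0 ltxx.
have b0 := real_combination0 rb bW.
have a0 : a = 0 by apply: real_combination0 => //; rewrite aE bW scaler0.
by rewrite xab a0 b0 scaler0 addr0.
Qed.

End Lagrangian.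
End Modulus.

Lemma contractible_ind (R : realType) (T : topologicalType) (C Q : set T) (x0 : T) (H : R * T -> T) :
  {within `[0, 1]%classic `*` C, continuous H} ->
  (forall t x, 0 <= t <= 1 -> C x -> C (H (t, x))) ->
  (forall x, C x -> H (0, x) = x /\ H (1, x) = x0) -> Q x0 ->
  (forall x, C x -> Q x -> \forall y \near x, C y -> Q y) ->
  (forall x, C x -> ~ Q x -> \forall y \near x, C y -> ~ Q y) -> forall x, C x -> Q x.
Proof.
move=> /subspace_continuousP cH hC hx Q0 h1 h2 x Cx.
have near_path (t : R) (S : set T) : 0 <= t <= 1 -> nbhs (H (t, x)) S ->
    \forall s \near t, 0 <= s <= 1 -> S (H (s, x)).
  move=> t01 nS.
  have dom : (`[0, 1]%classic `*` C) (t, x) by split; rewrite //= in_itv.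
  have [[A B] /= [nA nB] AB] := cH (t, x) dom S nS.
  apply: filterS nA => s As s01; apply: (AB (s, x)); first by split=> //; exact: nbhs_singleton nB.
  by split; rewrite //= in_itv.
have [H0 H1] := hx x Cx; rewrite -H0.
apply: (@connected_ind R `[0, 1]%classic (fun t => Q (H (t, x)))).
- exact: segment_connected.
- by exists 1; rewrite /= ?in_itv /= ?ler01 ?lexx // H1.
- move=> t; rewrite /= in_itv /= => t01 Qt.
  apply: filterS (near_path t _ t01 (h1 _ (hC t x t01 Cx) Qt)) => s hs s01.
  by apply: hs; [move: s01; rewrite /= in_itv|apply: hC => //; move: s01; rewrite /= in_itv].
- move=> t; rewrite /= in_itv /= => t01 Qt.
  apply: filterS (near_path t _ t01 (h2 _ (hC t x t01 Cx) Qt)) => s hs s01.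
  by apply: hs; [move: s01; rewrite /= in_itv|apply: hC => //; move: s01; rewrite /= in_itv].
- by rewrite /= in_itv /= ler01 lexx.
Qed.

Lemma mulmx_invM (F : fieldType) n (A S : 'M[F]_n) : A \in unitmx -> S \in unitmx ->
  S *m invmx (A *m S) = invmx A.
Proof.
move=> uA uS; rewrite -[LHS](mulKmx uA) (mulmxA A) mulmxV ?mulmx1 //.
by rewrite unitmx_mul uA.
Qed.

Section Local.
Variables (R : realType) (r : nat) (G : SKGeometry R r).
Local Notation K := (Cx R).
Local Notation V := ('rV[K]_r).
Local Notation pr := (@Defs.proj R r G).
Local Notation pol := (@Defs.pol R r G).
Hypothesis weak : forall U Phi P u, torus_chart pr U Phi P -> U u ->
  exists Q : 'M[K]_(r + r, r), \forall w \near u, ((P w)^T <= Q^T)%MS.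
Variables (C : set (base G)) (D : 'I_r -> nat) (s : base G -> 'I_(r + r) -> R -> Defs.total G).
Hypotheses (pD : polarization_type D) (sb : forall u, C u -> symplectic_basis pr pol u D (s u)).
Hypothesis lc : forall a, locally_constant_class pr C (fun u => s u a).

Let D0 : forall i, (0 < D i)%N. Proof. by have [] := pD. Qed.
Local Notation Del := (diag_mx (\row_i (D i)%:R) : 'M[K]_r).

Lemma period_block_unit u p P (N : 'M[int]_(r + r)) : C u -> uniformizes pr u p P ->
  (forall a, loop_class p P (s u a) (row a N)) -> usubmx (intmx R N *m P) \in unitmx.
Proof.
move=> Cu hp hN; have [hpol _] := @sk_polarized _ _ G.
have [E [Epol _ _ [H [Hh Hpos EH]]]] := hpol u p P hp.
have [_ [_ sJ]] := sb Cu.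
apply: (lagrangian_unit D0 Hpos) => a b.
rewrite -sJ (Epol _ _ _ _ (hN a) (hN b)).
have cN : map_mx Num.conj (intmx R N *m P) = intmx R N *m map_mx Num.conj P.
  rewrite map_mxM; congr (_ *m _); apply/matrixP => i j; rewrite !mxE.
  exact: rmorph_int.
pose Ga := map_mx Num.conj P *m H *m P^T.
have GE k l : 'Im (Ga k l) = (E k l)%:~R.
  rewrite EH map_row -row_mul tr_row; congr ('Im _).
  by rewrite [RHS]mxE /Ga [LHS]mxE; apply: eq_bigr => j _; rewrite !mxE.
have -> : map_mx Num.conj (intmx R N *m P) *m H *m (intmx R N *m P)^T =
    intmx R N *m Ga *m (intmx R N)^T by rewrite cN trmx_mul /Ga !mulmxA.
rewrite mxE raddf_sum /= mxE rmorph_sum /=; apply: eq_bigr => l _.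
rewrite !mxE mulr_suml raddf_sum /= rmorphM /= rmorph_sum /= mulr_suml; apply: eq_bigr => k _.
by rewrite [intmx R N a k]mxE [row a N 0 k]mxE ImMr ?realz // ImMl ?realz // GE rmorphM.
Qed.

Lemma local_modulus u0 : C u0 -> exists tau, \forall u \near u0, C u -> modulus pr u D (s u) tau.
Proof.
move=> Cu0; have [_ /(_ u0)[U [Phi [P [Uu0 TC]]]]] := sk_torus_family G.
have [n hn] := choice (fun a => lc a TC Cu0 Uu0).
pose N := \matrix_a n a : 'M[int]_(r + r).
have [Q hQ] := weak TC Uu0; have [oU _ _ hu] := TC.
have nU := open_nbhs_nbhs (conj oU Uu0).
have hn' : \forall u \near u0, forall a, C u -> loop_class (fun v => Phi (u, v)) (P u) (s u a) (n a).
  by apply: filter_forall => a; exact: hn.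
pose A0 := usubmx (intmx R N *m Q); pose B0 := dsubmx (intmx R N *m Q).
exists (B0 *m invmx A0 *m Del); near=> u => Cu.
have Uu : U u by near: u.
have hna : forall a, C u -> loop_class (fun v => Phi (u, v)) (P u) (s u a) (n a) by near: u.
have hNa a : loop_class (fun v => Phi (u, v)) (P u) (s u a) (row a N) by rewrite rowK; exact: hna.
have /submxP[S PS] : ((P u)^T <= Q^T)%MS by near: u.
have PE : P u = Q *m S^T by apply: trmx_inj; rewrite trmx_mul trmxK.
have uA := period_block_unit Cu (hu u Uu) hNa.
have AE : usubmx (intmx R N *m P u) = A0 *m S^T by rewrite PE mulmxA mul_usub_mx.
have BE : dsubmx (intmx R N *m P u) = B0 *m S^T by rewrite PE mulmxA mul_dsub_mx.
exists (fun v => Phi (u, v)), (P u), N, (invmx (usubmx (intmx R N *m P u)) *m Del); split.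
- exact: hu.
- exact: hNa.
- by rewrite unitmx_mul unitmx_inv uA Del_unit.
- by rewrite mulmxA mulmxV // mul1mx.
have uA' := uA; rewrite AE unitmx_mul in uA'; have /andP[u1 u2] := uA'.
rewrite AE BE mulmxA -(mulmxA B0); congr (_ *m _ *m _).
exact: mulmx_invM.
Unshelve. all: by end_near. Qed.

End Local.

Theorem mainTheorem2 (R : realType) (r : nat) (hr : (0 < r)%N)
    (G : SKGeometry R r) :
  connected [set: base G] ->
  scale_invariant G ->
  completely_split G ->
  isotrivial G.
Proof.
move=> cM si cs C oC [x0 [H [Cx0 cH hC hx]]] D s pD sb lc.
have weak := weak_all cM (sk_torus_family G) (split_weak si cs x0).
have D0 i : (0 < D i)%N by have [] := pD.
have lm := local_modulus weak pD sb lc.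
have [tau0 /nbhs_singleton/(_ Cx0) h0] := lm x0 Cx0.
exists tau0; apply: (contractible_ind cH hC hx h0) => u Cu.
- move=> hu; have [tau ht] := lm u Cu.
  by rewrite (modulus_uniq D0 hu (nbhs_singleton ht Cu)).
- move=> nu; have [tau ht] := lm u Cu; apply: filterS (ht) => w hw Cw h.
  by apply: nu; rewrite (modulus_uniq D0 h (hw Cw)); exact: nbhs_singleton ht Cu.
Qed.
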